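(* Let $\mathsf G$ be an infinite quasicrystalline isoradial graph with $d$ train-track directions which can be lifted to $\mathbb Z^d$ via star-triangle transformations, let $k\in(0,1)$, and let $G$ be the massive Green function of $\mathsf G$ (with its extension to even vertices of $\mathbb Z^d$). Let $x_0,x_1$ be even vertices of $\mathbb Z^d$, and let $(y_m)_{m\ge 1}$ be a sequence of even vertices of $\mathbb Z^d$ such that all the pairs $(x_0,y_m)$ and $(x_1,y_m)$ are admissible, $|y_m-x_0|\to\infty$, and the reduced coordinates of $y_m-x_0$ converge to some $\vec n=(n_1,\dots,n_d)$. Then $$\lim_{m\to\infty}\frac{G(x_1,y_m)}{G(x_0,y_m)}=\mathsf e_{(x_1,x_0)}(u_0),\qquad u_0=2iK'+v_0,$$ where $v_0=v_0(\vec n)\in\mathbb R/4K\mathbb Z$ is the critical point associated with the limiting direction $\vec n$.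
   Context: **Isoradial graphs.** An infinite planar embedded graph $\mathsf G=(\mathsf V,\mathsf E)$ whose bounded faces fill the whole plane is isoradial if every face is inscribed in a circle of radius $1$ whose center lies in the interior of the face. The dual graph $\mathsf G^*$ is embedded with vertices at the circumcenters. The diamond graph $\mathsf G^\diamond$ has as vertices those of $\mathsf G$ and $\mathsf G^*$, each dual vertex being joined to the primal vertices on the boundary of its face; its faces are rhombi of side length $1$, and each edge $e$ of $\mathsf G$ is a diagonal of exactly one rhombus. Let $\overline\theta_e\in(0,\pi/2)$ be the half-angle of this rhombus at a vertex it shares with $e$. It is assumed that there is $\epsilon>0$ with $\overline\theta_e\in(\epsilon,\frac\pi2-\epsilon)$ for all $e$. $\mathsf G$ is quasicrystalline if the edges of $\mathsf G^\diamond$ have finitely many directions; then the edge vectors are $\pm e^{i\overline\alpha_1},\dots,\pm e^{i\overline\alpha_d}$ with $\overline\alpha_1<\dots<\overline\alpha_d<\overline\alpha_1+\pi<\dots<\overline\alpha_d+\pi<\overline\alpha_1+2\pi$. **Lift to $\mathbb Z^d$.** Let $(e_1,\dots,e_d)$ be the canonical basis. Fixing a vertex of $\mathsf G$ sent to $0$, the vertices of $\mathsf G^\diamond$ are lifted to $\mathbb Z^d$ so that an edge with vector $\pm e^{i\overline\alpha_j}$ lifts to the step $\pm e_j$ (vertices of $\mathsf G$ become even vertices, i.e. with even coordinate sum); the image is called a monotone surface. $\mathsf G$ can be lifted to $\mathbb Z^d$ via star-triangle transformations if each of the $d$ coordinates on this surface is bounded neither from above nor from below. For $x\ne y\in\mathbb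 Z^d$ write $y-x=\sum_j N_je_j$, $|y-x|=\sum_j|N_j|$; the reduced coordinates of $y-x$ are $n_j=N_j/|y-x|$. A pair $(x,y)$ (or a vector $\sum_j N_je_j$) is admissible if the set of angles $\{\overline\alpha_j:N_j>0\}\cup\{\overline\alpha_j+\pi:N_j<0\}$ is contained in an arc of length $<\pi$ of $\mathbb R/2\pi\mathbb Z$ (this is always the case for two points of a common monotone surface). **Elliptic notation.** $k\in(0,1)$ is fixed, $k'=\sqrt{1-k^2}$, $K=K(k)$, $E=E(k)$ are the complete elliptic integrals of the first and second kind, $K'=K(k')$, and $\operatorname{sn},\operatorname{cn},\operatorname{dn},\operatorname{sc}=\operatorname{sn}/\operatorname{cn},\operatorname{dc}=\operatorname{dn}/\operatorname{cn}$ are Jacobi functions of modulus $k$. $\mathbb T(k)=\mathbb C/(4K\mathbb Z+4iK'\mathbb Z)$. For any geometric angle, removing the bar means multiplying by $2K/\pi$: $\theta_e=\frac{2K}\pi\overline\theta_e$, $\alpha_j=\frac{2K}\pi\overline\alpha_j$. Set $\mathrm A(u)=\frac1{k'}\big(\int_0^u\operatorname{dc}^2(v)\,dv+\frac{E-K}Ku\big)$. **Massive Laplacian and Green function.** For $f:\mathsf V\to\mathbb C$, $\Delta f(x)=\sum_{z\sim x}\operatorname{sc}(\theta_{xz})(f(x)-f(z))+m^2(x)f(x)$, with $m^2(x)=\sum_{z\sim x}(\mathrm A(\theta_{xz})-\operatorname{sc}(\theta_{xz}))$. The massive Green function $G$ is the inverse of $\Delta$. **Exponential function.** For $x,y\in\mathbb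 Z^d$ with $y-x=\sum_jN_je_j$, $\mathsf e_{(x,y)}(u)=\prod_{j=1}^d\big(i\sqrt{k'}\operatorname{sc}(\tfrac{u-\alpha_j}2)\big)^{N_j}$ (for vertices of $\mathsf G$, use their lifts). **Extension of $G$.** For $x,y\in\mathsf V$ it is known that $G(x,y)=\frac{k'}{4i\pi}\int_{\Gamma_{x,y}}\mathsf e_{(x,y)}(u)\,du$, where $\Gamma_{x,y}$ is a vertical closed contour $\{\varphi+is:s\in[0,4K']\}$ on $\mathbb T(k)$, oriented upwards, with $\varphi\frac{\pi}{2K}$ equal to the angle of the ray from $x$ to $y$; equivalently $\varphi$ may be taken anywhere in the shortest arc containing the zeros $\{\alpha_j:N_j>0\}\cup\{\alpha_j+2K:N_j<0\}$ of $\mathsf e_{(x,y)}$ (any $\varphi$ if $x=y$). The same formula gives the extension of $G$, via star-triangle transformations, to admissible pairs of even vertices of $\mathbb Z^d$. **The point $v_0$.** For a limit $\vec n$ of admissible reduced coordinates, $v_0(\vec n)$ is the unique $v$ in $\alpha+(-K+\varepsilon,K-\varepsilon)$ such that $\sum_{j=1}^dn_j\frac{\operatorname{sn}\operatorname{cn}}{\operatorname{dn}}\big(\frac{v-\alpha_j}2\big)=0$, where $\varepsilon>0$ and $\alpha$ are such that the open arc $\alpha+(-K+\varepsilon,K-\varepsilon)\subset\mathbb R/4K\mathbb Z$ contains $\{\alpha_j:n_j>0\}\cup\{\alpha_j+2K:n_j<0\}$. (Equivalently $v_0$ is the critical point in that arc of $\chi(v)=\sum_jn_j\log\big|\sqrt{k'}\operatorname{sc}(\frac{v+2iK'-\alpha_j}2)\big|$.)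 *)

(* Defs.v *)
(* Stdlib reals and Coquelicot; from MathComp only finite types and big
   operators, to index coordinates by 'I_d.  The plane is Coquelicot's C. *)
From Stdlib Require Import Reals ZArith List ClassicalEpsilon Lra.
From mathcomp Require Import ssreflect ssrfun ssrbool eqtype ssrnat seq.
From mathcomp Require Import fintype bigop.
From Coquelicot Require Import Coquelicot.

Set Implicit Arguments.
Unset Strict Implicit.
Unset Printing Implicit Defensive.

Open Scope R_scope.

Definition ell_F (k phi : R) : R :=
  RInt (fun t => / sqrt (1 - k ^ 2 * sin t ^ 2)) 0 phi.
Definition ell_K (k : R) : R := ell_F k (PI / 2).
Definition ell_E (k : R) : R :=
  RInt (fun t => sqrt (1 - k ^ 2 * sin t ^ 2)) 0 (PI / 2).

Definition compl_mod (k : R) : R := sqrt (1 - k ^ 2).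
Definition ell_K' (k : R) : R := ell_K (compl_mod k).

(* For 0 < k < 1, [ell_F k] is an increasing bijection of R: Jacobi's amplitude
   [am k] is its inverse. *)
Definition am (k u : R) : R :=
  epsilon (inhabits 0) (fun phi => ell_F k phi = u).
Definition sn (k u : R) : R := sin (am k u).
Definition cn (k u : R) : R := cos (am k u).
Definition dn (k u : R) : R := sqrt (1 - k ^ 2 * sn k u ^ 2).
Definition sc (k u : R) : R := sn k u / cn k u.
Definition dc (k u : R) : R := dn k u / cn k u.

(* Complex argument x + iy: the addition theorem combined with Jacobi's
   imaginary transformation, where s, c, d have modulus k at x and s1, c1, d1
   have the complementary modulus at y.  The common denominator [Cden] vanishes
   exactly at the poles of sn and cn. *)
Definition Cden (k : R) (z : C) : R :=
  cn (compl_mod k) (Im z) ^ 2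
  + k ^ 2 * sn k (Re z) ^ 2 * sn (compl_mod k) (Im z) ^ 2.

Definition Csn (k : R) (z : C) : C :=
  let s := sn k (Re z) in let c := cn k (Re z) in let d := dn k (Re z) in
  let s1 := sn (compl_mod k) (Im z) in
  let c1 := cn (compl_mod k) (Im z) in
  let d1 := dn (compl_mod k) (Im z) in
  ((s * d1 / Cden k z, c * d * s1 * c1 / Cden k z) : C).

Definition Ccn (k : R) (z : C) : C :=
  let s := sn k (Re z) in let c := cn k (Re z) in let d := dn k (Re z) in
  let s1 := sn (compl_mod k) (Im z) in
  let c1 := cn (compl_mod k) (Im z) in
  let d1 := dn (compl_mod k) (Im z) in
  ((c * c1 / Cden k z, - (s * d * s1 * d1) / Cden k z) : C).

(* The pointwise quotient [Csn / Ccn] is 0/0 at the common poles of sn and cn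
   (z = iK' modulo periods), where the meromorphic function sc is finite.  Here
   the factor common to numerator and denominator has been cancelled, so that
   the denominator vanishes only at the poles of sc: see [Csc_Ccn]. *)
Definition Csc (k : R) (z : C) : C :=
  let s := sn k (Re z) in let c := cn k (Re z) in let d := dn k (Re z) in
  let s1 := sn (compl_mod k) (Im z) in
  let c1 := cn (compl_mod k) (Im z) in
  let d1 := dn (compl_mod k) (Im z) in
  let den := 1 - s ^ 2 * d1 ^ 2 in
  ((s * c * c1 * d1 / den, d * s1 / den) : C).

Lemma cn_sqr (k u : R) : cn k u ^ 2 = 1 - sn k u ^ 2.
Proof. by rewrite /cn /sn; have := sin2_cos2 (am k u); rewrite /Rsqr => h; nra. Qed.

Lemma dn_sqr (k u : R) : 0 < k < 1 -> dn k u ^ 2 = 1 - k ^ 2 * sn k u ^ 2.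
Proof.
move=> [k0 k1]; rewrite /dn /= !Rmult_1_r sqrt_sqrt //.
have := cn_sqr k u; rewrite /= !Rmult_1_r => h.
have h2 : 0 <= cn k u * cn k u by apply: Rle_0_sqr.
have h3 : 0 <= sn k u * sn k u by apply: Rle_0_sqr.
have h4 : 0 <= k * k <= 1 by nra.
have h5 : sn k u * sn k u <= 1 by lra.
have h6 : k * k * (sn k u * sn k u) <= 1 * 1 by apply: Rmult_le_compat; lra.
lra.
Qed.

Lemma compl_mod_bounds (k : R) : 0 < k < 1 -> 0 < compl_mod k < 1.
Proof.
move=> [k0 k1]; rewrite /compl_mod; split; first by apply: sqrt_lt_R0; nra.
by rewrite -[X in _ < X]sqrt_1; apply: sqrt_lt_1_alt; nra.
Qed.

Lemma compl_mod_sqr (k : R) : 0 < k < 1 -> compl_mod k ^ 2 = 1 - k ^ 2.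
Proof. by move=> [k0 k1]; rewrite /compl_mod pow2_sqrt //; nra. Qed.

Lemma Csc_Ccn (k : R) (z : C) : 0 < k < 1 ->
  Cden k z <> 0 -> Ccn k z <> RtoC 0 -> Csc k z = Cdiv (Csn k z) (Ccn k z).
Proof.
move=> hk hD hC.
have cS := cn_sqr k (Re z); have c1S := cn_sqr (compl_mod k) (Im z).
have dS := dn_sqr (Re z) hk.
have d1S := dn_sqr (Im z) (compl_mod_bounds hk).
rewrite compl_mod_sqr // in d1S.
move: hD hC; rewrite /Csc /Csn /Ccn.
have : Cden k z = cn (compl_mod k) (Im z) ^ 2
  + k ^ 2 * sn k (Re z) ^ 2 * sn (compl_mod k) (Im z) ^ 2 by [].
move: (Cden k z) cS c1S dS d1S.
move: (sn k (Re z)) (cn k (Re z)) (dn k (Re z)) (sn _ (Im z)) (cn _ (Im z))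
  (dn _ (Im z)) => s c d s1 c1 d1 D cS c1S dS d1S DE hD hC.
have DE2 : D = 1 - d ^ 2 * s1 ^ 2 by rewrite DE c1S dS; ring.
have E2 : (c * c1) ^ 2 + (s * d * s1 * d1) ^ 2 = D * (1 - s ^ 2 * d1 ^ 2).
  rewrite !Rpow_mult_distr DE cS c1S dS d1S; ring.
have hden : 1 - s ^ 2 * d1 ^ 2 <> 0.
  move=> h0; apply: hC.
  rewrite h0 Rmult_0_r in E2.
  have a0 : c * c1 = 0 by nra.
  have b0 : s * d * s1 * d1 = 0 by nra.
  by rewrite a0 b0; apply: injective_projections => /=; field.
have hprod : (Cmult (s * c * c1 * d1 / (1 - s ^ 2 * d1 ^ 2),
                     d * s1 / (1 - s ^ 2 * d1 ^ 2))
   (c * c1 / D, - (s * d * s1 * d1) / D)) = (s * d1 / D, c * d * s1 * c1 / D).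
  have H1 : c ^ 2 * c1 ^ 2 + d ^ 2 * s1 ^ 2 = 1 - s ^ 2 * d1 ^ 2.
    rewrite cS c1S dS d1S; ring.
  have hden2 : 1 - (s * d1) ^ 2 <> 0 by rewrite Rpow_mult_distr.
  rewrite /Cmult /fst /snd; congr pair; last by field; split.
  transitivity (s * d1 * (c ^ 2 * c1 ^ 2 + d ^ 2 * s1 ^ 2)
                / ((1 - s ^ 2 * d1 ^ 2) * D)); first by field; split.
  by rewrite H1; field; split.
by rewrite -hprod /Cdiv -Cmult_assoc Cinv_r // Cmult_1_r.
Qed.


Definition angle_scale (k abar : R) : R := 2 * ell_K k / PI * abar.

(* Only meaningful on (-K, K), where dc has no pole. *)
Definition fA (k u : R) : R :=
  / compl_mod k * (RInt (fun v => dc k v ^ 2) 0 u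
                   + (ell_E k - ell_K k) / ell_K k * u).

Definition cis (t : R) : C := (cos t, sin t).

Record geom_graph : Type := GeomGraph {
  vertex : Type;
  pos : vertex -> C;
  nbrs : vertex -> list vertex
}.

Definition adj (g : geom_graph) (x z : vertex g) : Prop := In z (nbrs x).

Definition on_edge (g : geom_graph) (x z : vertex g) (p : C) : Prop :=
  exists t : R, 0 <= t <= 1 /\
    p = Cplus (Cmult (RtoC (1 - t)) (pos x)) (Cmult (RtoC t) (pos z)).

(* Local finiteness in the plane is part of the notion of an infinite embedded
   graph: every disc meets finitely many vertices and edges. *)
Definition planar_embedded (g : geom_graph) : Prop :=
  [/\ (forall x z : vertex g, pos x = pos z -> x = z),
      (forall x : vertex g, NoDup (nbrs x) /\ ~ adj x x),
      (forall x z : vertex g, adj x z -> adj z x)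
    & (forall r : R, exists l : list (vertex g),
         (forall x, Cmod (pos x) <= r -> In x l) /\
         (forall x z p, adj x z -> on_edge x z p -> Cmod p <= r -> In x l))]
  /\
  (forall (x z w : vertex g), adj x z -> on_edge x z (pos w) ->
     w = x \/ w = z) /\
  (forall (x z x' z' : vertex g) (p : C), adj x z -> adj x' z' ->
     on_edge x z p -> on_edge x' z' p ->
     (x' = x /\ z' = z) \/ (x' = z /\ z' = x) \/
     exists w, p = pos w /\ (w = x \/ w = z) /\ (w = x' \/ w = z')).

Definition drawing (g : geom_graph) (p : C) : Prop :=
  (exists x : vertex g, p = pos x) \/
  (exists x z : vertex g, adj x z /\ on_edge x z p).

Definition joined_off (g : geom_graph) (p q : C) : Prop :=
  exists gamma : R -> C,
    [/\ (forall t, continuous gamma t), gamma 0 = p, gamma 1 = q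
      & (forall t, 0 <= t <= 1 -> ~ drawing g (gamma t))].

(* Faces are the connected components of the complement of the drawing (an open
   set, so that they are its path components). *)
Definition is_face (g : geom_graph) (F : C -> Prop) : Prop :=
  exists p, ~ drawing g p /\ forall q, F q <-> joined_off g p q.

Definition closure_pt (F : C -> Prop) (q : C) : Prop :=
  forall eps : posreal, exists p, F p /\ Cmod (Cminus p q) < eps.

Definition bounded_set (F : C -> Prop) : Prop :=
  exists r : R, forall p, F p -> Cmod p <= r.

Definition circumcenter (g : geom_graph) (F : C -> Prop) (c : C) : Prop :=
  locally c F /\
  forall x : vertex g, closure_pt F (pos x) -> Cmod (Cminus (pos x) c) = 1.

Definition isoradial (g : geom_graph) : Prop :=
  [/\ planar_embedded g,
      (forall l : list (vertex g), exists x, ~ In x l),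
      (forall p : C, exists F, [/\ is_face g F, bounded_set F & closure_pt F p])
    & (forall F, is_face g F -> exists c, circumcenter g F c)].

Definition diamond_vertex (g : geom_graph) (p : C) : Prop :=
  (exists x : vertex g, p = pos x) \/
  (exists F, is_face g F /\ circumcenter g F p).

Definition diamond_edge (g : geom_graph) (x : vertex g) (c : C) : Prop :=
  exists F, [/\ is_face g F, circumcenter g F c & closure_pt F (pos x)].

(* The edge xz is a diagonal of a rhombus of side length 1, whose half-angle at
   x is therefore the arc cosine of |z - x| / 2. *)
Definition half_angle (g : geom_graph) (x z : vertex g) : R :=
  acos (Cmod (Cminus (pos z) (pos x)) / 2).

Definition bounded_angles (g : geom_graph) : Prop :=
  exists eps : R, 0 < eps /\
    forall x z : vertex g, adj x z -> eps < half_angle x z < PI / 2 - eps.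

Definition quasicrystalline (g : geom_graph) (d : nat) (abar : 'I_d -> R)
    : Prop :=
  [/\ (forall i j : 'I_d, (i < j)%N -> abar i < abar j),
      (forall i j : 'I_d, abar j < abar i + PI),
      (forall (x : vertex g) c, diamond_edge x c -> exists j,
         Cminus c (pos x) = cis (abar j) \/
         Cminus c (pos x) = Copp (cis (abar j)))
    & (forall j : 'I_d, exists (x : vertex g) c, diamond_edge x c /\
         (Cminus c (pos x) = cis (abar j) \/
          Cminus c (pos x) = Copp (cis (abar j))))].

Definition Zd (d : nat) : Type := 'I_d -> Z.

Definition basis_vec (d : nat) (j : 'I_d) : Zd d :=
  fun i => if i == j then 1%Z else 0%Z.

(* [lift] is only meaningful on [diamond_vertex g]. *)
Definition is_lift (g : geom_graph) (d : nat) (abar : 'I_d -> R)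
    (lift : C -> Zd d) : Prop :=
  (exists x : vertex g, forall i, lift (pos x) i = 0%Z) /\
  (forall (x : vertex g) c j, diamond_edge x c ->
     (Cminus c (pos x) = cis (abar j) ->
      forall i, lift c i = (lift (pos x) i + basis_vec j i)%Z) /\
     (Cminus c (pos x) = Copp (cis (abar j)) ->
      forall i, lift c i = (lift (pos x) i - basis_vec j i)%Z)).

Definition liftable (g : geom_graph) (d : nat) (lift : C -> Zd d) : Prop :=
  forall (j : 'I_d) (M : Z),
    (exists p, diamond_vertex g p /\ (M < lift p j)%Z) /\
    (exists p, diamond_vertex g p /\ (lift p j < M)%Z).

Definition even_vertex (d : nat) (x : Zd d) : Prop :=
  Z.Even (\big[Z.add/0%Z]_(j < d) x j).

Definition dist1 (d : nat) (x y : Zd d) : Z :=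
  \big[Z.add/0%Z]_(j < d) Z.abs (y j - x j).

Definition reduced_coord (d : nat) (x y : Zd d) (j : 'I_d) : R :=
  IZR (y j - x j) / IZR (dist1 x y).

Definition admissible (d : nat) (abar : 'I_d -> R) (x y : Zd d) : Prop :=
  exists a L : R, [/\ 0 <= L, L < PI
    & forall j : 'I_d,
      ((0 < y j - x j)%Z -> exists m : Z,
         a <= abar j + 2 * PI * IZR m <= a + L) /\
      ((y j - x j < 0)%Z -> exists m : Z,
         a <= abar j + PI + 2 * PI * IZR m <= a + L)].

Definition mass2 (g : geom_graph) (k : R) (x : vertex g) : R :=
  \big[Rplus/0]_(z <- nbrs x)
    (fA k (angle_scale k (half_angle x z))
     - sc k (angle_scale k (half_angle x z))).

Definition massive_laplacian (g : geom_graph) (k : R) (f : vertex g -> C)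
    (x : vertex g) : C :=
  Cplus
    (\big[Cplus/RtoC 0]_(z <- nbrs x)
       Cmult (RtoC (sc k (angle_scale k (half_angle x z))))
             (Cminus (f x) (f z)))
    (Cmult (RtoC (mass2 k x)) (f x)).

Definition square_summable (T : Type) (f : T -> C) : Prop :=
  exists M : R, forall l : list T, NoDup l ->
    \big[Rplus/0]_(z <- l) (Cmod (f z) ^ 2) <= M.

(* [Gr] is the matrix of the inverse of the massive Laplacian on l^2(V). *)
Definition massive_green (g : geom_graph) (k : R)
    (Gr : vertex g -> vertex g -> C) : Prop :=
  forall y : vertex g,
    [/\ square_summable (fun x => Gr x y),
        massive_laplacian k (fun x => Gr x y) y = RtoC 1
      & forall x, x <> y -> massive_laplacian k (fun z => Gr z y) x = RtoC 0].

Definition Cpow_Z (z : C) (n : Z) : C :=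
  match n with
  | Z0 => RtoC 1
  | Zpos p => Cpow z (Pos.to_nat p)
  | Zneg p => Cinv (Cpow z (Pos.to_nat p))
  end.

(* Where sc has a pole, [Csc] is 0/0 = 0 and so is its inverse; hence a factor
   with negative exponent takes there its correct value 0. *)
Definition exp_fun (k : R) (d : nat) (abar : 'I_d -> R) (x y : Zd d) (u : C)
    : C :=
  \big[Cmult/RtoC 1]_(j < d)
    Cpow_Z (Cmult (Cmult Ci (RtoC (sqrt (compl_mod k))))
              (Csc k (Cdiv (Cminus u (RtoC (angle_scale k (abar j))))
                           (RtoC 2))))
           (y j - x j).

(* Integral over {phi + i s : 0 <= s <= T}, oriented upwards: du = i ds. *)
Definition vertical_int (f : C -> C) (phi T : R) : C :=
  Cmult Ci (RInt (V := C_R_CompleteNormedModule) (fun s => f (phi, s)) 0 T).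

(* phi * PI / (2K) is the angle of the ray from x to y in the plane, where
   y - x projects to sum_j N_j cis (abar j); if x = y, phi is arbitrary. *)
Definition ray_abscissa (k : R) (d : nat) (abar : 'I_d -> R) (x y : Zd d)
    (phi : R) : Prop :=
  exists r : R, 0 <= r /\
    \big[Cplus/RtoC 0]_(j < d)
       Cmult (RtoC (IZR (y j - x j))) (cis (abar j))
    = Cmult (RtoC r) (cis (phi * (PI / (2 * ell_K k)))).

(* [G] is the massive Green function on pairs of vertices of the graph (through
   their lifts), and is given by the local integral formula on all admissible
   pairs of even vertices of Z^d.  It is unconstrained on other pairs. *)
Definition extended_green (g : geom_graph) (d : nat) (abar : 'I_d -> R)
    (lift : C -> Zd d) (k : R) (G : Zd d -> Zd d -> C) : Prop :=
  massive_green k (fun x y : vertex g => G (lift (pos x)) (lift (pos y))) /\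
  (forall (x y : Zd d) (phi : R),
     even_vertex x -> even_vertex y -> admissible abar x y ->
     ray_abscissa k abar x y phi ->
     G x y = Cmult (Cdiv (RtoC (compl_mod k)) (Cmult (RtoC (4 * PI)) Ci))
               (vertical_int (exp_fun k abar x y) phi (4 * ell_K' k))).

(* t belongs to a + (-K + eps, K - eps) in R / 4K Z. *)
Definition in_arc (k a eps t : R) : Prop :=
  exists m : Z, a - ell_K k + eps < t + 4 * ell_K k * IZR m
                                  < a + ell_K k - eps.

Definition is_critical_point (k : R) (d : nat) (abar n : 'I_d -> R) (v : R)
    : Prop :=
  (exists eps a : R,
     [/\ 0 < eps,
         (forall j : 'I_d,
            (0 < n j -> in_arc k a eps (angle_scale k (abar j))) /\
            (n j < 0 ->
               in_arc k a eps (angle_scale k (abar j) + 2 * ell_K k)))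
       & in_arc k a eps v])
  /\
  \big[Rplus/0]_(j < d)
     (let w := (v - angle_scale k (abar j)) / 2 in
      n j * (sn k w * cn k w / dn k w)) = 0.

(* A real representative of the point v_0 of R / 4K Z. *)
Definition critical_point (k : R) (d : nat) (abar n : 'I_d -> R) : R :=
  epsilon (inhabits 0) (is_critical_point k abar n).

(* Main.v *)
From HB Require Import structures.
Require Import Defs.
From Stdlib Require Import Reals ZArith Lra Lia ClassicalEpsilon.
From mathcomp Require Import ssreflect ssrfun ssrbool eqtype ssrnat seq choice.
From mathcomp Require Import fintype finfun bigop.
From Coquelicot Require Import Coquelicot.

Set Implicit Arguments.
Unset Strict Implicit.
Unset Printing Implicit Defensive.

Open Scope R_scope.

(** Both Green functions are integrals of exponential functions over a vertical
    contour, and [exp_fun k abar x1 y] is [exp_fun k abar x0 y] times the factor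
    [exp_fun k abar x1 x0], which does not depend on [y].  So the theorem says
    that the complex measure with density [exp_fun k abar x0 (y m)], once it is
    normalized, concentrates at the saddle point [u0 = v0 + 2 i K'].

    Saddle point.  A product of factors [i sqrt(k') sc((u - b) / 2)] raised to
    nonnegative powers is studied on a line [Re u = v].  Put
    [t = sn(Im u / 2, k') ^ 2], which grows from 0 to 1 as the point rises to the
    height [2 K'] of the saddle point.  The derivative in [t] of the logarithm of
    the modulus of a factor is half of [slope], and its argument is an arc tangent
    whose linear part is proportional to [snc = sn cn / dn] at [(v - b) / 2].
    The equation of the critical point, a vanishing weighted sum of values of
    [snc], does two things at once: it cancels the linear parts of the phases
    ([phase_cubic]), and it makes the modulus increase all the way up to the
    saddle point ([balanced_slope_gt0]).  The second fact holds because
    [slope / snc] decreases on [(0, K)] and has period [K]: for points in an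
    interval of length [K] around 0, the graph of [slope] over [snc] lies above a
    line through the origin, and the balance condition integrates this line to 0.
    Monotonicity gives the global estimate from the local quadratic one, and
    Laplace's method follows ([laplace_concentration], [saddle_concentration]).

    Contour.  A factor is holomorphic between its poles [b - 2 K] and [b + 2 K],
    and the integrand has period [4 i K'] because the vertices are even; so the
    contour may be moved between the poles ([vertical_integral_shift],
    [fac_prod_shift]).  For each [m] it is moved to the exact critical point of
    the exponents used, which tends to [v0] since [v0] is a simple zero of the
    limiting balance ([saddle_location]).

    Comparison.  The quotient of the two integrands may have poles on the
    contour, away from the saddle point.  Therefore the two exponential functions
    are written as [E g0] and [E g1], where the exponents of [E] are the minima of
    the two families of exponents.  Then [g0] and [g1] are free of poles on the
    contour, and they take finitely many values because the exponents differ
    by a bounded amount.  Both integrals are compared with that of [E]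
    ([ratio_limit]).

    Angles.  Reversing a direction inverts the factor and moves its zero by
    [2 K].  So an exponential function is a product of nonnegative powers indexed
    by signed directions ([exp_fun_fac_prod]), and admissibility puts the zeros of
    all these factors in an arc shorter than [2 K].  The critical point lies
    between two zeros of the limiting direction, hence in this arc
    ([admissible_arc_near]), which makes the above estimates available. *)

(** * Finite sums, products and families *)

Lemma RplusA : associative Rplus. Proof. by move=> x y z; ring. Qed.
Lemma RplusC : commutative Rplus. Proof. by move=> x y; ring. Qed.
Lemma Rplus0 : left_id 0 Rplus. Proof. by move=> x; ring. Qed.
Lemma RmultA : associative Rmult. Proof. by move=> x y z; ring. Qed.
Lemma RmultC : commutative Rmult. Proof. by move=> x y; ring. Qed.
Lemma Rmult1 : left_id 1 Rmult. Proof. by move=> x; ring. Qed.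
HB.instance Definition _ := Monoid.isComLaw.Build R 0 Rplus RplusA RplusC Rplus0.
HB.instance Definition _ := Monoid.isComLaw.Build R 1 Rmult RmultA RmultC Rmult1.
HB.instance Definition _ :=
  Monoid.isMulLaw.Build R 0 Rmult Rmult_0_l Rmult_0_r.
HB.instance Definition _ := Monoid.isAddLaw.Build R Rmult Rplus
  Rmult_plus_distr_r Rmult_plus_distr_l.
HB.instance Definition _ := Monoid.isComLaw.Build C (RtoC 1) Cmult
  Cmult_assoc Cmult_comm Cmult_1_l.
HB.instance Definition _ := Monoid.isComLaw.Build C (RtoC 0) Cplus
  Cplus_assoc Cplus_comm Cplus_0_l.
HB.instance Definition _ := Monoid.isComLaw.Build Z 0%Z Z.add
  Z.add_assoc Z.add_comm Z.add_0_l.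

Section FiniteSums.
Context (I : finType).
Implicit Types (f g w : I -> R).

Lemma sumR_ge0 f : (forall i, 0 <= f i) -> 0 <= \big[Rplus/0]_i f i.
Proof. by move=> h; elim/big_ind: _ => // [|x y]; lra. Qed.

Lemma sumR_le f g : (forall i, f i <= g i) ->
  \big[Rplus/0]_i f i <= \big[Rplus/0]_i g i.
Proof. by move=> h; elim/big_ind2: _ => // [|*]; lra. Qed.

Lemma sumR_gt0 f i : (forall i, 0 <= f i) -> 0 < f i -> 0 < \big[Rplus/0]_i f i.
Proof.
move=> h hi; rewrite (bigD1 i) //=.
have : 0 <= \big[Rplus/0]_(j | j != i) f j by elim/big_ind: _ => // [|x y]; lra.
lra.
Qed.

Lemma sumR_mull (c : R) f : \big[Rplus/0]_i (c * f i) = c * \big[Rplus/0]_i f i.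
Proof. by rewrite big_distrr. Qed.

Lemma sumR_lin (c : R) f g : \big[Rplus/0]_i (f i + c * g i) =
  \big[Rplus/0]_i f i + c * \big[Rplus/0]_i g i.
Proof. by rewrite big_split sumR_mull. Qed.

Lemma sumR_abs_le f : Rabs (\big[Rplus/0]_i f i) <= \big[Rplus/0]_i Rabs (f i).
Proof.
elim/big_ind2: _ => [|x x' y y' h1 h2|i _]; last by lra.
  by rewrite Rabs_R0; lra.
by apply: Rle_trans (Rabs_triang _ _) _; lra.
Qed.

Lemma common_scale (P : I -> R -> Prop) :
  (forall i e e', 0 < e' <= e -> P i e -> P i e') ->
  (forall i, exists e, 0 < e /\ P i e) -> exists e, 0 < e /\ forall i, P i e.
Proof.
move=> hmono hex.
have [e [e0 he]] : exists e, 0 < e /\ forall i, i \in enum I -> P i e.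
  elim: (enum I) => [|i s [e [e0 he]]]; first by exists 1; split; [lra|].
  have [e' [e'0 he']] := hex i.
  exists (Rmin e e'); have m := Rmin_pos _ _ e0 e'0; split => // j.
  rewrite in_cons => /orP [/eqP ->|hj].
    by apply: hmono he'; have := Rmin_r e e'; lra.
  by apply: hmono (he j hj); have := Rmin_l e e'; lra.
by exists e; split => // i; apply: he; rewrite mem_enum.
Qed.

Lemma finite_max (x : I -> R) (i0 : I) : exists i, forall j, x j <= x i.
Proof.
have [i hi] : exists i, forall j, j \in enum I -> x j <= x i.
  elim: (enum I) => [|a s [i hi]]; first by exists i0.
  have [h|h] := Rle_or_lt (x a) (x i).
    by exists i => j; rewrite in_cons => /orP [/eqP ->|/hi].
  exists a => j; rewrite in_cons => /orP [/eqP ->|/hi]; lra.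
by exists i => j; apply: hi; rewrite mem_enum.
Qed.

(** Finiteness leaves room at both ends, which makes an open interval possible. *)
Lemma common_interval (x : I -> R) (D : R) : 0 < D ->
  (forall i j, x i - x j < D) -> exists A, forall i, A < x i < A + D.
Proof.
move=> D0 h; have [i0 _|noI] := pickP (fun _ : I => true); last first.
  by exists 0 => i; have := noI i.
have [M hM] := finite_max x i0.
have [m hm] := finite_max (fun i => - x i) i0.
exists ((x M - D + x m) / 2) => i; have := hM i; have := hm i; have := h M m; lra.
Qed.

End FiniteSums.

Lemma is_derive_continuity_pt (f : R -> R) x l :
  is_derive f x l -> continuity_pt f x.
Proof.
move=> h; apply/continuity_pt_filterlim; apply: ex_derive_continuous.
by exists l.
Qed.

(** * The amplitude and the Jacobi functions *)

Section Jacobi.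
Context (k : R) (hk : 0 < k < 1).

Let rad (t : R) := 1 - k ^ 2 * sin t ^ 2.

Lemma rad_bounds t : 0 < rad t <= 1.
Proof.
have h1 := sin2_cos2 t; rewrite /Rsqr in h1.
have h2 := pow2_ge_0 (sin t); have h3 := pow2_ge_0 (cos t).
have h4 : 0 < k ^ 2 < 1 by nra.
rewrite /rad; split; nra.
Qed.

Lemma sqrt_rad_bounds t : 0 < sqrt (rad t) <= 1.
Proof.
have [h0 h1] := rad_bounds t.
split; first exact: sqrt_lt_R0.
by rewrite -sqrt_1; apply: sqrt_le_1_alt.
Qed.

Lemma continuous_inv_sqrt_rad t : continuous (fun t => / sqrt (rad t)) t.
Proof.
apply: ex_derive_continuous; rewrite /rad; auto_derive.
have [h1 _] := rad_bounds t; have [h2 _] := sqrt_rad_bounds t.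
by split; [exact: h1 | split => //; exact: Rgt_not_eq].
Qed.

Lemma ell_F_derive phi : is_derive (ell_F k) phi (/ sqrt (rad phi)).
Proof.
apply: (is_derive_RInt (fun t => / sqrt (rad t)) (ell_F k) 0 phi).
  exists (mkposreal 1 Rlt_0_1) => y _; apply: RInt_correct.
  by apply: ex_RInt_continuous => z _; apply: continuous_inv_sqrt_rad.
exact: continuous_inv_sqrt_rad.
Qed.

Lemma ell_F_0 : ell_F k 0 = 0.
Proof. by rewrite /ell_F RInt_point. Qed.

(** The integrand is at least [1], so that [ell_F k] expands distances and its
    inverse, the amplitude, contracts them. *)
Lemma ell_F_expand a b : a <= b -> b - a <= ell_F k b - ell_F k a.
Proof.
move=> ab.
have [c [_ ->]] := MVT_gen (ell_F k) a b (fun x => / sqrt (rad x))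
  (fun x _ => ell_F_derive x)
  (fun x _ => is_derive_continuity_pt (ell_F_derive x)).
have [h0 h1] := sqrt_rad_bounds c.
have : 1 <= / sqrt (rad c) by rewrite -Rinv_1; apply: Rinv_le_contravar.
nra.
Qed.

Lemma ell_F_continuity : continuity (ell_F k).
Proof.
by move=> x; apply: is_derive_continuity_pt (ell_F_derive x).
Qed.

Lemma ell_F_am u : ell_F k (am k u) = u.
Proof.
apply: (epsilon_spec (inhabits 0) (fun phi => ell_F k phi = u)).
have h1 := ell_F_expand (a := 0) (b := Rabs u) (Rabs_pos u).
have h2 : - Rabs u <= 0 by have := Rabs_pos u; lra.
have {}h2 := ell_F_expand h2.
rewrite ell_F_0 in h1 h2.
have h3 : - Rabs u <= u <= Rabs u by split_Rabs; lra.
have [x [_ hx]] : {x : R | Rmin (- Rabs u) (Rabs u) <= x <= Rmax (- Rabs u) (Rabs u)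
    /\ ell_F k x = u}.
  apply: (IVT_gen _ _ _ u ell_F_continuity).
  rewrite Rmin_left ?Rmax_right; lra.
by exists x.
Qed.

Lemma ell_F_inj a b : ell_F k a = ell_F k b -> a = b.
Proof.
move=> e; have [ab|ba] := Rle_or_lt a b.
  have := ell_F_expand ab; lra.
have := ell_F_expand (Rlt_le _ _ ba); lra.
Qed.

Lemma am_ell_F phi : am k (ell_F k phi) = phi.
Proof. by apply: ell_F_inj; rewrite ell_F_am. Qed.

Lemma am_0 : am k 0 = 0.
Proof. by rewrite -[X in am k X]ell_F_0 am_ell_F. Qed.

Lemma am_K : am k (ell_K k) = PI / 2.
Proof. exact: am_ell_F. Qed.

Lemma am_lt u v : u < v -> am k u < am k v.
Proof.
move=> uv; apply: Rnot_le_lt => h.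
have := ell_F_expand h; rewrite !ell_F_am; lra.
Qed.

Lemma am_contract u v : Rabs (am k u - am k v) <= Rabs (u - v).
Proof.
wlog uv : u v / u <= v.
  move=> w; have [h|h] := Rle_or_lt u v; first exact: w.
  by rewrite Rabs_minus_sym (Rabs_minus_sym u); apply: w; lra.
have h : am k u <= am k v.
  have [e|n] := Req_dec u v; first by rewrite e; lra.
  by apply/Rlt_le/am_lt; lra.
have := ell_F_expand h; rewrite !ell_F_am => h2.
rewrite !Rabs_left1; lra.
Qed.

Lemma dn_rad u : dn k u = sqrt (rad (am k u)).
Proof. by []. Qed.

Lemma dn_bounds u : 0 < dn k u <= 1.
Proof. exact: sqrt_rad_bounds. Qed.

Lemma am_derive u : is_derive (am k) u (dn k u).
Proof.
apply/is_derive_Reals => eps eps0.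
have /is_derive_Reals hF := ell_F_derive (am k u).
have [delta hd] := hF eps eps0.
exists delta => h h0 hdelta.
set D := am k (u + h) - am k u.
have hD : Rabs D <= Rabs h.
  have := am_contract (u + h) u; rewrite -/D.
  by replace (u + h - u) with h by ring.
have D0 : D <> 0.
  move=> e; apply: h0.
  have e2 : am k (u + h) = am k u by rewrite /D in e; lra.
  have := congr1 (ell_F k) e2; rewrite !ell_F_am; lra.
have := hd D D0 (Rle_lt_trans _ _ _ hD hdelta).
replace (am k u + D) with (am k (u + h)) by (rewrite /D; ring).
rewrite !ell_F_am -dn_rad.
replace (u + h - u) with h by ring.
have [d0 d1] := dn_bounds u; set d := dn k u in d0 d1 *.
move=> H.
have h0' : 0 < Rabs h by apply: Rabs_pos_lt.
replace (D / h - d) with (- (d * (D / h)) * (h / D - / d)); last first.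
  by field; repeat split => //; lra.
rewrite Rabs_mult.
apply: Rle_lt_trans (_ : 1 * Rabs (h / D - / d) < eps); last by lra.
apply: Rmult_le_compat_r; first exact: Rabs_pos.
rewrite Rabs_Ropp Rabs_mult (Rabs_pos_eq d); last by lra.
rewrite Rabs_div //.
have : Rabs D / Rabs h <= 1.
  by apply: (Rmult_le_reg_r (Rabs h)) => //; field_simplify; lra.
have : 0 <= Rabs D / Rabs h.
  apply: Rmult_le_pos; first exact: Rabs_pos.
  by apply/Rlt_le/Rinv_0_lt_compat.
nra.
Qed.

Lemma sn_derive u : is_derive (sn k) u (cn k u * dn k u).
Proof.
rewrite Rmult_comm; apply: (is_derive_comp sin (am k)).
  by apply/is_derive_Reals/derivable_pt_lim_sin.
exact: am_derive.
Qed.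

Lemma cn_derive u : is_derive (cn k) u (- (sn k u * dn k u)).
Proof.
replace (- (sn k u * dn k u)) with (dn k u * - sn k u) by ring.
apply: (is_derive_comp cos (am k)).
  by apply/is_derive_Reals/derivable_pt_lim_cos.
exact: am_derive.
Qed.

Lemma dn_derive u : is_derive (dn k) u (- (k ^ 2 * sn k u * cn k u)).
Proof.
have hs := sn_derive u.
have [d0 d1] := dn_bounds u.
have e : Derive (sn k) u = cn k u * dn k u by apply: is_derive_unique.
rewrite /dn; auto_derive.
  repeat split; first by exists (cn k u * dn k u).
  by have := rad_bounds (am k u); rewrite /rad /sn /=; lra.
rewrite e -/(dn k u).
replace (1 + - (k * (k * 1) * (sn k u * (sn k u * 1))))
  with (1 - k ^ 2 * sn k u ^ 2) by ring.
by rewrite -/(dn k u); field; lra.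
Qed.

Lemma sn_0 : sn k 0 = 0. Proof. by rewrite /sn am_0 sin_0. Qed.
Lemma cn_0 : cn k 0 = 1. Proof. by rewrite /cn am_0 cos_0. Qed.
Lemma dn_0 : dn k 0 = 1.
Proof. by rewrite /dn sn_0 -[RHS]sqrt_1; congr sqrt; ring. Qed.
Lemma sn_K : sn k (ell_K k) = 1. Proof. by rewrite /sn am_K sin_PI2. Qed.
Lemma cn_K : cn k (ell_K k) = 0. Proof. by rewrite /cn am_K cos_PI2. Qed.
Lemma dn_K : dn k (ell_K k) = compl_mod k.
Proof. by rewrite /dn sn_K /compl_mod; congr sqrt; ring. Qed.

Lemma ell_K_gt0 : 0 < ell_K k.
Proof.
have h : 0 <= PI / 2 by have := PI_RGT_0; lra.
have := ell_F_expand h; rewrite ell_F_0 /ell_K; have := PI_RGT_0; lra.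
Qed.

Lemma sn_cn u : sn k u ^ 2 + cn k u ^ 2 = 1.
Proof. have := cn_sqr k u; lra. Qed.

Lemma addition_den_gt0 u v : 0 < 1 - k ^ 2 * sn k u ^ 2 * sn k v ^ 2.
Proof.
have h1 := sn_cn u; have h2 := sn_cn v.
have h3 := pow2_ge_0 (cn k u); have h4 := pow2_ge_0 (cn k v).
have h5 := pow2_ge_0 (sn k u); have h6 := pow2_ge_0 (sn k v).
have h7 : 0 < k ^ 2 < 1 by nra.
have h8 : sn k u ^ 2 * sn k v ^ 2 <= 1 by nra.
have h9 : 0 <= sn k u ^ 2 * sn k v ^ 2 by nra.
nra.
Qed.

End Jacobi.

Lemma derive_zero_const (f : R -> R) a b :
  (forall t, is_derive f t 0) -> f a = f b.
Proof.
move=> h; have [[ab|e]|ba] := Rle_or_lt a b; [|by rewrite e|].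
  by apply: eq_is_derive => // t _; apply: h.
by symmetry; apply: eq_is_derive => // t _; apply: h.
Qed.

(** * Addition theorems and shifts *)

Lemma quotient_const (N N' D D' : R -> R) a b :
  (forall t, is_derive N t (N' t)) -> (forall t, is_derive D t (D' t)) ->
  (forall t, 0 < D t) -> (forall t, N' t * D t = N t * D' t) ->
  N a / D a = N b / D b.
Proof.
move=> hN hD D0 e.
apply: (derive_zero_const (f := fun t => N t / D t)) => t.
have h := D0 t.
replace 0 with ((N' t * D t - N t * D' t) / D t ^ 2); last first.
  by rewrite e; field; lra.
apply: is_derive_div => //; lra.
Qed.

Section Addition.
Context (k : R) (hk : 0 < k < 1) (u v : R).

Let s := sn k.
Let c := cn k.
Let d := dn k.
Let S t := sn k (u + v - t).
Let C t := cn k (u + v - t).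
Let D t := dn k (u + v - t).

Let ds t : is_derive s t (c t * d t). Proof. exact: sn_derive. Qed.
Let dc t : is_derive c t (- (s t * d t)). Proof. exact: cn_derive. Qed.
Let dd t : is_derive d t (- (k ^ 2 * s t * c t)). Proof. exact: dn_derive. Qed.

Let is_derive_rev (f : R -> R) t l :
  is_derive f (u + v - t) l -> is_derive (fun t => f (u + v - t)) t (- l).
Proof.
move=> h.
replace (- l) with (scal (-1) l); last by rewrite /scal /= /mult /=; ring.
apply: (is_derive_comp f (fun t => u + v - t)) => //.
by auto_derive => //; ring.
Qed.

Let dS t : is_derive S t (- (C t * D t)).
Proof. by apply: is_derive_rev; apply: sn_derive. Qed.
Let dC t : is_derive C t (S t * D t).
Proof. by rewrite -[_ * _]Ropp_involutive; apply: is_derive_rev; apply: cn_derive. Qed.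
Let dD t : is_derive D t (k ^ 2 * S t * C t).
Proof. by rewrite -[_ * _]Ropp_involutive; apply: is_derive_rev; apply: dn_derive. Qed.

Let den t := 1 - k ^ 2 * s t ^ 2 * S t ^ 2.
Let den_gt0 t : 0 < den t. Proof. exact: addition_den_gt0. Qed.
Let dden t : is_derive den t
  (- (2 * k ^ 2 * s t * S t * (c t * d t * S t - s t * C t * D t))).
Proof.
move: (ds t) (dS t); rewrite /den; move: s S => f g hf hg.
auto_derive.
  by split; [exists (c t * d t)| split => //; exists (- (C t * D t))].
by rewrite (is_derive_unique _ _ _ hf) (is_derive_unique _ _ _ hg); ring.
Qed.

Let rels t : [/\ c t ^ 2 = 1 - s t ^ 2, d t ^ 2 = 1 - k ^ 2 * s t ^ 2,
  C t ^ 2 = 1 - S t ^ 2 & D t ^ 2 = 1 - k ^ 2 * S t ^ 2].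
Proof. by split; rewrite ?cn_sqr ?dn_sqr. Qed.


Let at_ends (N : R -> R) : forall N' : R -> R,
  (forall t, is_derive N t (N' t)) ->
  (forall t, N' t * den t = N t * - (2 * k ^ 2 * s t * S t
                                     * (c t * d t * S t - s t * C t * D t))) ->
  N 0 = N u / den u.
Proof.
move=> N' hN e.
rewrite -(quotient_const 0 u hN dden den_gt0 e) /den /s sn_0 //.
by field.
Qed.

Let sn_num t : is_derive (fun t => s t * C t * D t + S t * c t * d t) t
  (2 * k ^ 2 * s t * S t * (s t ^ 2 - S t ^ 2)).
Proof.
move: (ds t) (dS t) (dc t) (dC t) (dd t) (dD t) (rels t).
move: s S c C d D => f1 f2 f3 f4 f5 f6 h1 h2 h3 h4 h5 h6 [r1 r2 r3 r4].
auto_derive; first by repeat split => //; eexists; eassumption.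
rewrite (is_derive_unique _ _ _ h1) (is_derive_unique _ _ _ h2)
        (is_derive_unique _ _ _ h3) (is_derive_unique _ _ _ h4)
        (is_derive_unique _ _ _ h5) (is_derive_unique _ _ _ h6).
transitivity (f1 t * f2 t * (f6 t ^ 2 + k ^ 2 * f4 t ^ 2 - f5 t ^ 2
                             - k ^ 2 * f3 t ^ 2)); first by ring.
rewrite r1 r2 r3 r4; ring.
Qed.

Let cn_num t : is_derive (fun t => c t * C t - s t * S t * d t * D t) t
  (2 * k ^ 2 * s t * S t * (s t * c t * D t - S t * d t * C t)).
Proof.
move: (ds t) (dS t) (dc t) (dC t) (dd t) (dD t) (rels t).
move: s S c C d D => f1 f2 f3 f4 f5 f6 h1 h2 h3 h4 h5 h6 [r1 r2 r3 r4].
auto_derive; first by repeat split => //; eexists; eassumption.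
rewrite (is_derive_unique _ _ _ h1) (is_derive_unique _ _ _ h2)
        (is_derive_unique _ _ _ h3) (is_derive_unique _ _ _ h4)
        (is_derive_unique _ _ _ h5) (is_derive_unique _ _ _ h6).
transitivity (- (f1 t * f5 t * f4 t) * (1 - f6 t ^ 2 + k ^ 2 * f2 t ^ 2)
   + f3 t * f2 t * f6 t * (1 - f5 t ^ 2 + k ^ 2 * f1 t ^ 2)); first by ring.
rewrite r2 r4; ring.
Qed.

Let dn_num t : is_derive (fun t => d t * D t - k ^ 2 * s t * S t * c t * C t) t
  (2 * k ^ 2 * s t * S t * (s t * d t * C t - S t * c t * D t)).
Proof.
move: (ds t) (dS t) (dc t) (dC t) (dd t) (dD t) (rels t).
move: s S c C d D => f1 f2 f3 f4 f5 f6 h1 h2 h3 h4 h5 h6 [r1 r2 r3 r4].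
auto_derive; first by repeat split => //; eexists; eassumption.
rewrite (is_derive_unique _ _ _ h1) (is_derive_unique _ _ _ h2)
        (is_derive_unique _ _ _ h3) (is_derive_unique _ _ _ h4)
        (is_derive_unique _ _ _ h5) (is_derive_unique _ _ _ h6).
transitivity (k ^ 2 * (f5 t * f2 t * f4 t * (1 - f3 t ^ 2 + f1 t ^ 2)
   - f1 t * f3 t * f6 t * (1 - f4 t ^ 2 + f2 t ^ 2))); first by ring.
rewrite r1 r3; ring.
Qed.

Let u0 : u + v - 0 = u + v. Proof. ring. Qed.
Let uv : u + v - u = v. Proof. ring. Qed.

(** For [u + v] fixed, the right-hand sides have derivative zero in [u]. *)
Lemma sn_addition :
  sn k (u + v) = (sn k u * cn k v * dn k v + sn k v * cn k u * dn k u)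
                 / (1 - k ^ 2 * sn k u ^ 2 * sn k v ^ 2).
Proof.
have h0 := at_ends sn_num.
rewrite /den /s /S /c /d /C /D sn_0 // cn_0 // dn_0 // u0 uv in h0.
rewrite -h0; first by ring.
move=> t; have [h1 h2 h3 h4] := rels t; move: h1 h2 h3 h4; rewrite /s /S /c /d /C /D.
move: (sn k t) (cn k t) (dn k t) (sn k (u + v - t)) (cn k (u + v - t)) (dn k (u + v - t)) => x y z X Y Z h1 h2 h3 h4.
transitivity (2 * k ^ 2 * x * X * (x ^ 2 * Y ^ 2 * Z ^ 2 - X ^ 2 * y ^ 2 * z ^ 2));
  last by ring.
rewrite h1 h2 h3 h4; ring.
Qed.

Lemma cn_addition :
  cn k (u + v) = (cn k u * cn k v - sn k u * sn k v * dn k u * dn k v)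
                 / (1 - k ^ 2 * sn k u ^ 2 * sn k v ^ 2).
Proof.
have h0 := at_ends cn_num.
rewrite /den /s /S /c /d /C /D sn_0 // cn_0 // dn_0 // u0 uv in h0.
rewrite -h0; first by ring.
move=> t; have [h1 h2 h3 h4] := rels t; move: h1 h2 h3 h4; rewrite /s /S /c /d /C /D.
move: (sn k t) (cn k t) (dn k t) (sn k (u + v - t)) (cn k (u + v - t)) (dn k (u + v - t)) => x y z X Y Z h1 h2 h3 h4.
transitivity (2 * k ^ 2 * x * X * (x * y * Z * (Y ^ 2 + X ^ 2 * z ^ 2)
  - z * Y * X * (y ^ 2 + x ^ 2 * Z ^ 2))); last by ring.
rewrite h1 h2 h3 h4; ring.
Qed.

Lemma dn_addition :
  dn k (u + v) = (dn k u * dn k v - k ^ 2 * sn k u * sn k v * cn k u * cn k v)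
                 / (1 - k ^ 2 * sn k u ^ 2 * sn k v ^ 2).
Proof.
have h0 := at_ends dn_num.
rewrite /den /s /S /c /d /C /D sn_0 // cn_0 // dn_0 // u0 uv in h0.
rewrite -h0; first by ring.
move=> t; have [h1 h2 h3 h4] := rels t; move: h1 h2 h3 h4; rewrite /s /S /c /d /C /D.
move: (sn k t) (cn k t) (dn k t) (sn k (u + v - t)) (cn k (u + v - t)) (dn k (u + v - t)) => x y z X Y Z h1 h2 h3 h4.
transitivity (2 * k ^ 2 * x * X * (x * z * Y * (Z ^ 2 + k ^ 2 * y ^ 2 * X ^ 2)
  - X * y * Z * (z ^ 2 + k ^ 2 * x ^ 2 * Y ^ 2))); last by ring.
rewrite h1 h2 h3 h4; ring.
Qed.
End Addition.

Section Shifts.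
Context (k : R) (hk : 0 < k < 1).

Let K := ell_K k.

Let den_K w : 1 - k ^ 2 * sn k w ^ 2 * sn k K ^ 2 = dn k w ^ 2.
Proof. by rewrite /K sn_K // dn_sqr //; ring. Qed.

Lemma sn_add_K w : sn k (w + K) = cn k w / dn k w.
Proof.
rewrite sn_addition // den_K /K sn_K // cn_K // dn_K //.
by have := dn_bounds hk w => h; field; lra.
Qed.

Lemma cn_add_K w : cn k (w + K) = - (compl_mod k * sn k w / dn k w).
Proof.
rewrite cn_addition // den_K /K sn_K // cn_K // dn_K //.
by have := dn_bounds hk w => h; field; lra.
Qed.

Lemma dn_add_K w : dn k (w + K) = compl_mod k / dn k w.
Proof.
rewrite dn_addition // den_K /K sn_K // cn_K // dn_K //.
by have := dn_bounds hk w => h; field; lra.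
Qed.

Let k'0 : compl_mod k <> 0.
Proof. have := compl_mod_bounds hk; lra. Qed.

Let twice w : w + 2 * K = w + K + K. Proof. ring. Qed.

Lemma sn_add_2K w : sn k (w + 2 * K) = - sn k w.
Proof.
rewrite twice sn_add_K cn_add_K dn_add_K.
by have := dn_bounds hk w => h; field; split => //; lra.
Qed.

Lemma cn_add_2K w : cn k (w + 2 * K) = - cn k w.
Proof.
rewrite twice cn_add_K sn_add_K dn_add_K.
by have := dn_bounds hk w => h; field; split => //; lra.
Qed.

Lemma dn_add_2K w : dn k (w + 2 * K) = dn k w.
Proof.
rewrite twice !dn_add_K.
by have := dn_bounds hk w => h; field; split => //; lra.
Qed.

End Shifts.

(** * The function sn cn / dn and balanced weights *)

(** By the descending Landen transformation this is, up to scaling, [sn] for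
    another modulus; its half-period is [K]. *)
Definition snc (k w : R) : R := sn k w * cn k w / dn k w.
Definition dsnc (k w : R) : R :=
  cn k w ^ 2 - sn k w ^ 2 + k ^ 2 * snc k w ^ 2.

(** For [B = (1 - t) (1 - k' ^ 2 t)] and [t = sn(y, k') ^ 2] this is the derivative
    in [t] of the logarithm of [|sc(w + i y)| ^ 2]: see [sc_mod2_deriv]. *)
Definition slope (k t B w : R) : R := dsnc k w / (t + snc k w ^ 2 * B).

Section Snc.
Context (k : R) (hk : 0 < k < 1).

Let K := ell_K k.

Lemma snc_derive w : is_derive (snc k) w (dsnc k w).
Proof.
have hs := sn_derive hk w; have hc := cn_derive hk w; have hd := dn_derive hk w.
have d0 := dn_bounds hk w.
have dS := dn_sqr w hk.
replace (dsnc k w) with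
  (((cn k w * dn k w * cn k w + sn k w * - (sn k w * dn k w)) * dn k w
   - sn k w * cn k w * - (k ^ 2 * sn k w * cn k w)) / dn k w ^ 2); last first.
  by rewrite /dsnc /snc; field; lra.
apply: (is_derive_div (fun w => sn k w * cn k w)) => //; last by lra.
exact: (is_derive_mult (sn k) (cn k) w _ _ hs hc Rmult_comm).
Qed.

Lemma dsnc_derive w :
  is_derive (dsnc k) w (- (2 * (2 - k ^ 2)) * snc k w + 2 * k ^ 4 * snc k w ^ 3).
Proof.
have hs := sn_derive hk w; have hc := cn_derive hk w.
have hh := snc_derive w.
have d0 := dn_bounds hk w.
have dS := dn_sqr w hk; have cS := cn_sqr k w.
rewrite /dsnc; auto_derive.
  by repeat split => //; eexists; eassumption.
rewrite (is_derive_unique _ _ _ hs) (is_derive_unique _ _ _ hc)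
  (is_derive_unique _ _ _ hh).
have e : sn k w * cn k w = snc k w * dn k w by rewrite /snc; field; lra.
transitivity (- (4 * dn k w * (sn k w * cn k w)) + 2 * k ^ 2 * dsnc k w * snc k w).
  by ring.
have e2 : (snc k w * dn k w) ^ 2 = (sn k w * cn k w) ^ 2 by rewrite e.
rewrite e; rewrite /dsnc.
have -> : 4 * dn k w * (snc k w * dn k w) = 4 * snc k w * dn k w ^ 2 by ring.
rewrite dS cS; ring.
Qed.

Lemma dsnc_sqr w :
  dsnc k w ^ 2 = 1 - 2 * (2 - k ^ 2) * snc k w ^ 2 + k ^ 4 * snc k w ^ 4.
Proof.
have d0 := dn_bounds hk w.
have dS := dn_sqr w hk; have cS := cn_sqr k w.
have e : snc k w ^ 2 * (1 - k ^ 2 * sn k w ^ 2) = sn k w ^ 2 * (1 - sn k w ^ 2).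
  by rewrite -dS -cS /snc; field; lra.
rewrite /dsnc cS.
move: (snc k w) (sn k w) e => h s e.
have -> : (1 - s ^ 2 - s ^ 2 + k ^ 2 * h ^ 2) ^ 2 =
  1 - 4 * (s ^ 2 * (1 - s ^ 2)) + 2 * k ^ 2 * h ^ 2 - 4 * (s ^ 2 * k ^ 2 * h ^ 2) + k ^ 4 * h ^ 4 by ring.
rewrite -e; ring.
Qed.

Lemma snc_sqr_le1 w : snc k w ^ 2 <= 1.
Proof.
have d0 := dn_bounds hk w.
have dS := dn_sqr w hk; have cS := cn_sqr k w.
have e : snc k w ^ 2 * dn k w ^ 2 = sn k w ^ 2 * cn k w ^ 2.
  by rewrite /snc; field; lra.
have := pow2_ge_0 (sn k w); have := pow2_ge_0 (cn k w).
have := pow2_ge_0 (snc k w).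
have k2 : 0 < k ^ 2 < 1 by nra.
move: e; rewrite dS cS; move: (snc k w ^ 2) (sn k w ^ 2) => h s e h0 c0 s0.
have : 0 < 1 - k ^ 2 * s by nra.
nra.
Qed.

Lemma dsnc_bound w : Rabs (dsnc k w) <= 2.
Proof.
have := snc_sqr_le1 w; have := cn_sqr k w; have := pow2_ge_0 (sn k w).
have := pow2_ge_0 (cn k w); have := pow2_ge_0 (snc k w).
have k2 : 0 < k ^ 2 < 1 by nra.
rewrite /dsnc => h1 h2 h3 h4 h5; apply: Rabs_le; nra.
Qed.

Lemma snc_add_K w : snc k (w + K) = - snc k w.
Proof.
rewrite /snc sn_add_K // cn_add_K // dn_add_K //.
have := dn_bounds hk w; have := compl_mod_bounds hk => h1 h2.
by field; lra.
Qed.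

Lemma dsnc_add_K w : dsnc k (w + K) = - dsnc k w.
Proof.
have d0 := dn_bounds hk w; have k0 := compl_mod_bounds hk.
have dS := dn_sqr w hk; have cS := cn_sqr k w; have kS := compl_mod_sqr hk.
rewrite /dsnc snc_add_K sn_add_K // cn_add_K //.
have e : snc k w ^ 2 * dn k w ^ 2 = sn k w ^ 2 * cn k w ^ 2.
  by rewrite /snc; field; lra.
apply: (Rmult_eq_reg_r (dn k w ^ 2)); last by nra.
transitivity (compl_mod k ^ 2 * sn k w ^ 2 - cn k w ^ 2
   + k ^ 2 * (snc k w ^ 2 * dn k w ^ 2)); first by field; lra.
transitivity (- ((cn k w ^ 2 - sn k w ^ 2) * dn k w ^ 2
   + k ^ 2 * (snc k w ^ 2 * dn k w ^ 2))); last by ring.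
rewrite e kS dS cS; ring.
Qed.

Lemma snc_gt0 w : 0 < w < K -> 0 < snc k w.
Proof.
move=> [w0 wK]; have := am_lt hk w0; have := am_lt hk wK.
rewrite am_0 // am_K // => h1 h2.
have d0 := dn_bounds hk w.
have s0 : 0 < sn k w by apply: sin_gt_0 => //; have := PI_RGT_0; lra.
have c0 : 0 < cn k w by apply: cos_gt_0 => //; have := PI_RGT_0; lra.
apply: Rmult_lt_0_compat; first by apply: Rmult_lt_0_compat.
by apply: Rinv_0_lt_compat; lra.
Qed.

Lemma snc_0 : snc k 0 = 0.
Proof. by rewrite /snc sn_0 //; field; have := dn_bounds hk 0; lra. Qed.

Lemma dsnc_0 : dsnc k 0 = 1.
Proof. by rewrite /dsnc snc_0 sn_0 // cn_0 //; ring. Qed.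

Lemma snc_lt0 w : - K < w < 0 -> snc k w < 0.
Proof.
move=> h; have : 0 < snc k (w + K) by apply: snc_gt0; lra.
by rewrite snc_add_K; lra.
Qed.

Section Slope.
Context (t B : R) (t0 : 0 < t) (B0 : 0 <= B).

Let den w := t + snc k w ^ 2 * B.
Let den_gt0 w : 0 < den w.
Proof. have := pow2_ge_0 (snc k w); rewrite /den; nra. Qed.

(** The numerator of the derivative of the ratio is
    [t (h'' h - h' ^ 2) + h ^ 2 B (h'' h - 3 h' ^ 2)] where [h = snc k];
    both brackets are negative because [h'' h <= 0] and
    [h'' h - h' ^ 2 = k ^ 4 h ^ 4 - 1]. *)
Lemma slope_ratio_decr a b : 0 < a -> a < b -> b < K ->
  slope k t B b / snc k b < slope k t B a / snc k a.
Proof.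
move=> a0 ab bK.
pose num w := t * (k ^ 4 * snc k w ^ 4 - 1) + snc k w ^ 2 * B *
   (snc k w * (- (2 * (2 - k ^ 2)) * snc k w + 2 * k ^ 4 * snc k w ^ 3)
    - 3 * dsnc k w ^ 2).
have hder w : a <= w <= b -> is_derive (fun w => slope k t B w / snc k w) w
    (num w / (snc k w * den w) ^ 2).
  move=> hw; have h0 : 0 < snc k w by apply: snc_gt0; lra.
  have hh := snc_derive w; have hp := dsnc_derive w.
  have d0 := den_gt0 w; rewrite /den in d0.
  rewrite /slope; auto_derive.
    repeat split => //; try (by eexists; eassumption).
      by move: d0 => /=; lra.
    by lra.
  rewrite (is_derive_unique _ _ _ hh) (is_derive_unique _ _ _ hp).
  have e := dsnc_sqr w; rewrite /num /den.
  have -> : k ^ 4 * snc k w ^ 4 - 1 =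
    snc k w * (- (2 * (2 - k ^ 2)) * snc k w + 2 * k ^ 4 * snc k w ^ 3) - dsnc k w ^ 2.
    by rewrite e; ring.
  by field; move: d0 => /=; lra.
have neg w : a <= w <= b -> num w / (snc k w * den w) ^ 2 < 0.
  move=> hw; have h0 : 0 < snc k w by apply: snc_gt0; lra.
  have d0 := den_gt0 w.
  have p0 : 0 < (snc k w * den w) ^ 2 by apply: pow_lt; nra.
  suff : num w < 0.
    by move=> n0; have := Rinv_0_lt_compat _ p0; rewrite /Rdiv; nra.
  have l1 := snc_sqr_le1 w; have k2 : 0 < k ^ 2 < 1 by nra.
  have q0 := pow2_ge_0 (dsnc k w).
  rewrite /num.
  have -> : k ^ 4 * snc k w ^ 4 = (k ^ 2 * snc k w ^ 2) ^ 2 by ring.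
  have -> : snc k w * (- (2 * (2 - k ^ 2)) * snc k w + 2 * k ^ 4 * snc k w ^ 3) =
     - (2 * snc k w ^ 2) * (2 - k ^ 2 - k ^ 4 * snc k w ^ 2) by ring.
  have x0 : 0 < snc k w ^ 2 by apply: pow_lt.
  have k4 : k ^ 4 = k ^ 2 * k ^ 2 by ring.
  rewrite k4; move: (snc k w ^ 2) (k ^ 2) (dsnc k w ^ 2) x0 k2 q0 l1 => x m q x0 m0 q0 x1.
  have y1 : 0 < m * x < 1 by nra.
  have y2 : (m * x) ^ 2 < 1 by nra.
  have y3 : 0 <= 2 - m - m * m * x by nra.
  have y4 : 0 <= x * B by nra.
  have y5 : - (2 * x) * (2 - m - m * m * x) - 3 * q <= 0 by nra.
  nra.
have hM := MVT_gen (fun w => slope k t B w / snc k w) a b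
  (fun w => num w / (snc k w * den w) ^ 2).
rewrite Rmin_left in hM; last by lra.
rewrite Rmax_right in hM; last by lra.
have [||c [hc e']] := hM.
- by move=> w hw; apply: hder; lra.
- by move=> w hw; apply: is_derive_continuity_pt (hder w hw).
have := neg c hc; nra.
Qed.

Lemma slope_add_K w : slope k t B (w + K) = - slope k t B w.
Proof.
rewrite /slope dsnc_add_K snc_add_K; have := den_gt0 w; rewrite /den => h.
by field; lra.
Qed.

(** [slope / snc] decreases on [(0, K)] and has period [K]: so the line of slope
    [slope / snc] at [X] separates the two signs of [snc] on [(X - K, X)]. *)
Lemma slope_above_line X w : 0 < X < K -> X - K < w < X ->
  slope k t B X / snc k X * snc k w < slope k t B w.
Proof.
move=> hX hw; set l := slope k t B X / snc k X.
have [w0|[w0|w0]] := Rtotal_order w 0.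
- have h := @slope_ratio_decr X (w + K) _ _ _.
  have {}h : slope k t B (w + K) / snc k (w + K) < l by apply: slope_ratio_decr; lra.
  have h0 : 0 < snc k (w + K) by apply: snc_gt0; lra.
  have : slope k t B (w + K) < l * snc k (w + K).
    have -> : slope k t B (w + K) =
      slope k t B (w + K) / snc k (w + K) * snc k (w + K) by field; lra.
    exact: Rmult_lt_compat_r.
  rewrite slope_add_K snc_add_K; lra.
- rewrite w0 /slope snc_0 dsnc_0 Rmult_0_r.
  by apply: Rdiv_lt_0_compat; rewrite /=; lra.
- have h : l < slope k t B w / snc k w by apply: slope_ratio_decr; lra.
  have h0 : 0 < snc k w by apply: snc_gt0; lra.
  have -> : slope k t B w = slope k t B w / snc k w * snc k w by field; lra.
  exact: Rmult_lt_compat_r.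
Qed.

End Slope.

Section Balanced.
Context (I : finType) (w W : I -> R).

(** Subtracting from [slope] a multiple of [snc] makes all the terms positive and,
    by the balance condition, leaves the sum unchanged. *)
Lemma balanced_slope_gt0 t B A : 0 < t -> 0 <= B ->
  (forall i, 0 <= w i) -> (exists i, 0 < w i) ->
  - K < A < 0 -> (forall i, 0 < w i -> A < W i < A + K) ->
  \big[Rplus/0]_i (w i * snc k (W i)) = 0 ->
  0 < \big[Rplus/0]_i (w i * slope k t B (W i)).
Proof.
move=> t0 B0 w0 [i0 hi0] hA hW bal.
set l := slope k t B (A + K) / snc k (A + K).
have e : \big[Rplus/0]_i (w i * slope k t B (W i)) =
    \big[Rplus/0]_i (w i * (slope k t B (W i) - l * snc k (W i))).
  transitivity (\big[Rplus/0]_i (w i * slope k t B (W i) + - l * (w i * snc k (W i)))).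
    by rewrite sumR_lin bal; ring.
  by apply: eq_bigr => i _; ring.
have pos i : 0 < w i -> 0 < slope k t B (W i) - l * snc k (W i).
  move=> hi; have := hW i hi => hi2.
  have : l * snc k (W i) < slope k t B (W i) by apply: slope_above_line; lra.
  lra.
rewrite e; apply: (sumR_gt0 (i := i0)) => [i|].
  have := w0 i => -[h|<-]; last by lra.
  by have := pos i h; nra.
by have := pos i0 hi0; nra.
Qed.

End Balanced.

End Snc.

(** * Holomorphic functions on vertical strips *)

(** Differentiability in [v + i s], through the Cauchy-Riemann equations.  The
    joint continuity of the derivative is what differentiation under an integral
    sign requires. *)
Record complex_derivative (f f' : R -> R -> C) (v s : R) : Prop := {
  cd_re_v : is_derive (fun v => fst (f v s)) v (fst (f' v s));
  cd_im_v : is_derive (fun v => snd (f v s)) v (snd (f' v s));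
  cd_re_s : is_derive (fun s => fst (f v s)) s (- snd (f' v s));
  cd_im_s : is_derive (fun s => snd (f v s)) s (fst (f' v s));
  cd_re_cont : continuity_2d_pt (fun v s => fst (f v s)) v s;
  cd_im_cont : continuity_2d_pt (fun v s => snd (f v s)) v s;
  cd_re_cont' : continuity_2d_pt (fun v s => fst (f' v s)) v s;
  cd_im_cont' : continuity_2d_pt (fun v s => snd (f' v s)) v s }.

Definition holomorphic_on (U : R -> Prop) (f : R -> R -> C) : Prop :=
  exists f', forall v s, U v -> complex_derivative f f' v s.

Lemma is_derive_mult_R (f g : R -> R) (x l m : R) :
  is_derive f x l -> is_derive g x m ->
  is_derive (fun x => f x * g x) x (l * g x + f x * m).
Proof. by move=> hf hg; apply: (is_derive_mult f g x l m hf hg Rmult_comm). Qed.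

Lemma is_derive_eq (f : R -> R) (x l m : R) : is_derive f x l -> l = m -> is_derive f x m.
Proof. by move=> h <-. Qed.

Lemma complex_derivative_mult f f' g g' v s :
  complex_derivative f f' v s -> complex_derivative g g' v s ->
  complex_derivative (fun v s => Cmult (f v s) (g v s))
    (fun v s => Cplus (Cmult (f' v s) (g v s)) (Cmult (f v s) (g' v s))) v s.
Proof.
case=> f1 f2 f3 f4 f5 f6 f7 f8 [g1 g2 g3 g4 g5 g6 g7 g8].
split; rewrite /Cmult /Cplus /=.
- apply: is_derive_eq.
    apply: (is_derive_minus (fun v => fst (f v s) * fst (g v s))
      (fun v => snd (f v s) * snd (g v s))); apply: is_derive_mult_R; eassumption.
  by rewrite /minus /plus /opp /=; ring.
- apply: is_derive_eq.
    apply: (is_derive_plus (fun v => fst (f v s) * snd (g v s))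
      (fun v => snd (f v s) * fst (g v s))); apply: is_derive_mult_R; eassumption.
  by rewrite /plus /=; ring.
- apply: is_derive_eq.
    apply: (is_derive_minus (fun s => fst (f v s) * fst (g v s))
      (fun s => snd (f v s) * snd (g v s))); apply: is_derive_mult_R; eassumption.
  by rewrite /minus /plus /opp /=; ring.
- apply: is_derive_eq.
    apply: (is_derive_plus (fun s => fst (f v s) * snd (g v s))
      (fun s => snd (f v s) * fst (g v s))); apply: is_derive_mult_R; eassumption.
  by rewrite /plus /=; ring.
- by apply: continuity_2d_pt_minus; apply: continuity_2d_pt_mult.
- by apply: continuity_2d_pt_plus; apply: continuity_2d_pt_mult.
- by apply: continuity_2d_pt_plus; apply: continuity_2d_pt_minus;
    apply: continuity_2d_pt_mult.
- by apply: continuity_2d_pt_plus; apply: continuity_2d_pt_plus;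
    apply: continuity_2d_pt_mult.
Qed.

Lemma holomorphic_mult U f g : holomorphic_on U f -> holomorphic_on U g ->
  holomorphic_on U (fun v s => Cmult (f v s) (g v s)).
Proof.
move=> [f' hf] [g' hg]; eexists => v s Uv.
by apply: complex_derivative_mult; [apply: hf | apply: hg].
Qed.

Lemma holomorphic_const U (c : C) : holomorphic_on U (fun _ _ => c).
Proof.
exists (fun _ _ => RtoC 0) => v s _; split => /=; rewrite ?Ropp_0;
  try exact: is_derive_const; exact: continuity_2d_pt_const.
Qed.

Lemma holomorphic_pow U f n : holomorphic_on U f ->
  holomorphic_on U (fun v s => Cpow (f v s) n).
Proof.
move=> hf; elim: n => [|n IH]; first exact: holomorphic_const.
exact: holomorphic_mult.
Qed.

Lemma holomorphic_prod (I : finType) U (f : I -> R -> R -> C) :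
  (forall i, holomorphic_on U (f i)) ->
  holomorphic_on U (fun v s => \big[Cmult/RtoC 1]_i f i v s).
Proof.
move=> hf.
suff [f' h] : holomorphic_on U (fun v s => \big[Cmult/RtoC 1]_(i <- index_enum I) f i v s).
  by exists f'.
elim: (index_enum I) => [|i r [f' h]].
  have [f' h] := holomorphic_const U (RtoC 1); exists f' => v s Uv.
  have e : (fun v s => \big[Cmult/RtoC 1]_(i <- [::]) f i v s) = fun _ _ => RtoC 1.
    by do 2!apply: FunctionalExtensionality.functional_extensionality => ?; rewrite big_nil.
  by rewrite e; apply: h.
have e : (fun v s => \big[Cmult/RtoC 1]_(j <- i :: r) f j v s) =
   fun v s => Cmult (f i v s) (\big[Cmult/RtoC 1]_(j <- r) f j v s).
  by do 2!apply: FunctionalExtensionality.functional_extensionality => ?; rewrite big_cons.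
by rewrite e; apply: holomorphic_mult; [|exists f'].
Qed.

Lemma continuity_2d_pt_slice (f : R -> R -> R) v s :
  continuity_2d_pt f v s -> continuous (f v) s.
Proof.
move=> h; apply/filterlim_locally => eps.
have [d hd] := h eps.
exists d => s' hs'; apply: hd; last by exact: hs'.
by rewrite Rminus_diag Rabs_R0; apply: cond_pos.
Qed.

Lemma is_RInt_C (f : R -> C) a b :
  (forall s, continuous (fun s => fst (f s)) s) ->
  (forall s, continuous (fun s => snd (f s)) s) ->
  is_RInt (V := C_R_NormedModule) f a b
    (RInt (fun s => fst (f s)) a b, RInt (fun s => snd (f s)) a b).
Proof.
move=> h1 h2; apply: (is_RInt_fct_extend_pair (U := R_NormedModule) (V := R_NormedModule));
  apply: RInt_correct; exact: ex_RInt_continuous.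
Qed.

Lemma RInt_C (f : R -> C) a b :
  (forall s, continuous (fun s => fst (f s)) s) ->
  (forall s, continuous (fun s => snd (f s)) s) ->
  RInt (V := C_R_CompleteNormedModule) f a b =
    (RInt (fun s => fst (f s)) a b, RInt (fun s => snd (f s)) a b).
Proof.
by move=> h1 h2; apply: (is_RInt_unique (V := C_R_CompleteNormedModule)); apply: is_RInt_C.
Qed.

(** The derivative in [v] of an integral over a vertical segment is the integral
    of a derivative in [s], by the Cauchy-Riemann equations. *)
Lemma vertical_integral_real (g gv h : R -> R -> R) (lo hi a b T : R) :
  (forall v s, lo < v < hi -> is_derive (fun v => g v s) v (gv v s)) ->
  (forall v s, lo < v < hi -> is_derive (fun s => h v s) s (gv v s)) ->
  (forall v s, lo < v < hi -> continuity_2d_pt g v s) ->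
  (forall v s, lo < v < hi -> continuity_2d_pt gv v s) ->
  (forall v, lo < v < hi -> h v T = h v 0) ->
  lo < a < hi -> a < b < hi ->
  RInt (g a) 0 T = RInt (g b) 0 T.
Proof.
move=> hg hh cg cgv per ha hb.
apply: (eq_is_derive (fun v => RInt (g v) 0 T)); last by lra.
move=> v hv; have {}hv : lo < v < hi by lra.
have near : locally v (fun v => lo < v < hi).
  have h0 : 0 < Rmin (v - lo) (hi - v) by apply: Rmin_pos; lra.
  exists (mkposreal _ h0) => x; rewrite /ball /= /AbsRing_ball /= /abs /minus /plus /opp /= => hx.
  have := Rmin_l (v - lo) (hi - v); have := Rmin_r (v - lo) (hi - v); split_Rabs; lra.
have e : RInt (fun s => Derive (fun v => g v s) v) 0 T = 0.
  rewrite (RInt_ext _ (gv v)); last by move=> s _; apply/is_derive_unique/hg.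
  rewrite (is_RInt_unique (gv v) 0 T (minus (h v T) (h v 0))).
    by rewrite per //; rewrite /minus /plus /opp /=; ring.
  apply: is_RInt_derive => s _; first exact: hh.
  exact/continuity_2d_pt_slice/cgv.
rewrite [zero](_ : _ = RInt (fun s => Derive (fun v => g v s) v) 0 T) //.
apply: is_derive_RInt_param.
- by apply: filter_imp near => x hx t _; exists (gv x t); apply: hg.
- move=> s _; apply: continuity_2d_pt_ext_loc (cgv v s hv).
  have [d hd] := near.
  by exists d => x y hx _; symmetry; apply/is_derive_unique/hg/hd.
- apply: filter_imp near => x hx; apply: ex_RInt_continuous => s _.
  exact/continuity_2d_pt_slice/cg.
Qed.

(** Cauchy's theorem for a rectangle whose horizontal sides cancel. *)
Lemma vertical_integral_shift (f : R -> R -> C) (lo hi a b T : R) :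
  holomorphic_on (fun v => lo < v < hi) f ->
  (forall v, lo < v < hi -> f v T = f v 0) ->
  lo < a < hi -> lo < b < hi ->
  RInt (V := C_R_CompleteNormedModule) (f a) 0 T =
  RInt (V := C_R_CompleteNormedModule) (f b) 0 T.
Proof.
move=> [f' hf] per.
have main x y : lo < x < hi -> x < y < hi ->
  RInt (V := C_R_CompleteNormedModule) (f x) 0 T =
  RInt (V := C_R_CompleteNormedModule) (f y) 0 T.
  move=> hx hy; have {}hy' : lo < y < hi by lra.
  rewrite !RInt_C.
  - congr pair.
    + apply: (vertical_integral_real (g := fun v s => fst (f v s))
        (gv := fun v s => fst (f' v s)) (h := fun v s => snd (f v s)) (lo := lo) (hi := hi)) => // v.
      * by move=> s hv; apply: cd_re_v (hf v s hv).
      * by move=> s hv; apply: cd_im_s (hf v s hv).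
      * by move=> s hv; apply: cd_re_cont (hf v s hv).
      * by move=> s hv; apply: cd_re_cont' (hf v s hv).
      * by move=> hv; rewrite per.
    + apply: (vertical_integral_real (g := fun v s => snd (f v s))
        (gv := fun v s => snd (f' v s)) (h := fun v s => - fst (f v s)) (lo := lo) (hi := hi)) => // v.
      * by move=> s hv; apply: cd_im_v (hf v s hv).
      * move=> s hv; rewrite -[snd _]Ropp_involutive.
        exact: (is_derive_opp (fun s => fst (f v s)) s _ (cd_re_s (hf v s hv))).
      * by move=> s hv; apply: cd_im_cont (hf v s hv).
      * by move=> s hv; apply: cd_im_cont' (hf v s hv).
      * by move=> hv; rewrite per.
  - by move=> s; apply: (continuity_2d_pt_slice (f := fun v s => fst (f v s)));
      apply: cd_re_cont (hf y s hy').
  - by move=> s; apply: (continuity_2d_pt_slice (f := fun v s => snd (f v s)));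
      apply: cd_im_cont (hf y s hy').
  - by move=> s; apply: (continuity_2d_pt_slice (f := fun v s => fst (f v s)));
      apply: cd_re_cont (hf x s hx).
  - by move=> s; apply: (continuity_2d_pt_slice (f := fun v s => snd (f v s)));
      apply: cd_im_cont (hf x s hx).
move=> ha hb; have [ab|[->//|ba]] := Rtotal_order a b; first by apply: main; lra.
by symmetry; apply: main; lra.
Qed.

(** * The elementary factor i sqrt(k') sc *)

Definition fac (k w y : R) : C :=
  Cmult (Cmult Ci (RtoC (sqrt (compl_mod k)))) (Csc k (w, y)).

(** This is [|sc(w + i y)| ^ 2] for [t = sn(y, k') ^ 2]. *)
Definition sc_mod2 (k t w : R) : R :=
  (sn k w ^ 2 + cn k w ^ 2 * t) / (cn k w ^ 2 + compl_mod k ^ 2 * sn k w ^ 2 * t).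

Section Factor.
Context (k : R) (hk : 0 < k < 1).

Let K := ell_K k.
Let k' := compl_mod k.
Let hk' : 0 < k' < 1. Proof. exact: compl_mod_bounds. Qed.

Definition sc_den (w y : R) : R := 1 - sn k w ^ 2 * dn k' y ^ 2.

Lemma sc_denE w y :
  sc_den w y = cn k w ^ 2 + k' ^ 2 * sn k w ^ 2 * sn k' y ^ 2.
Proof. by rewrite /sc_den dn_sqr // cn_sqr; ring. Qed.

Lemma sc_den_gt0 w y : cn k w <> 0 \/ sn k' y <> 0 -> 0 < sc_den w y.
Proof.
move=> h; rewrite sc_denE.
have h1 := cn_sqr k w; have c0 := pow2_ge_0 (cn k w).
have s0 := pow2_ge_0 (sn k w); have y0 := pow2_ge_0 (sn k' y).
have k2 : 0 < k' ^ 2 by nra.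
have z0 : 0 <= k' ^ 2 * sn k w ^ 2 * sn k' y ^ 2.
  by apply: Rmult_le_pos => //; nra.
have [e|n] := Req_dec (cn k w) 0; last by have := pow2_gt_0 _ n; lra.
case: h => [//|h]; have y1 := pow2_gt_0 _ h.
have s1 : 0 < sn k w ^ 2 by rewrite e in h1; lra.
by have := Rmult_lt_0_compat _ _ (Rmult_lt_0_compat _ _ k2 s1) y1; lra.
Qed.

Lemma facE w y : fac k w y =
  (- (sqrt k' * (dn k w * sn k' y / sc_den w y)),
   sqrt k' * (sn k w * cn k w * cn k' y * dn k' y / sc_den w y)).
Proof.
rewrite /fac /Csc /sc_den -/k' /Cmult /Ci /RtoC /=.
by congr pair; rewrite /Rdiv; ring.
Qed.

Lemma fac_period w y : fac k (w + 2 * K) y = fac k w y.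
Proof.
rewrite !facE /sc_den sn_add_2K // cn_add_2K // dn_add_2K //.
have -> : (- sn k w) ^ 2 = sn k w ^ 2 by ring.
by congr pair; rewrite /Rdiv; ring.
Qed.

(** [w + K] and [w] are the arguments attached to opposite directions. *)
Lemma fac_shift_K w y : sn k' y <> 0 -> Cmult (fac k (w + K) y) (fac k w y) = RtoC 1.
Proof.
move=> y0; have d0 : 0 < sc_den w y by apply: sc_den_gt0; right.
have d1 : 0 < sc_den (w + K) y by apply: sc_den_gt0; right.
have dw := dn_bounds hk w.
have cS := cn_sqr k w; have dS := dn_sqr w hk.
have c1S := cn_sqr k' y; have d1S := dn_sqr y hk'; have kS := compl_mod_sqr hk.
have q0 : 0 < sqrt k' by apply: sqrt_lt_R0; lra.
have qq : sqrt k' * sqrt k' = k' by apply: sqrt_sqrt; lra.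
have dE : sc_den (w + K) y * dn k w ^ 2 =
    k' ^ 2 * (sn k w ^ 2 + cn k w ^ 2 * sn k' y ^ 2).
  transitivity (dn k w ^ 2 - cn k w ^ 2 * dn k' y ^ 2).
    by rewrite /sc_den sn_add_K //; field; lra.
  by rewrite d1S dS cS -/k' /k' kS; ring.
have nE : (sn k w ^ 2 + cn k w ^ 2 * sn k' y ^ 2) * sc_den w y =
    dn k w ^ 2 * sn k' y ^ 2 + sn k w ^ 2 * cn k w ^ 2 * cn k' y ^ 2 * dn k' y ^ 2.
  by rewrite sc_denE -/k' d1S c1S dS cS /k' kS; ring.
rewrite !facE sn_add_K // cn_add_K // dn_add_K // -/k' /Cmult /=.
have main : sqrt k' ^ 2 * k' * (dn k w ^ 2 * sn k' y ^ 2 + sn k w ^ 2 * cn k w ^ 2 * cn k' y ^ 2 * dn k' y ^ 2)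
   = sc_den (w + K) y * dn k w ^ 2 * sc_den w y.
  rewrite dE -nE; have -> : sqrt k' ^ 2 = k' by rewrite -[RHS]qq; ring.
  by ring.
congr pair; last by field; lra.
apply: (Rmult_eq_reg_r (sc_den (w + K) y * dn k w ^ 2 * sc_den w y)).
  rewrite -{2}main; field; lra.
by apply: Rgt_not_eq; do 2!apply: Rmult_lt_0_compat => //; nra.
Qed.

Lemma fac_anti_y w y : fac k w (y + 2 * ell_K k') = Copp (fac k w y).
Proof.
rewrite !facE /sc_den sn_add_2K // cn_add_2K // dn_add_2K // /Copp /=.
by congr pair; rewrite /Rdiv; ring.
Qed.

Lemma cis_add a b : cis (a + b) = Cmult (cis a) (cis b).
Proof. by rewrite /cis /Cmult /= cos_plus sin_plus; congr pair; ring. Qed.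

(** The real part keeps a constant sign for [0 < y < 2 K'], so that the argument
    is an arc tangent; it vanishes at [y = K'], where [cn(y, k') = 0]. *)
Lemma fac_polar w y : 0 < sn k' y ->
  fac k w y = Cmult (RtoC (- sqrt (k' * sc_mod2 k (sn k' y ^ 2) w)))
    (cis (- atan (snc k w * (cn k' y * dn k' y / sn k' y)))).
Proof.
move=> s0; have d0 : 0 < sc_den w y by apply: sc_den_gt0; right; lra.
have dw := dn_bounds hk w.
have cS := cn_sqr k w; have dS := dn_sqr w hk.
have c1S := cn_sqr k' y; have d1S := dn_sqr y hk'; have kS := compl_mod_sqr hk.
set x := snc k w * _.
set m := dn k w * sn k' y / sc_den w y * sqrt (1 + x²).
have r0 : 0 < 1 + x² by rewrite /Rsqr; nra.
have q0 : 0 < sqrt (1 + x²) by apply: sqrt_lt_R0.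
have m0 : 0 <= m.
  apply: Rmult_le_pos; last by lra.
  by apply: Rlt_le; apply: Rdiv_lt_0_compat => //; nra.
have nE : (sn k w ^ 2 + cn k w ^ 2 * sn k' y ^ 2) * sc_den w y =
    dn k w ^ 2 * sn k' y ^ 2 + sn k w ^ 2 * cn k w ^ 2 * cn k' y ^ 2 * dn k' y ^ 2.
  by rewrite sc_denE -/k' d1S c1S dS cS /k' kS; ring.
have mE : m ^ 2 = sc_mod2 k (sn k' y ^ 2) w.
  rewrite /m Rpow_mult_distr.
  have -> : sqrt (1 + x²) ^ 2 = 1 + x² by apply: pow2_sqrt; lra.
  rewrite /sc_mod2 -sc_denE; apply: (Rmult_eq_reg_r (sc_den w y ^ 2)); last by nra.
  transitivity ((sn k w ^ 2 + cn k w ^ 2 * sn k' y ^ 2) * sc_den w y); last first.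
    by field; lra.
  by rewrite nE /x /snc /Rsqr; field; lra.
have -> : sqrt (k' * sc_mod2 k (sn k' y ^ 2) w) = sqrt k' * m.
  by rewrite sqrt_mult_alt; [rewrite -mE sqrt_pow2 | lra].
rewrite /cis cos_neg sin_neg cos_atan sin_atan facE /Cmult /RtoC /=.
congr pair; rewrite /m; first by field; lra.
transitivity (sqrt k' * (dn k w * sn k' y / sc_den w y) * x); last by field; lra.
by rewrite /x /snc; field; lra.
Qed.

Lemma sc_mod2_deriv t w : 0 < t ->
  is_derive (fun t => ln (sc_mod2 k t w)) t
    (slope k t ((1 - t) * (1 - k' ^ 2 * t)) w).
Proof.
move=> t0.
have dw := dn_bounds hk w.
have cS := cn_sqr k w; have dS := dn_sqr w hk; have kS := compl_mod_sqr hk.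
have s0 := pow2_ge_0 (sn k w); have c0 := pow2_ge_0 (cn k w).
have k2 : 0 < k' ^ 2 < 1 by nra.
have n0 : 0 < sn k w ^ 2 + cn k w ^ 2 * t by nra.
have p0 : 0 < cn k w ^ 2 + k' ^ 2 * sn k w ^ 2 * t.
  have [e|e] := Rle_lt_or_eq_dec _ _ c0.
    have : 0 <= k' ^ 2 * sn k w ^ 2 by nra.
    by nra.
  have e1 : sn k w ^ 2 = 1 by lra.
  rewrite e1; nra.
have hE : snc k w ^ 2 * dn k w ^ 2 = sn k w ^ 2 * cn k w ^ 2.
  by rewrite /snc; field; lra.
have gE : dsnc k w * dn k w ^ 2 = cn k w ^ 4 - k' ^ 2 * sn k w ^ 4.
  rewrite /dsnc Rmult_plus_distr_r Rmult_assoc hE /k' kS.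
  have -> : cn k w ^ 4 = (cn k w ^ 2) ^ 2 by ring.
  by rewrite dS cS; ring.
have fE : (t + snc k w ^ 2 * ((1 - t) * (1 - k' ^ 2 * t))) * dn k w ^ 2 =
   (sn k w ^ 2 + cn k w ^ 2 * t) * (cn k w ^ 2 + k' ^ 2 * sn k w ^ 2 * t).
  rewrite Rmult_plus_distr_r.
  have -> : snc k w ^ 2 * ((1 - t) * (1 - k' ^ 2 * t)) * dn k w ^ 2 =
    snc k w ^ 2 * dn k w ^ 2 * ((1 - t) * (1 - k' ^ 2 * t)) by ring.
  by rewrite hE dS cS /k' kS; ring.
have -> : slope k t ((1 - t) * (1 - k' ^ 2 * t)) w =
   (cn k w ^ 4 - k' ^ 2 * sn k w ^ 4) /
   ((sn k w ^ 2 + cn k w ^ 2 * t) * (cn k w ^ 2 + k' ^ 2 * sn k w ^ 2 * t)).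
  have A0 : t + snc k w ^ 2 * ((1 - t) * (1 - k' ^ 2 * t)) <> 0.
    move=> z; move: fE; rewrite z Rmult_0_l => z2.
    by have := Rmult_lt_0_compat _ _ n0 p0; lra.
  rewrite /slope -fE -gE; move: (t + _) A0 => A A0; field; lra.
rewrite /sc_mod2 -/k'; move: n0 p0.
move: (sn k w) (cn k w) => s c n0 p0.
auto_derive.
  split; first by move: p0 => /=; lra.
  split => //; apply: Rdiv_lt_0_compat; [move: n0 => /= | move: p0 => /=]; lra.
by field; move: n0 p0 => /=; lra.
Qed.

End Factor.

Lemma complex_derivative_scale f f' b v s :
  complex_derivative f f' ((v - b) / 2) (s / 2) ->
  complex_derivative (fun v s => f ((v - b) / 2) (s / 2))
    (fun v s => Cmult (RtoC (/ 2)) (f' ((v - b) / 2) (s / 2))) v s.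
Proof.
have dv : is_derive (fun v => (v - b) / 2) v (/ 2) by auto_derive => //; field.
have ds : is_derive (fun s => s / 2) s (/ 2) by auto_derive => //; field.
have cont (g : R -> R -> R) : continuity_2d_pt g ((v - b) / 2) (s / 2) ->
    continuity_2d_pt (fun v s => g ((v - b) / 2) (s / 2)) v s.
  move=> hg eps; have [d hd] := hg eps; exists d => v' s' hv hs.
  by apply: hd; split_Rabs; lra.
case=> f1 f2 f3 f4 f5 f6 f7 f8; split; rewrite /Cmult /RtoC /=.
- apply: is_derive_eq.
    exact: (is_derive_comp (fun w => fst (f w (s / 2))) (fun v => (v - b) / 2) _ _ _ f1 dv).
  by rewrite /scal /= /mult /=; ring.
- apply: is_derive_eq.
    exact: (is_derive_comp (fun w => snd (f w (s / 2))) (fun v => (v - b) / 2) _ _ _ f2 dv).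
  by rewrite /scal /= /mult /=; ring.
- apply: is_derive_eq.
    exact: (is_derive_comp (fun y => fst (f ((v - b) / 2) y)) (fun s => s / 2) _ _ _ f3 ds).
  by rewrite /scal /= /mult /=; ring.
- apply: is_derive_eq.
    exact: (is_derive_comp (fun y => snd (f ((v - b) / 2) y)) (fun s => s / 2) _ _ _ f4 ds).
  by rewrite /scal /= /mult /=; ring.
- exact: (cont (fun w y => fst (f w y))).
- exact: (cont (fun w y => snd (f w y))).
- apply: (cont (fun w y => / 2 * fst (f' w y) - 0 * snd (f' w y))).
  by apply: continuity_2d_pt_minus; apply: continuity_2d_pt_mult => //;
    apply: continuity_2d_pt_const.
- apply: (cont (fun w y => / 2 * snd (f' w y) + 0 * fst (f' w y))).
  by apply: continuity_2d_pt_plus; apply: continuity_2d_pt_mult => //;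
    apply: continuity_2d_pt_const.
Qed.

Section FactorDerivative.
Context (k : R) (hk : 0 < k < 1).

Let K := ell_K k.
Let k' := compl_mod k.
Let hk' : 0 < k' < 1. Proof. exact: compl_mod_bounds. Qed.

Definition dfac (w y : R) : C :=
  (sqrt k' * (sn k' y * sn k w * cn k w
     * (k ^ 2 * sc_den k w y - 2 * dn k w ^ 2 * dn k' y ^ 2) / sc_den k w y ^ 2),
   sqrt k' * (cn k' y * dn k' y * dn k w
     * ((cn k w ^ 2 - sn k w ^ 2) * sc_den k w y
        + 2 * sn k w ^ 2 * cn k w ^ 2 * dn k' y ^ 2) / sc_den k w y ^ 2)).

Let cont_w (f : R -> R) l w y : is_derive f w l ->
  continuity_2d_pt (fun w _ => f w) w y.
Proof.
move=> h; apply: (continuity_1d_2d_pt_comp f (fun w _ => w)).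
  exact: is_derive_continuity_pt h.
exact: continuity_2d_pt_id1.
Qed.

Let cont_y (f : R -> R) l w y : is_derive f y l ->
  continuity_2d_pt (fun _ y => f y) w y.
Proof.
move=> h; apply: (continuity_1d_2d_pt_comp f (fun _ y => y)).
  exact: is_derive_continuity_pt h.
exact: continuity_2d_pt_id2.
Qed.

Let cont_pow (f : R -> R -> R) n w y : continuity_2d_pt f w y ->
  continuity_2d_pt (fun w y => f w y ^ n) w y.
Proof.
move=> h; elim: n => [|n IH]; first exact: continuity_2d_pt_const.
exact: continuity_2d_pt_mult.
Qed.

Lemma fac_complex_derivative w y : cn k w <> 0 ->
  complex_derivative (fac k) dfac w y.
Proof.
move=> c0; have d0 : 0 < sc_den k w y by apply: sc_den_gt0 => //; left.
have hs := sn_derive hk w; have hc := cn_derive hk w; have hd := dn_derive hk w.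
have hs1 := sn_derive hk' y; have hc1 := cn_derive hk' y; have hd1 := dn_derive hk' y.
have cs := @cont_w (sn k) _ w y hs; have cc := @cont_w (cn k) _ w y hc.
have cd := @cont_w (dn k) _ w y hd.
have cs1 := @cont_y (sn k') _ w y hs1; have cc1 := @cont_y (cn k') _ w y hc1.
have cd1 := @cont_y (dn k') _ w y hd1.
have dw := dn_bounds hk w.
have cS := cn_sqr k w; have dS := dn_sqr w hk.
have c1S := cn_sqr k' y; have d1S := dn_sqr y hk'; have kS := compl_mod_sqr hk.
rewrite -/k' in kS.
have cden : continuity_2d_pt (sc_den k) w y.
  apply: continuity_2d_pt_minus; first exact: continuity_2d_pt_const.
  by apply: continuity_2d_pt_mult; [exact: (cont_pow 2 cs) | exact: (cont_pow 2 cd1)].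
have div (f g : R -> R -> R) : continuity_2d_pt f w y -> continuity_2d_pt g w y ->
    g w y <> 0 -> continuity_2d_pt (fun w y => f w y / g w y) w y.
  by move=> hf hg g0; apply: continuity_2d_pt_mult => //; apply: continuity_2d_pt_inv.
have den_w : is_derive (fun w => sc_den k w y) w
    (- (2 * sn k w * cn k w * dn k w * dn k' y ^ 2)).
  rewrite /sc_den -/k'; auto_derive; first by repeat split => //; eexists; eassumption.
  by rewrite (is_derive_unique _ _ _ hs); ring.
have den_y : is_derive (fun y => sc_den k w y) y
    (2 * k' ^ 2 * sn k w ^ 2 * sn k' y * cn k' y * dn k' y).
  rewrite /sc_den -/k'; auto_derive; first by repeat split => //; eexists; eassumption.
  by rewrite (is_derive_unique _ _ _ hd1); ring.
have d2 : sc_den k w y ^ 2 <> 0 by nra.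
have dden := sc_denE hk w y; rewrite -/k' in dden.
have sc_derive : is_derive (fun w => sn k w * cn k w) w
    (dn k w * (cn k w ^ 2 - sn k w ^ 2)).
  by apply: is_derive_eq; [apply: is_derive_mult_R; eassumption | ring].
have cd1_derive : is_derive (fun y => cn k' y * dn k' y) y
    (- sn k' y * (dn k' y ^ 2 + k' ^ 2 * cn k' y ^ 2)).
  by apply: is_derive_eq; [apply: is_derive_mult_R; eassumption | ring].
have cX : continuity_2d_pt (fun w y => - (sqrt k' * (dn k w * sn k' y / sc_den k w y))) w y.
  apply: continuity_2d_pt_opp; apply: continuity_2d_pt_mult; first exact: continuity_2d_pt_const.
  by apply: div => //; [apply: continuity_2d_pt_mult | lra].
have cY : continuity_2d_pt
    (fun w y => sqrt k' * (sn k w * cn k w * cn k' y * dn k' y / sc_den k w y)) w y.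
  apply: continuity_2d_pt_mult; first exact: continuity_2d_pt_const.
  by apply: div => //; [do !apply: continuity_2d_pt_mult => // | lra].
split.
- apply: (is_derive_ext (fun w => - sqrt k' * (dn k w * sn k' y / sc_den k w y))).
    by move=> z; rewrite facE /= -/k' /Rdiv; ring.
  apply: is_derive_eq.
    apply: is_derive_scal; apply: is_derive_div; last by lra.
      by apply: is_derive_mult_R; [exact: hd | exact: is_derive_const].
    exact: den_w.
  by rewrite /scal /zero /= /mult /=; field; lra.
- apply: (is_derive_ext (fun w => sqrt k' * cn k' y * dn k' y * (sn k w * cn k w / sc_den k w y))).
    by move=> z; rewrite facE /= -/k' /Rdiv; ring.
  apply: is_derive_eq.
    apply: is_derive_scal; apply: is_derive_div; last by lra.
      exact: sc_derive.
    exact: den_w.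
  by rewrite /scal /= /mult /=; field; lra.
- apply: (is_derive_ext (fun y => - sqrt k' * dn k w * (sn k' y / sc_den k w y))).
    by move=> z; rewrite facE /= -/k' /Rdiv; ring.
  apply: is_derive_eq.
    apply: is_derive_scal; apply: is_derive_div; last by lra.
      exact: hs1.
    exact: den_y.
  rewrite /scal /= /mult /=.
  transitivity (- (sqrt k' * (cn k' y * dn k' y * dn k w
     * (sc_den k w y - 2 * k' ^ 2 * sn k w ^ 2 * sn k' y ^ 2)) / sc_den k w y ^ 2)).
    by field; lra.
  have -> : sc_den k w y - 2 * k' ^ 2 * sn k w ^ 2 * sn k' y ^ 2 =
    (cn k w ^ 2 - sn k w ^ 2) * sc_den k w y + 2 * sn k w ^ 2 * cn k w ^ 2 * dn k' y ^ 2.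
    by rewrite d1S dden cS; ring.
  by rewrite /dfac /= -/k' /Rdiv; ring.
- apply: (is_derive_ext (fun y => sqrt k' * sn k w * cn k w * (cn k' y * dn k' y / sc_den k w y))).
    by move=> z; rewrite facE /= -/k' /Rdiv; ring.
  apply: is_derive_eq.
    apply: is_derive_scal; apply: is_derive_div; last by lra.
      exact: cd1_derive.
    exact: den_y.
  rewrite /scal /= /mult /=.
  have e : k ^ 2 * sc_den k w y - 2 * dn k w ^ 2 * dn k' y ^ 2 =
    - (dn k' y ^ 2 + k' ^ 2 * cn k' y ^ 2) * sc_den k w y
    - 2 * k' ^ 2 * sn k w ^ 2 * cn k' y ^ 2 * dn k' y ^ 2.
    by rewrite /sc_den dS -/k' c1S d1S kS; ring.
  by rewrite e; field; lra.
- by apply: continuity_2d_pt_ext cX => x z; rewrite facE.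
- by apply: continuity_2d_pt_ext cY => x z; rewrite facE.
- rewrite /dfac /=; apply: continuity_2d_pt_mult; first exact: continuity_2d_pt_const.
  apply: div; [|exact: (cont_pow 2 cden)|exact: d2].
  apply: continuity_2d_pt_mult; first by do !apply: continuity_2d_pt_mult => //.
  apply: continuity_2d_pt_minus; first by apply: continuity_2d_pt_mult => //; apply: continuity_2d_pt_const.
  apply: continuity_2d_pt_mult; last exact: (cont_pow 2 cd1).
  by apply: continuity_2d_pt_mult; [apply: continuity_2d_pt_const | exact: (cont_pow 2 cd)].
- rewrite /dfac /=; apply: continuity_2d_pt_mult; first exact: continuity_2d_pt_const.
  apply: div; [|exact: (cont_pow 2 cden)|exact: d2].
  apply: continuity_2d_pt_mult; first by do !apply: continuity_2d_pt_mult => //.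
  apply: continuity_2d_pt_plus.
    apply: continuity_2d_pt_mult => //.
    by apply: continuity_2d_pt_minus; [exact: (cont_pow 2 cc) | exact: (cont_pow 2 cs)].
  apply: continuity_2d_pt_mult; last exact: (cont_pow 2 cd1).
  apply: continuity_2d_pt_mult; last exact: (cont_pow 2 cc).
  by apply: continuity_2d_pt_mult; [apply: continuity_2d_pt_const | exact: (cont_pow 2 cs)].
Qed.

Lemma cn_neq0 w : - K < w < K -> cn k w <> 0.
Proof.
move=> [h1 h2].
have [w0|w0] := Rle_or_lt 0 w.
  have a2 := am_lt hk h2; rewrite am_K // in a2.
  have a1 : 0 <= am k w.
    have [e|n] := Req_dec w 0; first by rewrite e am_0 //; lra.
    by have := @am_lt k hk 0 w ltac:(lra); rewrite am_0 //; lra.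
  by apply: Rgt_not_eq; apply: cos_gt_0; have := PI_RGT_0; lra.
have s0 : 0 < sn k (w + K).
  have a1 := @am_lt k hk 0 (w + K) ltac:(lra); rewrite am_0 // in a1.
  have a2 := @am_lt k hk (w + K) K ltac:(lra); rewrite /K am_K // -/K in a2.
  by apply: sin_gt_0; have := PI_RGT_0; lra.
move=> e; move: s0; rewrite sn_add_K // e; lra.
Qed.

Lemma fac_holomorphic (U : R -> Prop) b :
  (forall v, U v -> b - 2 * K < v < b + 2 * K) ->
  holomorphic_on U (fun v s => fac k ((v - b) / 2) (s / 2)).
Proof.
move=> hU; eexists => v s /hU hv.
apply: complex_derivative_scale; apply: fac_complex_derivative.
by apply: cn_neq0; lra.
Qed.

End FactorDerivative.

(** * Laplace's method *)

Notation CInt := (RInt (V := C_R_CompleteNormedModule)).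

Definition C_continuous (f : R -> C) : Prop :=
  forall s, continuous (fun s => fst (f s)) s /\ continuous (fun s => snd (f s)) s.

Lemma norm_C_R (z : C) : norm (V := C_R_NormedModule) z = Cmod z.
Proof.
rewrite /norm /= /prod_norm /Cmod /norm /= /abs /=.
by congr sqrt; rewrite !Rmult_1_r -!Rabs_mult !Rabs_pos_eq //; nra.
Qed.

Lemma C_continuous_mult f g : C_continuous f -> C_continuous g ->
  C_continuous (fun s => Cmult (f s) (g s)).
Proof.
move=> hf hg s; have [f1 f2] := hf s; have [g1 g2] := hg s; split; rewrite /Cmult /=.
  apply: (continuous_minus (fun s => fst (f s) * fst (g s)) (fun s => snd (f s) * snd (g s)));
    exact: continuous_mult.
apply: (continuous_plus (fun s => fst (f s) * snd (g s)) (fun s => snd (f s) * fst (g s)));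
  exact: continuous_mult.
Qed.

Lemma C_continuous_const c : C_continuous (fun _ => c).
Proof. by move=> s; split; apply: continuous_const. Qed.

Lemma is_CInt f a b : C_continuous f ->
  is_RInt (V := C_R_NormedModule) f a b (CInt f a b).
Proof.
move=> hf; rewrite RInt_C; try by move=> s; have [] := hf s.
by apply: is_RInt_C => s; have [] := hf s.
Qed.

Lemma Re_CInt f a b : C_continuous f -> fst (CInt f a b) = RInt (fun s => fst (f s)) a b.
Proof. by move=> hf; rewrite RInt_C //; move=> s; have [] := hf s. Qed.

Lemma CInt_Chasles f a b c : C_continuous f ->
  CInt f a c = Cplus (CInt f a b) (CInt f b c).
Proof.
move=> hf; symmetry; apply: (RInt_Chasles (V := C_R_CompleteNormedModule));
  by eexists; apply: is_CInt.
Qed.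

Lemma CInt_Cmult f z a b : C_continuous f ->
  CInt (fun s => Cmult z (f s)) a b = Cmult z (CInt f a b).
Proof.
move=> hf; have h1 s := proj1 (hf s); have h2 s := proj2 (hf s).
have ex1 c d : ex_RInt (fun s => fst (f s)) c d by apply: ex_RInt_continuous.
have ex2 c d : ex_RInt (fun s => snd (f s)) c d by apply: ex_RInt_continuous.
have hm : C_continuous (fun s => Cmult z (f s)).
  by apply: C_continuous_mult => //; apply: C_continuous_const.
rewrite (RInt_C (f := fun s => Cmult z (f s))); try by move=> s; have [] := hm s.
rewrite RInt_C // /Cmult /=; congr pair.
  apply: is_RInt_unique.
  apply: (is_RInt_minus (fun s => fst z * fst (f s)) (fun s => snd z * snd (f s)));
    apply: is_RInt_scal; exact: RInt_correct.
apply: is_RInt_unique.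
apply: (is_RInt_plus (fun s => fst z * snd (f s)) (fun s => snd z * fst (f s)));
  apply: is_RInt_scal; exact: RInt_correct.
Qed.

Lemma CInt_minus f g a b : C_continuous f -> C_continuous g ->
  CInt (fun s => Cminus (f s) (g s)) a b = Cminus (CInt f a b) (CInt g a b).
Proof.
move=> hf hg; apply: (is_RInt_unique (V := C_R_CompleteNormedModule)).
have h := is_RInt_minus (V := C_R_NormedModule) f g a b _ _ (is_CInt (a := a) (b := b) hf) (is_CInt (a := a) (b := b) hg).
exact h.
Qed.

Lemma Cmod_CInt_le f (h : R -> R) a b : a <= b -> C_continuous f ->
  (forall s, continuous h s) -> (forall s, a <= s <= b -> Cmod (f s) <= h s) ->
  Cmod (CInt f a b) <= RInt h a b.
Proof.
move=> ab hf hh le; rewrite -norm_C_R.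
apply: (norm_RInt_le f h a b) => //.
- by move=> s hs; rewrite norm_C_R; apply: le.
- exact: is_CInt.
- by apply: RInt_correct; apply: ex_RInt_continuous.
Qed.

Lemma Cmod_CInt_le_const f (M : R) a b : a <= b -> C_continuous f ->
  (forall s, a <= s <= b -> Cmod (f s) <= M) -> Cmod (CInt f a b) <= (b - a) * M.
Proof.
move=> ab hf le.
have := Cmod_CInt_le ab hf (fun s => continuous_const M s) le.
by rewrite RInt_const.
Qed.

(** The mass [A] of the real part of [E] on the near interval dominates both the
    modulus of [E] there, because the phase stays small, and the far part; so
    [E] acts as an approximate unit mass at [c], up to normalization. *)
Lemma laplace_concentration (E g : R -> C) (T c r r' m eta eps M : R) (gam : C) :
  C_continuous E -> C_continuous g ->
  0 < r' -> r' <= r -> 0 < c - r -> c + r < T -> 0 < m -> 0 < eps <= 1 ->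
  (forall s, Rabs (s - c) <= r -> Cmod (E s) <= 2 * fst (E s)) ->
  (forall s, Rabs (s - c) <= r' -> m <= fst (E s)) ->
  (forall s, 0 <= s <= T -> r <= Rabs (s - c) -> Cmod (E s) <= eta) ->
  (forall s, 0 <= s <= T -> Cmod (g s) <= M) -> Cmod gam <= M ->
  (forall s, Rabs (s - c) <= r -> Cmod (Cminus (g s) gam) <= eps) ->
  (2 * M + 1) * (eta * T) <= eps * (r' * m) ->
  CInt E 0 T <> RtoC 0 /\
  Cmod (Cminus (CInt (fun s => Cmult (g s) (E s)) 0 T) (Cmult gam (CInt E 0 T)))
    <= 6 * eps * Cmod (CInt E 0 T).
Proof.
move=> cE cg r'0 r'r c0 cT m0 [e0 e1] near core far gM gamM gnear small.
set A := RInt (fun s => fst (E s)) (c - r) (c + r).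
have cre s : continuous (fun s => fst (E s)) s by have [] := cE s.
have exre a b : ex_RInt (fun s => fst (E s)) a b by apply: ex_RInt_continuous.
have eta0 : 0 <= eta.
  have h : 0 <= 0 <= T by lra.
  have := far 0 h; have := Cmod_ge_0 (E 0) => h1 h2.
  by apply: Rle_trans h1 (h2 _); rewrite Rabs_left; lra.
have M0 : 0 <= M by have := Cmod_ge_0 gam; lra.
have pos s : Rabs (s - c) <= r -> 0 <= fst (E s).
  by move=> hs; have := near s hs; have := Cmod_ge_0 (E s); lra.
have A_ge : 2 * (r' * m) <= A.
  have h1 : RInt (fun _ => m) (c - r') (c + r') <= RInt (fun s => fst (E s)) (c - r') (c + r').
    apply: RInt_le => //; first by lra.
      exact: ex_RInt_const.
    by move=> s hs; apply: core; apply: Rabs_le; lra.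
  rewrite RInt_const /scal /= /mult /= in h1.
  have pos_int a b : c - r <= a -> a <= b -> b <= c + r ->
      0 <= RInt (fun s => fst (E s)) a b.
    move=> ha ab hb.
    have : RInt (fun _ => 0) a b <= RInt (fun s => fst (E s)) a b.
      apply: RInt_le => //; first exact: ex_RInt_const.
      by move=> s hs; apply: pos; apply: Rabs_le; lra.
    by rewrite RInt_const /scal /= /mult /=; lra.
  have e : A = RInt (fun s => fst (E s)) (c - r) (c - r') +
      (RInt (fun s => fst (E s)) (c - r') (c + r') +
       RInt (fun s => fst (E s)) (c + r') (c + r)).
    rewrite /A -(RInt_Chasles _ (c - r) (c - r') (c + r)) //.
    by rewrite -(RInt_Chasles _ (c - r') (c + r') (c + r)).
  have p1 := pos_int (c - r) (c - r') ltac:(lra) ltac:(lra) ltac:(lra).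
  have p2 := pos_int (c + r') (c + r) ltac:(lra) ltac:(lra) ltac:(lra).
  lra.
have A0 : 0 < A by have := Rmult_lt_0_compat _ _ r'0 m0; lra.
have farL s : 0 <= s <= c - r -> Cmod (E s) <= eta.
  by move=> hs; apply: far; [lra | rewrite Rabs_left1; lra].
have farR s : c + r <= s <= T -> Cmod (E s) <= eta.
  by move=> hs; apply: far; [lra | rewrite Rabs_pos_eq; lra].
have etaT0 : 0 <= eta * T by apply: Rmult_le_pos; lra.
have small1 : eta * T <= A / 2.
  have : 0 <= 2 * M * (eta * T) by apply: Rmult_le_pos; lra.
  have : eps * (r' * m) <= 1 * (r' * m).
    by apply: Rmult_le_compat_r; [have := Rmult_lt_0_compat _ _ r'0 m0|]; lra.
  lra.
have lower : A / 2 <= Cmod (CInt E 0 T).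
  apply: Rle_trans (re_le_Cmod _); rewrite /Re Re_CInt //.
  apply: Rle_trans (Rle_abs _).
  rewrite -(RInt_Chasles _ 0 (c - r) T) // -(RInt_Chasles _ (c - r) (c + r) T) //.
  rewrite /plus /= -/A -!Re_CInt //.
  have l1 : Cmod (CInt E 0 (c - r)) <= (c - r - 0) * eta.
    by apply: Cmod_CInt_le_const => //; lra.
  have l2 : Cmod (CInt E (c + r) T) <= (T - (c + r)) * eta.
    by apply: Cmod_CInt_le_const => //; lra.
  have := re_le_Cmod (CInt E 0 (c - r)); have := re_le_Cmod (CInt E (c + r) T).
  rewrite /Re => h1 h2.
  have h3 : 0 <= r * eta by apply: Rmult_le_pos; lra.
  split_Rabs; lra.
split.
  by move=> z; move: lower; rewrite z Cmod_0; lra.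
have cgE : C_continuous (fun s => Cmult (g s) (E s)) by apply: C_continuous_mult.
have cgamE : C_continuous (fun s => Cmult gam (E s)).
  by apply: C_continuous_mult => //; apply: C_continuous_const.
rewrite -CInt_Cmult // -CInt_minus //.
set H := fun s => Cminus (Cmult (g s) (E s)) (Cmult gam (E s)).
have cH : C_continuous H.
  move=> s; have [a1 a2] := cgE s; have [b1 b2] := cgamE s; split.
    exact: (continuous_minus (fun s => fst (Cmult (g s) (E s))) (fun s => fst (Cmult gam (E s)))).
  exact: (continuous_minus (fun s => snd (Cmult (g s) (E s))) (fun s => snd (Cmult gam (E s)))).
have HE s : Cmod (H s) = Cmod (Cminus (g s) gam) * Cmod (E s).
  by rewrite -Cmod_mult; congr Cmod; rewrite /H; ring.
have Hfar s : 0 <= s <= T -> Cmod (E s) <= eta -> Cmod (H s) <= 2 * M * eta.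
  move=> hs hE; rewrite HE; apply: Rmult_le_compat => //; try exact: Cmod_ge_0.
  apply: Rle_trans (Cmod_triangle _ _) _; rewrite Cmod_opp; have := gM s hs; lra.
have Hnear s : Rabs (s - c) <= r -> Cmod (H s) <= 2 * eps * fst (E s).
  move=> hs; rewrite HE.
  have := Rmult_le_compat _ _ _ _ (Cmod_ge_0 _) (Cmod_ge_0 _) (gnear s hs) (near s hs).
  by lra.
have l1 : Cmod (CInt H 0 (c - r)) <= (c - r - 0) * (2 * M * eta).
  apply: Cmod_CInt_le_const => // [|s hs]; first by lra.
  by apply: Hfar; [lra | apply: farL].
have l2 : Cmod (CInt H (c + r) T) <= (T - (c + r)) * (2 * M * eta).
  apply: Cmod_CInt_le_const => // [|s hs]; first by lra.
  by apply: Hfar; [lra | apply: farR].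
have l3 : Cmod (CInt H (c - r) (c + r)) <= 2 * eps * A.
  have -> : 2 * eps * A = RInt (fun s => 2 * eps * fst (E s)) (c - r) (c + r).
    rewrite /A; symmetry; apply: is_RInt_unique; apply: is_RInt_scal.
    exact: RInt_correct.
  apply: Cmod_CInt_le => // [|s|s hs]; first by lra.
    by apply: (continuous_scal_r (2 * eps)).
  by apply: Hnear; apply: Rabs_le; lra.
rewrite (CInt_Chasles 0 (c - r) T) // (CInt_Chasles (c - r) (c + r) T) //.
apply: Rle_trans (Cmod_triangle _ _) _.
have := Cmod_triangle (CInt H (c - r) (c + r)) (CInt H (c + r) T).
have h3 : 0 <= r * (2 * M * eta) by do !apply: Rmult_le_pos; lra.
have h4 : (2 * M) * (eta * T) <= eps * A / 2.
  have : eps * (2 * (r' * m)) <= eps * A by apply: Rmult_le_compat_l; lra.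
  lra.
have h5 : eps * (A / 2) <= eps * Cmod (CInt E 0 T) by apply: Rmult_le_compat_l; lra.
have h6 : 0 <= eps * Cmod (CInt E 0 T) by apply: Rmult_le_pos; [lra | exact: Cmod_ge_0].
lra.
Qed.

(** * Products of elementary factors *)

Definition fac_prod (k : R) (I : finType) (b : I -> R) (p : I -> nat) (v s : R) : C :=
  \big[Cmult/RtoC 1]_i Cpow (fac k ((v - b i) / 2) (s / 2)) (p i).

Lemma holomorphic_C_continuous U f v : holomorphic_on U f -> U v -> C_continuous (f v).
Proof.
move=> [f' hf] Uv s; have h := hf v s Uv; split; apply: ex_derive_continuous; eexists.
  exact: cd_re_s h.
exact: cd_im_s h.
Qed.

Section FacProd.
Context (k : R) (hk : 0 < k < 1) (I : finType) (b : I -> R) (p : I -> nat).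

Let K := ell_K k.
Let k' := compl_mod k.
Let hk' : 0 < k' < 1. Proof. exact: compl_mod_bounds. Qed.

(** The poles of the factor with zero [b i] are at [b i - 2 K] and [b i + 2 K],
    modulo periods. *)
Definition pole_free (v : R) : Prop :=
  forall i, (0 < p i)%N -> b i - 2 * K < v < b i + 2 * K.

Lemma fac_prod_holomorphic : holomorphic_on pole_free (fac_prod k b p).
Proof.
apply: (holomorphic_prod (f := fun i v s => Cpow (fac k ((v - b i) / 2) (s / 2)) (p i))) => i.
have [e|p0] := posnP (p i); first by rewrite e; apply: holomorphic_const.
by apply: holomorphic_pow; apply: fac_holomorphic => // v; apply.
Qed.

Lemma fac_prod_continuous v : pole_free v -> C_continuous (fac_prod k b p v).
Proof. exact: (holomorphic_C_continuous fac_prod_holomorphic). Qed.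

Lemma fac_prod_period v : ~~ odd (\sum_i p i) ->
  fac_prod k b p v (4 * ell_K k') = fac_prod k b p v 0.
Proof.
move=> ev.
have hp i : Cpow (fac k ((v - b i) / 2) (4 * ell_K k' / 2)) (p i) =
    Cmult (RtoC ((-1) ^ p i)) (Cpow (fac k ((v - b i) / 2) (0 / 2)) (p i)).
  have -> : 4 * ell_K k' / 2 = 0 / 2 + 2 * ell_K k' by field.
  rewrite fac_anti_y // RtoC_pow -Cpow_mult_l; congr Cpow.
  by rewrite /Copp /Cmult /=; congr pair; ring.
rewrite /fac_prod (eq_bigr _ (fun i _ => hp i)) big_split /=.
have -> : \big[Cmult/RtoC 1]_i RtoC ((-1) ^ p i) = RtoC ((-1) ^ (\sum_i p i)%N).
  symmetry; apply: (big_morph (fun n : nat => RtoC ((-1) ^ n))) => [m n|] //.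
  by rewrite -plusE pow_add RtoC_mult.
have -> : (-1) ^ (\sum_i p i)%N = 1.
  have := odd_double_half (\sum_i p i); rewrite (negbTE ev) add0n => <-.
  rewrite -mul2n -multE pow_mult.
  by have -> : (-1) ^ 2 = 1; [ring | rewrite pow1].
by rewrite Cmult_1_l.
Qed.

Lemma fac_prod_shift a c : ~~ odd (\sum_i p i) -> pole_free a -> pole_free c ->
  CInt (fac_prod k b p a) 0 (4 * ell_K k') = CInt (fac_prod k b p c) 0 (4 * ell_K k').
Proof.
move=> ev ha hc.
have [e [e0 he]] : exists e, 0 < e /\ forall i, (0 < p i)%N ->
    b i - 2 * K + e < a < b i + 2 * K - e /\ b i - 2 * K + e < c < b i + 2 * K - e.
  apply: common_scale => [i e e' he h /h|i]; first by lra.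
  have [z|p0] := posnP (p i); first by exists 1; split; [lra | ].
  have h1 := ha i p0; have h2 := hc i p0.
  pose m := Rmin (Rmin (a - (b i - 2 * K)) (b i + 2 * K - a))
                 (Rmin (c - (b i - 2 * K)) (b i + 2 * K - c)).
  have m0 : 0 < m by do !apply: Rmin_pos; lra.
  have := Rmin_l (Rmin (a - (b i - 2 * K)) (b i + 2 * K - a))
                 (Rmin (c - (b i - 2 * K)) (b i + 2 * K - c)).
  have := Rmin_r (Rmin (a - (b i - 2 * K)) (b i + 2 * K - a))
                 (Rmin (c - (b i - 2 * K)) (b i + 2 * K - c)).
  have := Rmin_l (a - (b i - 2 * K)) (b i + 2 * K - a).
  have := Rmin_r (a - (b i - 2 * K)) (b i + 2 * K - a).
  have := Rmin_l (c - (b i - 2 * K)) (b i + 2 * K - c).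
  have := Rmin_r (c - (b i - 2 * K)) (b i + 2 * K - c).
  by rewrite -/m => *; exists (m / 2); split; [lra | move=> _; lra].
have l1 := Rmin_l a c; have l2 := Rmin_r a c.
have l3 := Rmax_l a c; have l4 := Rmax_r a c.
apply: (vertical_integral_shift (lo := Rmin a c - e) (hi := Rmax a c + e)); try lra.
  have [f' hf] := fac_prod_holomorphic; exists f' => v s hv; apply: hf => i /he.
  by move: hv; rewrite /Rmin /Rmax; case: Rle_dec => _; lra.
by move=> v _; apply: fac_prod_period.
Qed.

(** Logarithm of the squared modulus of [fac_prod], for
    [t = sn(s / 2, k') ^ 2]. *)
Definition log_mod2 (v t : R) : R :=
  \big[Rplus/0]_i (INR (p i) * ln (k' * sc_mod2 k t ((v - b i) / 2))).

Definition phase (v tau : R) : R :=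
  \big[Rplus/0]_i (INR (p i) * atan (snc k ((v - b i) / 2) * tau)).

Definition fac_sign : R := \big[Rmult/1]_i (-1) ^ p i.

Lemma sc_mod2_gt0 t w : 0 < t -> 0 < sc_mod2 k t w.
Proof.
move=> t0; have cS := cn_sqr k w.
have s0 := pow2_ge_0 (sn k w); have c0 := pow2_ge_0 (cn k w).
have k2 : 0 < k' ^ 2 < 1 by nra.
have n0 : 0 < sn k w ^ 2 + cn k w ^ 2 * t by nra.
apply: Rdiv_lt_0_compat => //; rewrite -/k'.
have [e|e] := Rle_lt_or_eq_dec _ _ c0.
  have : 0 <= k' ^ 2 * sn k w ^ 2 by nra.
  by nra.
have e1 : sn k w ^ 2 = 1 by lra.
rewrite e1; nra.
Qed.

Lemma Cpow_cis x n : Cpow (cis x) n = cis (INR n * x).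
Proof.
elim: n => [|n IH]; first by rewrite /= Rmult_0_l /cis cos_0 sin_0.
rewrite /= IH -cis_add -/(INR n.+1) S_INR; congr cis; ring.
Qed.

Lemma sqrt_pow_exp x n : 0 < x -> sqrt x ^ n = exp (INR n * ln x / 2).
Proof.
move=> x0; rewrite -Rpower_sqrt // -Rpower_pow; last by apply: exp_pos.
by rewrite Rpower_mult /Rpower; congr exp; field.
Qed.

Lemma fac_prod_polar v s : 0 < sn k' (s / 2) ->
  fac_prod k b p v s = Cmult (RtoC (fac_sign * exp (log_mod2 v (sn k' (s / 2) ^ 2) / 2)))
    (cis (- phase v (cn k' (s / 2) * dn k' (s / 2) / sn k' (s / 2)))).
Proof.
move=> s0; rewrite /fac_prod /log_mod2 /phase /fac_sign.
have t0 : 0 < sn k' (s / 2) ^ 2 by apply: pow_lt.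
elim: (index_enum I) => [|i r IH].
  rewrite !big_nil /Rdiv Rmult_0_l exp_0 Ropp_0 /cis cos_0 sin_0 Rmult_1_l.
  by rewrite Cmult_1_l.
rewrite !big_cons IH fac_polar // -/k'.
have q0 : 0 < k' * sc_mod2 k (sn k' (s / 2) ^ 2) ((v - b i) / 2).
  by apply: Rmult_lt_0_compat; [lra | apply: sc_mod2_gt0].
have -> : - sqrt (k' * sc_mod2 k (sn k' (s / 2) ^ 2) ((v - b i) / 2)) =
  (-1) * sqrt (k' * sc_mod2 k (sn k' (s / 2) ^ 2) ((v - b i) / 2)) by ring.
rewrite Cpow_mult_l -RtoC_pow Rpow_mult_distr sqrt_pow_exp // Cpow_cis.
set L := \big[_/_]_(_ <- _) (_ * ln _); set P := \big[_/_]_(_ <- _) (_ * atan _).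
set S := \big[Rmult/1]_(_ <- _) _.
rewrite [(_ + L) / 2]Rmult_plus_distr_r -/(Rdiv _ _) exp_plus.
rewrite Ropp_plus_distr cis_add -[in RHS]Ropp_mult_distr_r_reverse.
rewrite !RtoC_mult -/(Rdiv L 2); ring.
Qed.

End FacProd.

(** * Estimates near and away from the saddle point *)

Lemma MVT_le (f f' : R -> R) a b : a <= b ->
  (forall x, a <= x <= b -> is_derive f x (f' x)) ->
  exists c, a <= c <= b /\ f b - f a = f' c * (b - a).
Proof.
move=> ab h; have hM := MVT_gen f a b f'.
rewrite Rmin_left // Rmax_right // in hM.
by apply: hM => x hx; [apply: h; lra | apply: is_derive_continuity_pt (h x hx)].
Qed.

Lemma is_derive_sumR (I : finType) (f : I -> R -> R) (f' : I -> R) x :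
  (forall i, is_derive (f i) x (f' i)) ->
  is_derive (fun x => \big[Rplus/0]_i f i x) x (\big[Rplus/0]_i f' i).
Proof.
move=> h.
suff H : is_derive (fun x => \big[Rplus/0]_(i <- index_enum I) f i x) x
  (\big[Rplus/0]_(i <- index_enum I) f' i) by [].
elim: (index_enum I) => [|i r IH].
  apply: (is_derive_ext (fun _ => 0)); first by move=> t; rewrite big_nil.
  by rewrite big_nil; apply: is_derive_const.
apply: (is_derive_ext (fun x => f i x + \big[Rplus/0]_(j <- r) f j x)).
  by move=> t; rewrite big_cons.
by rewrite big_cons; apply: (is_derive_plus (f i)).
Qed.

Section Quarter.
Context (k : R) (hk : 0 < k < 1).

Let K := ell_K k.

Lemma ell_K_gt1 : 1 < K.
Proof.
have h := PI2_3_2; have h0 : 0 <= PI / 2 by lra.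
have := ell_F_expand hk h0; rewrite ell_F_0 /K /ell_K; lra.
Qed.

Lemma sn_gt0 w : 0 < w < 2 * K -> 0 < sn k w.
Proof.
move=> hw; have [h|h] := Rle_or_lt w K.
  have a1 := @am_lt k hk 0 w ltac:(lra); rewrite am_0 // in a1.
  have a2 : am k w <= PI / 2.
    have [->|n] := Req_dec w K; first by rewrite am_K //; lra.
    by have := @am_lt k hk w K ltac:(lra); rewrite am_K //; lra.
  by apply: sin_gt_0; have := PI_RGT_0; lra.
have -> : w = w - K + K by ring.
rewrite sn_add_K //; apply: Rdiv_lt_0_compat; last by have := dn_bounds hk (w - K); lra.
have a1 := @am_lt k hk 0 (w - K) ltac:(lra); rewrite am_0 // in a1.
have a2 := @am_lt k hk (w - K) K ltac:(lra); rewrite am_K // in a2.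
by apply: cos_gt_0; have := PI_RGT_0; lra.
Qed.

Lemma sn_ge0 w : 0 <= w <= 2 * K -> 0 <= sn k w.
Proof.
move=> hw; have [e|n] := Req_dec w 0; first by rewrite e sn_0 //; lra.
have [e|n'] := Req_dec w (2 * K).
  have -> : w = 0 + 2 * K by rewrite e; ring.
  by rewrite sn_add_2K // sn_0 //; lra.
by apply/Rlt_le/sn_gt0; lra.
Qed.

Lemma sn_abs_le1 w : Rabs (sn k w) <= 1.
Proof. by apply: Rabs_le; have := SIN_bound (am k w); rewrite /sn; lra. Qed.

Lemma dn_ge w : compl_mod k <= dn k w.
Proof.
have d := dn_sqr w hk; have c := cn_sqr k w; have e := compl_mod_sqr hk.
have c0 := pow2_ge_0 (cn k w); have k0 := compl_mod_bounds hk.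
have d0 := dn_bounds hk w; have k2 : 0 < k ^ 2 by nra.
apply: Rnot_lt_le => h; nra.
Qed.

Lemma cn_abs_le w : Rabs (cn k w) <= Rabs (w - K).
Proof.
have bound a b : a <= b -> Rabs (cn k b - cn k a) <= b - a.
  move=> ab; have [c [_ ->]] := MVT_le ab (fun x _ => cn_derive hk x).
  rewrite Rabs_mult Rabs_Ropp Rabs_mult (Rabs_pos_eq (b - a)); last by lra.
  rewrite (Rabs_pos_eq (dn k c)); last by have := dn_bounds hk c; lra.
  have := sn_abs_le1 c; have := dn_bounds hk c; have := Rabs_pos (sn k c) => h1 h2 h3.
  have : Rabs (sn k c) * dn k c <= 1 by nra.
  nra.
have [h|h] := Rle_or_lt w K.
  have := bound _ _ h; rewrite /K cn_K // -/K Rabs_minus_sym Rminus_0_r.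
  by rewrite (Rabs_left1 (w - K)); lra.
have := bound K w ltac:(lra); rewrite {1}/K cn_K // Rminus_0_r.
by rewrite (Rabs_pos_eq (w - K)); lra.
Qed.

Lemma sn_ge_half w : Rabs (w - K) <= 1 / 2 -> 1 / 2 <= sn k w.
Proof.
move=> h; have := cn_abs_le w => h1.
have K1 := ell_K_gt1.
have s0 : 0 < sn k w by apply: sn_gt0; split_Rabs; lra.
have := sn_cn k w; have : Rabs (cn k w) <= 1 / 2 by lra.
move=> h2 h3; have : cn k w ^ 2 <= 1 / 4 by split_Rabs; nra.
by nra.
Qed.

Lemma cn_abs_ge x w : 0 <= x <= 1 / 2 -> 0 <= w <= 2 * K -> x <= Rabs (w - K) ->
  compl_mod k / 2 * x <= Rabs (cn k w).
Proof.
move=> hx hw hd; have K1 := ell_K_gt1; have k0 := compl_mod_bounds hk.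
have slope_near c : Rabs (c - K) <= 1 / 2 -> compl_mod k / 2 <= sn k c * dn k c.
  move=> hc; have := sn_ge_half hc; have := dn_ge c; nra.
have decr a b : 0 <= a -> a <= b -> b <= 2 * K -> cn k b <= cn k a.
  move=> a0 ab bK; have [c [hc e]] := MVT_le ab (fun x _ => cn_derive hk x).
  have := @sn_ge0 c ltac:(lra); have := dn_bounds hk c => h1 h2.
  have : 0 <= sn k c * dn k c by nra.
  nra.
have [h|h] := Rle_or_lt w K.
  rewrite Rabs_left1 in hd; last by lra.
  have h1 := decr w (K - x) ltac:(lra) ltac:(lra) ltac:(lra).
  have [c [hc e]] := MVT_le (a := K - x) (b := K) ltac:(lra) (fun x _ => cn_derive hk x).
  rewrite {1}/K cn_K // in e.
  have := slope_near c; have hc2 : Rabs (c - K) <= 1 / 2 by apply: Rabs_le; lra.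
  move=> /(_ hc2) h2; have := Rle_abs (cn k w); nra.
rewrite Rabs_pos_eq in hd; last by lra.
have h1 := decr (K + x) w ltac:(lra) ltac:(lra) ltac:(lra).
have [c [hc e]] := MVT_le (a := K) (b := K + x) ltac:(lra) (fun x _ => cn_derive hk x).
rewrite {2}/K cn_K // in e.
have := slope_near c; have hc2 : Rabs (c - K) <= 1 / 2 by apply: Rabs_le; lra.
move=> /(_ hc2) h2; have := Rle_abs (- cn k w); rewrite Rabs_Ropp; nra.
Qed.

End Quarter.

Lemma atan_cubic x : Rabs (atan x - x) <= Rabs x ^ 3.
Proof.
have der t : is_derive (fun t => atan t - t) t (/ (1 + t ^ 2) - 1).
  apply: is_derive_minus; last exact: is_derive_id.
  by apply/is_derive_Reals; apply: derivable_pt_lim_atan.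
have bound a b c : a <= c <= b -> Rabs a <= Rabs x -> Rabs b <= Rabs x ->
    Rabs (/ (1 + c ^ 2) - 1) <= Rabs x ^ 2.
  move=> hc ha hb; have c0 : 0 <= c ^ 2 by apply: pow2_ge_0.
  have cx : c ^ 2 <= Rabs x ^ 2.
    have : Rabs c <= Rabs x by split_Rabs; lra.
    by rewrite -(pow2_abs c) => h; have := Rabs_pos c; nra.
  apply: Rle_trans cx.
  have -> : / (1 + c ^ 2) - 1 = - (c ^ 2 / (1 + c ^ 2)) by field; lra.
  rewrite Rabs_Ropp Rabs_pos_eq; last by apply: Rdiv_le_0_compat; lra.
  by apply: (Rmult_le_reg_r (1 + c ^ 2)); [lra | field_simplify; nra].
have z : atan 0 - 0 = 0 by rewrite atan_0; ring.
have e3 : Rabs x ^ 3 = Rabs x ^ 2 * Rabs x by ring.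
have [h|h] := Rle_or_lt 0 x.
  have [c [hc e]] := MVT_le h (fun t _ => der t).
  rewrite z !Rminus_0_r in e; rewrite e Rabs_mult e3.
  apply: Rmult_le_compat_r; first exact: Rabs_pos.
  by apply: (bound 0 x c) => //; [rewrite Rabs_R0; apply: Rabs_pos | lra].
have [c [hc e]] := MVT_le (Rlt_le _ _ h) (fun t _ => der t).
rewrite z in e.
have -> : atan x - x = (/ (1 + c ^ 2) - 1) * x by lra.
rewrite Rabs_mult e3.
apply: Rmult_le_compat_r; first exact: Rabs_pos.
by apply: (bound x 0 c) => //; [lra | rewrite Rabs_R0; apply: Rabs_pos].
Qed.

Section Saddle.
Context (k : R) (hk : 0 < k < 1) (I : finType) (b : I -> R) (r : I -> nat) (v : R).

Let K := ell_K k.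
Let k' := compl_mod k.
Let hk' : 0 < k' < 1. Proof. exact: compl_mod_bounds. Qed.
Let W i := (v - b i) / 2.
Let N := \big[Rplus/0]_i INR (r i).

(** On the line [Im u = 2 K'] the factors have modulus [sqrt(k') / dn], whose
    logarithmic derivative is a multiple of [snc]; so this says that [v] is a
    critical point of the logarithm of the modulus of the product on that line. *)
Definition critical : Prop := \big[Rplus/0]_i (INR (r i) * snc k (W i)) = 0.

Definition common_arc : Prop :=
  exists a, a < v < a + 2 * K /\
    forall i, (0 < r i)%N -> a < b i < a + 2 * K.

Context (crit : critical) (arc : common_arc).

Lemma common_arc_pole_free : pole_free k b r v.
Proof. by move: arc => [a [hv h]] i /h; rewrite -/K; lra. Qed.

(** At a critical point the linear parts of the phases cancel. *)
Lemma phase_cubic tau : Rabs (phase k b r v tau) <= N * Rabs tau ^ 3.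
Proof.
have -> : phase k b r v tau =
  \big[Rplus/0]_i (INR (r i) * (atan (snc k (W i) * tau) - snc k (W i) * tau)).
  transitivity (\big[Rplus/0]_i (INR (r i) * atan (snc k (W i) * tau)
     + - tau * (INR (r i) * snc k (W i)))).
    by rewrite sumR_lin crit Rmult_0_r Rplus_0_r.
  by apply: eq_bigr => i _; ring.
apply: Rle_trans (sumR_abs_le _) _.
have -> : N * Rabs tau ^ 3 = \big[Rplus/0]_i (INR (r i) * Rabs tau ^ 3).
  by rewrite Rmult_comm -sumR_mull; apply: eq_bigr => i _; ring.
apply: sumR_le => i; have r0 := pos_INR (r i).
rewrite Rabs_mult (Rabs_pos_eq (INR _)) //; apply: Rmult_le_compat_l => //.
apply: Rle_trans (atan_cubic _) _; rewrite Rabs_mult.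
apply: pow_incr; split.
  by apply: Rmult_le_pos; apply: Rabs_pos.
have h1 : Rabs (snc k (W i)) <= 1.
  by have := snc_sqr_le1 hk (W i); split_Rabs; nra.
by have := Rabs_pos tau; nra.
Qed.

Let B t := (1 - t) * (1 - k' ^ 2 * t).

Lemma log_mod2_derive t : 0 < t ->
  is_derive (log_mod2 k b r v) t (\big[Rplus/0]_i (INR (r i) * slope k t (B t) (W i))).
Proof.
move=> t0; apply: (is_derive_sumR (f := fun i t => INR (r i) * ln (k' * sc_mod2 k t (W i)))) => i.
apply: is_derive_scal.
have e : locally t (fun t => ln k' + ln (sc_mod2 k t (W i)) = ln (k' * sc_mod2 k t (W i))).
  exists (mkposreal _ t0) => z hz.
  have z0 : 0 < z by move: hz; rewrite /ball /= /AbsRing_ball /= /abs /minus /plus /opp /=; split_Rabs; lra.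
  by rewrite ln_mult //; [case: hk' | apply: sc_mod2_gt0].
apply: is_derive_ext_loc e _.
apply: is_derive_eq.
  by apply: is_derive_plus; [exact: is_derive_const | exact: sc_mod2_deriv].
by rewrite /plus /zero /= Rplus_0_l.
Qed.

Let B_ge0 t : 0 < t <= 1 -> 0 <= B t <= 1 - t.
Proof.
move=> ht; have k2 : 0 < k' ^ 2 < 1 by nra.
have k3 : 0 <= k' ^ 2 * t <= 1 by nra.
rewrite /B; split; nra.
Qed.

(** This monotonicity reaches down to the real axis, however far from the saddle
    point; it spares a global estimate of the integrand. *)
Lemma log_mod2_incr t t' : 0 < t -> t <= t' -> t' <= 1 -> 0 < N ->
  log_mod2 k b r v t <= log_mod2 k b r v t'.
Proof.
move=> t0 tt t1 N0.
have [c [hc e]] := MVT_le tt (fun x hx => log_mod2_derive (Rlt_le_trans _ _ _ t0 (proj1 hx))).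
move: arc => [a [hv ha]].
have pos : 0 < \big[Rplus/0]_i (INR (r i) * slope k c (B c) (W i)).
  apply: (balanced_slope_gt0 hk (A := (v - a) / 2 - K)) => //; rewrite -/K; try lra.
  - by have := @B_ge0 c ltac:(lra); lra.
  - by move=> i; apply: pos_INR.
  - apply: Classical_Prop.NNPP => h; move: N0; rewrite /N.
    have -> : \big[Rplus/0]_i INR (r i) = 0; last by lra.
    rewrite big1 // => i _; apply: Rle_antisym; last exact: pos_INR.
    by apply: Rnot_lt_le => hi; apply: h; exists i.
  - move=> i ri; have {}ri : (0 < r i)%N.
      by rewrite lt0n; apply/eqP => z; move: ri; rewrite z /=; lra.
    by have := ha i ri; rewrite /W -/K; lra.
have tt' : 0 <= t' - t by lra.
have := Rmult_le_pos _ _ (Rlt_le _ _ pos) tt'; lra.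
Qed.

Context (D : R) (D0 : 0 < D <= 2)
  (hD : N * D <= \big[Rplus/0]_i (INR (r i) * dsnc k (W i))).

Lemma slope_near1 t w : 1 - D / 8 <= t <= 1 ->
  dsnc k w - D / 2 <= slope k t (B t) w <= 4.
Proof.
move=> ht; have t0 : 0 < t by lra.
have hB := @B_ge0 t ltac:(lra).
have h1 := snc_sqr_le1 hk w; have h0 := pow2_ge_0 (snc k w).
have d2 := dsnc_bound hk w.
set A := t + snc k w ^ 2 * B t.
have hA : t <= A <= 1 by rewrite /A; nra.
have e : slope k t (B t) w - dsnc k w = dsnc k w * ((1 - A) / A).
  by rewrite /slope -/A; field; lra.
have q : 0 <= (1 - A) / A <= D / 4.
  split; first by apply: Rdiv_le_0_compat; lra.
  by apply: (Rmult_le_reg_r A); [lra | field_simplify; nra].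
have : Rabs (dsnc k w * ((1 - A) / A)) <= 2 * (D / 4).
  rewrite Rabs_mult (Rabs_pos_eq ((1 - A) / A)); last by lra.
  by apply: Rmult_le_compat; [exact: Rabs_pos | lra ..].
move=> h; split_Rabs; lra.
Qed.

Lemma log_mod2_near1 t : 1 - D / 8 <= t <= 1 ->
  N * (D / 2) * (1 - t) <= log_mod2 k b r v 1 - log_mod2 k b r v t <= 4 * N * (1 - t).
Proof.
move=> ht; have t0 : 0 < t by lra.
have [c [hc e]] := MVT_le (proj2 ht)
  (fun x hx => log_mod2_derive (Rlt_le_trans _ _ _ t0 (proj1 hx))).
have hs i := @slope_near1 c (W i) ltac:(lra).
rewrite e.
have low : N * (D / 2) <= \big[Rplus/0]_i (INR (r i) * slope k c (B c) (W i)).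
  have : \big[Rplus/0]_i (INR (r i) * dsnc k (W i) + - (D / 2) * INR (r i)) <=
      \big[Rplus/0]_i (INR (r i) * slope k c (B c) (W i)).
    by apply: sumR_le => i; have := hs i; have := pos_INR (r i); nra.
  by rewrite sumR_lin -/N; lra.
have up : \big[Rplus/0]_i (INR (r i) * slope k c (B c) (W i)) <= 4 * N.
  rewrite /N -sumR_mull; apply: sumR_le => i.
  by have := hs i; have := pos_INR (r i); nra.
by split; apply: Rmult_le_compat_r => //; lra.
Qed.

End Saddle.

(** Bounds are obtained inside the segment only, since the logarithm of the
    modulus may be infinite at its ends, on the real axis. *)
Lemma Cmod_le_closure f M a b : C_continuous f -> a < b ->
  (forall s, a < s < b -> Cmod (f s) <= M) ->
  forall s, a <= s <= b -> Cmod (f s) <= M.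
Proof.
move=> cf ab h s hs; apply: Rnot_lt_le => lt.
have cont : continuous (fun s => Cmod (f s)) s.
  have [c1 c2] := cf s.
  apply: (continuous_comp (fun s => fst (f s) ^ 2 + snd (f s) ^ 2) sqrt).
    apply: (continuous_plus (fun s => fst (f s) ^ 2) (fun s => snd (f s) ^ 2)).
      by do !apply: (continuous_mult (fun s => fst (f s))) => //; apply: continuous_const.
    by do !apply: (continuous_mult (fun s => snd (f s))) => //; apply: continuous_const.
  exact: continuous_sqrt.
have e0 : 0 < Cmod (f s) - M by lra.
have [d hd] := proj1 (filterlim_locally _ _) cont (mkposreal _ e0).
have d0 := cond_pos d.
pose th := Rmin (1 / 2) (d / (b - a)).
have th0 : 0 < th by apply: Rmin_pos; [lra | apply: Rdiv_lt_0_compat; lra].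
have th1 : th <= 1 / 2 by apply: Rmin_l.
have th2 : th * (b - a) <= d.
  have : th <= d / (b - a) by apply: Rmin_r.
  move=> h2; have := Rmult_le_compat_r (b - a) _ _ ltac:(lra) h2.
  by have -> : d / (b - a) * (b - a) = d by field; lra.
pose s' := s + th * ((a + b) / 2 - s).
have h1 : a < s' < b by rewrite /s'; split; nra.
have h2 : ball s d s'.
  rewrite /ball /= /AbsRing_ball /= /abs /minus /plus /opp /= /s'.
  apply: Rabs_def1; nra.
have := hd s' h2; rewrite /ball /= /AbsRing_ball /= /abs /minus /plus /opp /=.
have := h s' h1; split_Rabs; lra.
Qed.

Lemma exp_neg_le x : 0 < x -> exp (- x) <= 4 / x ^ 2.
Proof.
move=> x0; have h := exp_ineq1 (x / 2) ltac:(lra).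
have e : exp x = exp (x / 2) * exp (x / 2) by rewrite -exp_plus; congr exp; field.
have e2 : x ^ 2 / 4 <= exp x by rewrite e; nra.
rewrite exp_Ropp; have x2 : 0 < x ^ 2 by apply: pow_lt.
have -> : 4 / x ^ 2 = / (x ^ 2 / 4) by field; lra.
by apply: Rinv_le_contravar; lra.
Qed.

Lemma cos_ge_half x : Rabs x <= 1 -> 1 / 2 <= cos x.
Proof.
move=> hx; have p := PI2_3_2; rewrite -cos_PI3.
have -> : cos x = cos (Rabs x).
  by rewrite /Rabs; case: Rcase_abs => // _; rewrite cos_neg.
by have h := Rabs_pos x; apply: cos_decr_1; lra.
Qed.

Section Concentration.
Context (k : R) (hk : 0 < k < 1) (I : finType) (b : I -> R).

Let k' := compl_mod k.
Let hk' : 0 < k' < 1. Proof. exact: compl_mod_bounds. Qed.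
Let K' := ell_K k'.

Lemma fac_sign_neq0 (r : I -> nat) : fac_sign r <> 0.
Proof.
rewrite /fac_sign; elim/big_ind: _ => [|x y hx hy|i _]; first by lra.
  exact: Rmult_integral_contrapositive_currified.
by apply: pow_nonzero; lra.
Qed.

Section Normalized.
Context (r : I -> nat) (v : R).

Definition fac_prod_peak : C := RtoC (fac_sign r * exp (log_mod2 k b r v 1 / 2)).

Definition fac_prod_normal (s : R) : C :=
  Cmult (Cinv fac_prod_peak) (fac_prod k b r v s).

Lemma fac_prod_peak_neq0 : fac_prod_peak <> RtoC 0.
Proof.
move=> /RtoC_inj; apply: Rmult_integral_contrapositive_currified.
  exact: fac_sign_neq0.
by have := exp_pos (log_mod2 k b r v 1 / 2); lra.
Qed.

Lemma fac_prod_normal_polar s : 0 < s < 4 * K' ->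
  fac_prod_normal s = Cmult
    (RtoC (exp (- ((log_mod2 k b r v 1 - log_mod2 k b r v (sn k' (s / 2) ^ 2)) / 2))))
    (cis (- phase k b r v (cn k' (s / 2) * dn k' (s / 2) / sn k' (s / 2)))).
Proof.
move=> hs; have s0 : 0 < sn k' (s / 2) by apply: sn_gt0; rewrite // -/K'; lra.
rewrite /fac_prod_normal fac_prod_polar // -/k' Cmult_assoc; congr Cmult.
rewrite /fac_prod_peak -RtoC_inv; last first.
  apply: Rmult_integral_contrapositive_currified; first exact: fac_sign_neq0.
  by have := exp_pos (log_mod2 k b r v 1 / 2); lra.
rewrite -RtoC_mult; congr RtoC.
set L1 := log_mod2 k b r v 1; set L := log_mod2 k b r v _.
have -> : - ((L1 - L) / 2) = L / 2 + - (L1 / 2) by field.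
rewrite exp_plus exp_Ropp; field; split; last exact: fac_sign_neq0.
by have := exp_pos (L1 / 2); lra.
Qed.

Lemma Cmod_fac_prod_normal s : 0 < s < 4 * K' ->
  Cmod (fac_prod_normal s) =
    exp (- ((log_mod2 k b r v 1 - log_mod2 k b r v (sn k' (s / 2) ^ 2)) / 2)).
Proof.
move=> hs; rewrite fac_prod_normal_polar // Cmod_mult Cmod_R.
rewrite Rabs_pos_eq; last by apply/Rlt_le/exp_pos.
have -> : forall x, Cmod (cis x) = 1; last by ring.
by move=> x; rewrite /cis /Cmod /= !Rmult_1_r -!/(Rsqr _) Rplus_comm sin2_cos2 sqrt_1.
Qed.

Lemma Re_fac_prod_normal s : 0 < s < 4 * K' ->
  fst (fac_prod_normal s) = Cmod (fac_prod_normal s)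
   * cos (phase k b r v (cn k' (s / 2) * dn k' (s / 2) / sn k' (s / 2))).
Proof.
move=> hs; rewrite Cmod_fac_prod_normal // fac_prod_normal_polar //.
by rewrite /Cmult /cis /RtoC /= cos_neg; ring.
Qed.

End Normalized.

(** With [N] factors, the phase is negligible at the scale [N ^ (-1/3)], while
    the modulus has the width [N ^ (-1/2)] of a Gaussian and is already
    exponentially small at that scale: with [nu = N ^ (1/6)] these scales are
    [nu ^ -2] and [nu ^ -3]. *)
Lemma saddle_concentration D M eps del :
  0 < D <= 2 -> 0 <= M -> 0 < eps <= 1 -> 0 < del ->
  exists N0, forall (r : I -> nat) (v : R),
  critical k b r v -> common_arc k b r v ->
  N0 <= \big[Rplus/0]_i INR (r i) ->
  \big[Rplus/0]_i INR (r i) * D <=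
    \big[Rplus/0]_i (INR (r i) * dsnc k ((v - b i) / 2)) ->
  forall (g : R -> C) (gam : C), C_continuous g ->
  (forall s, 0 <= s <= 4 * K' -> Cmod (g s) <= M) -> Cmod gam <= M ->
  (forall s, Rabs (s - 2 * K') <= del -> Cmod (Cminus (g s) gam) <= eps) ->
  let E := fac_prod k b r v in
  CInt E 0 (4 * K') <> RtoC 0 /\
  Cmod (Cminus (CInt (fun s => Cmult (g s) (E s)) 0 (4 * K'))
               (Cmult gam (CInt E 0 (4 * K'))))
    <= 6 * eps * Cmod (CInt E 0 (4 * K')).
Proof.
move=> hD M0 heps del0.
have kk : compl_mod k' = k.
  rewrite /compl_mod /k' compl_mod_sqr // -[RHS](sqrt_pow2 k); last by lra.
  by congr sqrt; ring.
have K1 : 1 < K' by apply: ell_K_gt1.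
(* At the distance [rad] from the saddle point, [1 - t] is at least
   [a1 * rad ^ 2], so that the modulus has dropped to [exp (- c2 * nu ^ 2)]. *)
pose a1 := Rmin (k ^ 2 / 16) (D / 8).
have a10 : 0 < a1 by apply: Rmin_pos; [have : 0 < k ^ 2 by nra|]; lra.
pose c2 := D / 4 * a1.
have c20 : 0 < c2 by apply: Rmult_lt_0_compat; lra.
have ce0 : 0 < c2 ^ 2 * eps by apply: Rmult_lt_0_compat; [apply: pow_lt | lra].
pose q := 64 * (2 * M + 1) * K' / (c2 ^ 2 * eps).
have q0 : 0 < q by apply: Rdiv_lt_0_compat => //; nra.
have id0 : 0 < / del by apply: Rinv_0_lt_compat.
have iD0 : 0 < 2 / D by apply: Rdiv_lt_0_compat; lra.
(* The four terms respectively make the near interval shorter than 1, than [del]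
   and than the range of the quadratic estimates, and the far part negligible. *)
pose nu0 := 1 + / del + 2 / D + q.
exists (nu0 ^ 6) => r v crit arc NN0 hDN g gam cg gM gamM gnear E.
set N := \big[Rplus/0]_i INR (r i) in NN0 hDN.
have nu01 : 1 <= nu0 by rewrite /nu0; lra.
have N1 : 1 <= N by apply: Rle_trans NN0; apply: pow_R1_Rle.
pose nu := Rpower N (/ 6).
have nupos : 0 < nu by apply: exp_pos.
have nu6 : nu ^ 6 = N.
  rewrite -Rpower_pow // /nu Rpower_mult.
  have -> : / 6 * INR 6 = 1 by rewrite /=; field.
  by apply: Rpower_1; lra.
have nunu : nu0 <= nu.
  apply: Rnot_lt_le => h.
  have : nu ^ 6 < nu0 ^ 6; last by lra.
  have h2 : nu ^ 2 < nu0 ^ 2 by nra.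
  have -> : nu ^ 6 = (nu ^ 2) * (nu ^ 2 * nu ^ 2) by ring.
  have -> : nu0 ^ 6 = (nu0 ^ 2) * (nu0 ^ 2 * nu0 ^ 2) by ring.
  have p2 : 0 < nu ^ 2 by nra.
  move: (nu ^ 2) (nu0 ^ 2) h2 p2 => x y h2 p2.
  have : x * x < y * y by nra.
  by nra.
have nu1 : 1 <= nu by lra.
pose i := / nu.
have i0 : 0 < i by apply: Rinv_0_lt_compat.
have inu : i * nu = 1 by rewrite /i; field; lra.
have i1 : i <= 1 by nra.
have idel : i <= del.
  rewrite /i -[X in _ <= X]Rinv_inv; apply: Rinv_le_contravar => //.
  by rewrite /nu0 in nunu; lra.
have iD : i <= D / 2.
  have -> : D / 2 = / (2 / D) by field; lra.
  by apply: Rinv_le_contravar => //; rewrite /nu0 in nunu; lra.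
pose rad := i ^ 2.
have rad0 : 0 < rad by apply: pow_lt.
have radi : rad <= i by rewrite /rad; nra.
have Nrad : N * rad ^ 3 = 1.
  have -> : N * rad ^ 3 = (i * nu) ^ 6 by rewrite -nu6 /rad; ring.
  by rewrite inu; ring.
have Ncore : N * (i ^ 3) ^ 2 = 1.
  have -> : N * (i ^ 3) ^ 2 = (i * nu) ^ 6 by rewrite -nu6; ring.
  by rewrite inu; ring.
have Nfar : N * rad ^ 2 = nu ^ 2.
  have -> : N * rad ^ 2 = (i * nu) ^ 4 * nu ^ 2 by rewrite -nu6 /rad; ring.
  by rewrite inu; ring.
have core_rad : i ^ 3 <= rad by rewrite /rad; have := pow_lt i 2 i0; nra.
have rad2 : rad ^ 2 / 4 <= D / 8.
  have : rad ^ 2 <= rad by nra.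
  lra.
have E_cont : C_continuous E.
  by apply: fac_prod_continuous => //; apply: common_arc_pole_free.
pose En := fac_prod_normal r v.
have cEn : C_continuous En by apply: C_continuous_mult => //; apply: C_continuous_const.
have near_data s : Rabs (s - 2 * K') <= rad ->
    [/\ 0 < s < 4 * K', 1 / 2 <= sn k' (s / 2),
        cn k' (s / 2) ^ 2 <= (s - 2 * K') ^ 2 / 4
      & 1 - D / 8 <= sn k' (s / 2) ^ 2 <= 1].
  move=> hs; have hs2 : Rabs (s / 2 - K') <= 1 / 2 by split_Rabs; lra.
  have h1 := cn_abs_le hk' (s / 2); rewrite -/K' in h1.
  have h2 : cn k' (s / 2) ^ 2 <= (s - 2 * K') ^ 2 / 4.
    rewrite -(pow2_abs (cn _ _)).
    have -> : (s - 2 * K') ^ 2 / 4 = Rabs (s / 2 - K') ^ 2 by rewrite pow2_abs; field.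
    by apply: pow_incr; split => //; apply: Rabs_pos.
  have h3 : (s - 2 * K') ^ 2 <= rad ^ 2.
    by rewrite -(pow2_abs (s - _)); apply: pow_incr; split => //; apply: Rabs_pos.
  have h4 := sn_cn k' (s / 2); have := pow2_ge_0 (cn k' (s / 2)) => h5.
  split => //; [split_Rabs; lra | exact: sn_ge_half | split; lra].
have phase_small s : Rabs (s - 2 * K') <= rad ->
    1 / 2 <= cos (phase k b r v (cn k' (s / 2) * dn k' (s / 2) / sn k' (s / 2))).
  move=> hs; have [hs1 s1 hc ht] := near_data s hs.
  apply: cos_ge_half; apply: Rle_trans (phase_cubic hk crit _) _; rewrite -/N -[X in _ <= X]Nrad.
  apply: Rmult_le_compat_l; first by lra.
  apply: pow_incr; split; first exact: Rabs_pos.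
  have d0 := dn_bounds hk' (s / 2).
  have h1 : Rabs (cn k' (s / 2)) <= rad / 2.
    have : Rabs (cn k' (s / 2)) ^ 2 <= (Rabs (s - 2 * K') / 2) ^ 2.
      by rewrite /Rdiv Rpow_mult_distr !pow2_abs; lra.
    have := Rabs_pos (cn k' (s / 2)); have := Rabs_pos (s - 2 * K') => h1 h2 h3.
    by nra.
  rewrite Rabs_div; last by lra.
  rewrite Rabs_mult (Rabs_pos_eq (dn _ _)); last by lra.
  rewrite (Rabs_pos_eq (sn _ _)); last by lra.
  apply: (Rmult_le_reg_r (sn k' (s / 2))); first by lra.
  have -> : Rabs (cn k' (s / 2)) * dn k' (s / 2) / sn k' (s / 2) * sn k' (s / 2) =
    Rabs (cn k' (s / 2)) * dn k' (s / 2) by field; lra.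
  have := Rabs_pos (cn k' (s / 2)); nra.
have main : CInt En 0 (4 * K') <> RtoC 0 /\
    Cmod (Cminus (CInt (fun s => Cmult (g s) (En s)) 0 (4 * K'))
               (Cmult gam (CInt En 0 (4 * K'))))
    <= 6 * eps * Cmod (CInt En 0 (4 * K')).
  apply: (@laplace_concentration En g (4 * K') (2 * K') rad (i ^ 3) (1 / 4)
    (exp (- (c2 * nu ^ 2))) eps M gam) => //; try lra.
  - exact: pow_lt.
  - move=> s hs; have [hs1 _ _ _] := near_data s hs.
    rewrite Re_fac_prod_normal //; have := phase_small s hs.
    by have := Cmod_ge_0 (En s); rewrite -/(En s); nra.
  - move=> s hs; have hs' : Rabs (s - 2 * K') <= rad by lra.
    have [hs1 s1 hc ht] := near_data s hs'.
    rewrite Re_fac_prod_normal //; have := phase_small s hs'.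
    rewrite Cmod_fac_prod_normal //.
    have [_ up] := log_mod2_near1 hk hD hDN ht.
    rewrite -/N in up.
    set L := log_mod2 _ _ _ _ 1 - _ in up *.
    have L1 : L <= 1.
      apply: Rle_trans up _; rewrite -[X in _ <= X]Ncore.
      have -> : 1 - sn k' (s / 2) ^ 2 = cn k' (s / 2) ^ 2 by rewrite cn_sqr.
      have : (s - 2 * K') ^ 2 <= (i ^ 3) ^ 2.
        by rewrite -(pow2_abs (s - _)); apply: pow_incr; split => //; apply: Rabs_pos.
      by move=> h; nra.
    have := exp_ineq1_le (- (L / 2)) => h1 h2.
    have h3 : 1 / 2 <= exp (- (L / 2)) by lra.
    by nra.
  - move=> s0 hs0 hr.
    have interior s : 0 < s < 4 * K' -> rad <= Rabs (s - 2 * K') ->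
        Cmod (En s) <= exp (- (c2 * nu ^ 2)).
      move=> hs hrs; rewrite Cmod_fac_prod_normal //.
      have s1 : 0 < sn k' (s / 2) by apply: sn_gt0; rewrite // -/K'; lra.
      have hc : k / 2 * (rad / 2) <= Rabs (cn k' (s / 2)).
        rewrite -{1}kk; apply: cn_abs_ge => //; rewrite -/K'; try lra.
        by move: hrs; split_Rabs; lra.
      have t1 : sn k' (s / 2) ^ 2 <= 1 - a1 * rad ^ 2.
        have e : sn k' (s / 2) ^ 2 = 1 - Rabs (cn k' (s / 2)) ^ 2.
          by have := sn_cn k' (s / 2); rewrite pow2_abs; lra.
        have h1 : (k / 2 * (rad / 2)) ^ 2 <= Rabs (cn k' (s / 2)) ^ 2.
          by apply: pow_incr; split => //; nra.
        have h2 : a1 <= k ^ 2 / 16 by apply: Rmin_l.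
        have h3 : a1 * rad ^ 2 <= k ^ 2 / 16 * rad ^ 2.
          by apply: Rmult_le_compat_r => //; apply: pow2_ge_0.
        by rewrite e; lra.
      have r1 : rad ^ 2 <= 1 by nra.
      have a1D : a1 <= D / 8 by apply: Rmin_r.
      have ar : 0 < a1 * rad ^ 2 <= D / 8 by have := pow_lt rad 2 rad0; nra.
      have t0 : 0 < sn k' (s / 2) ^ 2 by apply: pow_lt.
      have inc := @log_mod2_incr k hk I b r v crit arc _ (1 - a1 * rad ^ 2) t0 t1
        ltac:(lra) (Rlt_le_trans _ _ _ Rlt_0_1 N1).
      have [low _] := @log_mod2_near1 k hk I b r v D hD hDN
        (1 - a1 * rad ^ 2) ltac:(lra).
      have exp_mono x y : x <= y -> exp x <= exp y.
        by case=> [/exp_increasing|->]; lra.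
      apply: exp_mono; rewrite -/N in low; rewrite /c2 -Nfar; lra.
    have [h|h] := Rle_or_lt s0 (2 * K').
      rewrite Rabs_left1 in hr; last by lra.
      apply: (@Cmod_le_closure En _ 0 (2 * K' - rad)) => //; try lra.
      by move=> s hs; apply: interior; [lra | rewrite Rabs_left1; lra].
    rewrite Rabs_pos_eq in hr; last by lra.
    apply: (@Cmod_le_closure En _ (2 * K' + rad) (4 * K')) => //; try lra.
    by move=> s hs; apply: interior; [lra | rewrite Rabs_pos_eq; lra].
  - by move=> s hs; apply: gnear; lra.
  - have n2 : 0 < c2 * nu ^ 2 by apply: Rmult_lt_0_compat => //; apply: pow_lt.
    have h := exp_neg_le n2.
    have qnu : q <= nu by rewrite /nu0 in nunu; lra.
    have h1 : 64 * (2 * M + 1) * K' <= nu * (c2 ^ 2 * eps).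
      have -> : 64 * (2 * M + 1) * K' = q * (c2 ^ 2 * eps) by rewrite /q; field; lra.
      by apply: Rmult_le_compat_r; lra.
    have h2 : 4 / (c2 * nu ^ 2) ^ 2 = 4 * i ^ 4 / c2 ^ 2.
      by rewrite /i; field; lra.
    rewrite h2 in h.
    have mk0 : 0 <= (2 * M + 1) * (4 * K') by nra.
    have h3 : (2 * M + 1) * (exp (- (c2 * nu ^ 2)) * (4 * K')) <=
       (2 * M + 1) * (4 * K') * (4 * i ^ 4 / c2 ^ 2).
      have := Rmult_le_compat_l _ _ _ mk0 h; lra.
    apply: Rle_trans h3 _.
    have c22 : 0 < c2 ^ 2 by apply: pow_lt.
    apply: (Rmult_le_reg_r (c2 ^ 2)) => //.
    have -> : (2 * M + 1) * (4 * K') * (4 * i ^ 4 / c2 ^ 2) * c2 ^ 2 =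
      64 * (2 * M + 1) * K' * (i ^ 4 / 4) by field; lra.
    have -> : eps * (i ^ 3 * (1 / 4)) * c2 ^ 2 = nu * (c2 ^ 2 * eps) * (i ^ 4 / 4).
      have -> : i ^ 4 = i ^ 3 * i by ring.
      have -> : nu * (c2 ^ 2 * eps) * (i ^ 3 * i / 4) =
        (i * nu) * (c2 ^ 2 * eps * i ^ 3 / 4) by field.
      by rewrite inu; field.
    by apply: Rmult_le_compat_r => //; have := pow_lt i 4 i0; lra.
have pk := @fac_prod_peak_neq0 r v.
have EE s : E s = Cmult (fac_prod_peak r v) (En s).
  by rewrite /En /fac_prod_normal Cmult_assoc Cinv_r // Cmult_1_l.
have IE : CInt E 0 (4 * K') = Cmult (fac_prod_peak r v) (CInt En 0 (4 * K')).
  by rewrite -CInt_Cmult //; apply: RInt_ext => s _; apply: EE.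
have IgE : CInt (fun s => Cmult (g s) (E s)) 0 (4 * K') =
    Cmult (fac_prod_peak r v) (CInt (fun s => Cmult (g s) (En s)) 0 (4 * K')).
  rewrite -CInt_Cmult; last exact: C_continuous_mult.
  have e s : Cmult (g s) (E s) = Cmult (fac_prod_peak r v) (Cmult (g s) (En s)).
    by rewrite EE; ring.
  by apply: RInt_ext => s _; apply: e.
have [nz le] := main; split.
  by rewrite IE; apply: Cmult_neq_0.
rewrite IE IgE.
have -> : Cminus (Cmult (fac_prod_peak r v) (CInt (fun s => Cmult (g s) (En s)) 0 (4 * K')))
    (Cmult gam (Cmult (fac_prod_peak r v) (CInt En 0 (4 * K')))) =
  Cmult (fac_prod_peak r v) (Cminus (CInt (fun s => Cmult (g s) (En s)) 0 (4 * K'))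
    (Cmult gam (CInt En 0 (4 * K')))) by ring.
rewrite !Cmod_mult -Rmult_assoc (Rmult_comm (6 * eps)) Rmult_assoc.
by apply: Rmult_le_compat_l => //; apply: Cmod_ge_0.
Qed.

End Concentration.

(** * Ratios of vertical integrals along a sequence of exponents *)

Lemma eventually_forall (T : finType) (P : T -> nat -> Prop) :
  (forall t, eventually (P t)) -> eventually (fun m => forall t, P t m).
Proof.
move=> h.
have : eventually (fun m => forall t, t \in enum T -> P t m).
  elim: (enum T) => [|t s IH]; first by exists 0%N.
  apply: filter_imp (filter_and _ _ (h t) IH) => m [h1 h2] u.
  by rewrite in_cons => /orP [/eqP ->|/h2].
by apply: filter_imp => m hm t; apply: hm; rewrite mem_enum.
Qed.

Lemma is_lim_seq_sumR (I : finType) (u : I -> nat -> R) (l : I -> R) :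
  (forall i, is_lim_seq (u i) (l i)) ->
  is_lim_seq (fun m => \big[Rplus/0]_i u i m) (\big[Rplus/0]_i l i).
Proof.
move=> h.
suff H : is_lim_seq (fun m => \big[Rplus/0]_(i <- index_enum I) u i m)
  (\big[Rplus/0]_(i <- index_enum I) l i) by [].
elim: (index_enum I) => [|i r IH].
  apply: (is_lim_seq_ext (fun _ => 0)); first by move=> m; rewrite big_nil.
  by rewrite big_nil; apply: is_lim_seq_const.
apply: (is_lim_seq_ext (fun m => u i m + \big[Rplus/0]_(j <- r) u j m)).
  by move=> m; rewrite big_cons.
by rewrite big_cons; apply: is_lim_seq_plus'.
Qed.

Lemma is_lim_seq_lt (u : nat -> R) (l a : R) : is_lim_seq u l -> a < l ->
  eventually (fun m => a < u m).
Proof.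
move=> /is_lim_seq_spec h al; have e0 : 0 < l - a by lra.
by apply: filter_imp (h (mkposreal _ e0)) => m /=; split_Rabs; lra.
Qed.

Lemma is_lim_seq_gt (u : nat -> R) (l a : R) : is_lim_seq u l -> l < a ->
  eventually (fun m => u m < a).
Proof.
move=> /is_lim_seq_spec h al; have e0 : 0 < a - l by lra.
by apply: filter_imp (h (mkposreal _ e0)) => m /=; split_Rabs; lra.
Qed.

Lemma Cmod_le_Rabs (z : C) : Cmod z <= Rabs (fst z) + Rabs (snd z).
Proof.
have e : z = Cplus (RtoC (fst z)) (Cmult Ci (RtoC (snd z))).
  by case: z => a c; rewrite /Cplus /Cmult /Ci /RtoC /=; congr pair; ring.
rewrite {1}e; apply: Rle_trans (Cmod_triangle _ _) _.
by rewrite Cmod_mult Cmod_Ci !Cmod_R; lra.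
Qed.

Lemma continuous_bounded (f : R -> R) a c : a <= c -> (forall s, continuous f s) ->
  exists M, forall s, a <= s <= c -> Rabs (f s) <= M.
Proof.
move=> ac cf.
have [x [hx _]] := continuity_ab_maj (fun s => Rabs (f s)) a c ac
  (fun s _ => proj2 (continuity_pt_filterlim _ _)
     (continuous_comp f Rabs s (cf s) (continuous_Rabs (f s)))).
by exists (Rabs (f x)).
Qed.

(** By compactness; the same constants serve for all the lines near the segment. *)
Lemma holomorphic_near_segment U f v0 T : 0 <= T -> holomorphic_on U f -> U v0 ->
  exists M, 0 <= M /\ forall eps, 0 < eps <= 1 -> exists del, 0 < del /\
  forall v, Rabs (v - v0) <= del ->
    (forall s, 0 <= s <= T -> Cmod (f v s) <= M) /\
    (forall s c, 0 <= s <= T -> 0 <= c <= T -> Rabs (s - c) <= del ->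
       Cmod (Cminus (f v s) (f v0 c)) <= eps).
Proof.
move=> T0 hol Uv; have cf := holomorphic_C_continuous hol Uv.
have [M1 h1] := continuous_bounded T0 (fun s => proj1 (cf s)).
have [M2 h2] := continuous_bounded T0 (fun s => proj2 (cf s)).
have M1p : 0 <= M1 by have := h1 0 ltac:(lra); have := Rabs_pos (fst (f v0 0)); lra.
have M2p : 0 <= M2 by have := h2 0 ltac:(lra); have := Rabs_pos (snd (f v0 0)); lra.
exists (M1 + M2 + 1); split; first by lra.
move=> eps heps; have [f' hf] := hol.
have e0 : 0 < eps / 2 by lra.
have [d1 hd1] := uniform_continuity_2d_1d' (fun v s => fst (f v s)) 0 T v0
  (fun s _ => cd_re_cont (hf v0 s Uv)) (mkposreal _ e0).
have [d2 hd2] := uniform_continuity_2d_1d' (fun v s => snd (f v s)) 0 T v0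
  (fun s _ => cd_im_cont (hf v0 s Uv)) (mkposreal _ e0).
have p1 := cond_pos d1; have p2 := cond_pos d2.
pose del := Rmin d1 d2 / 2.
have m1 := Rmin_l d1 d2; have m2 := Rmin_r d1 d2; have m0 := Rmin_pos _ _ p1 p2.
exists del; split; first by rewrite /del; lra.
move=> v hv.
have close s c : 0 <= s <= T -> 0 <= c <= T -> Rabs (s - c) <= del ->
    Cmod (Cminus (f v s) (f v0 c)) <= eps.
  move=> hs hc hsc; apply: Rle_trans (Cmod_le_Rabs _) _.
  have a1 := hd1 c v0 s v hc ltac:(lra) hs ltac:(rewrite /del in hv; split_Rabs; lra)
    ltac:(rewrite /del in hsc; lra).
  have a2 := hd2 c v0 s v hc ltac:(lra) hs ltac:(rewrite /del in hv; split_Rabs; lra)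
    ltac:(rewrite /del in hsc; lra).
  by move: a1 a2; rewrite /Cminus /Cplus /Copp /=; rewrite /Rminus; lra.
split => // s hs.
have -> : f v s = Cplus (f v0 s) (Cminus (f v s) (f v0 s)) by ring.
apply: Rle_trans (Cmod_triangle _ _) _.
have := close s s hs hs; rewrite Rminus_diag Rabs_R0 /del => /(_ ltac:(lra)) h.
have := Cmod_le_Rabs (f v0 s); have := h1 s hs; have := h2 s hs; lra.
Qed.

Section Ratio.
Context (k : R) (hk : 0 < k < 1) (I : finType) (b : I -> R).

Let K := ell_K k.
Let k' := compl_mod k.
Let hk' : 0 < k' < 1. Proof. exact: compl_mod_bounds. Qed.
Let K' := ell_K k'.

Lemma fac_prod_add (p q : I -> nat) v s :
  fac_prod k b (fun i => p i + q i)%N v s = Cmult (fac_prod k b p v s) (fac_prod k b q v s).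
Proof.
rewrite /fac_prod -big_split; apply: eq_bigr => i _ /=.
by rewrite -plusE Cpow_add_r.
Qed.

Lemma fac_prod_peak_value_neq0 p v : fac_prod k b p v (2 * K') <> RtoC 0.
Proof.
have K1 := ell_K_gt1 hk'.
have h : 0 < sn k' (2 * K' / 2).
  by apply: sn_gt0 => //; rewrite -/K' in K1 *; lra.
rewrite fac_prod_polar //; apply: Cmult_neq_0.
  move=> /RtoC_inj; apply: Rmult_integral_contrapositive_currified.
    exact: fac_sign_neq0.
  by apply: Rgt_not_eq; apply: exp_pos.
move=> e; have := sin2_cos2 (- phase k b p v (cn k' (2 * K' / 2) * dn k' (2 * K' / 2) / sn k' (2 * K' / 2))).
by case: e => -> ->; rewrite /Rsqr; lra.
Qed.

Lemma dsnc_lipschitz x y : Rabs (dsnc k x - dsnc k y) <= 6 * Rabs (x - y).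
Proof.
wlog xy : x y / y <= x.
  move=> w; have [h|h] := Rle_or_lt y x; first exact: w.
  by rewrite Rabs_minus_sym (Rabs_minus_sym x); apply: w; lra.
have [c [_ ->]] := MVT_le xy (fun t _ => dsnc_derive hk t).
rewrite Rabs_mult; apply: Rmult_le_compat_r; first exact: Rabs_pos.
have h2 := snc_sqr_le1 hk c; have h1 : Rabs (snc k c) <= 1 by split_Rabs; nra.
have k2 : 0 < k ^ 2 < 1 by nra.
have -> : - (2 * (2 - k ^ 2)) * snc k c + 2 * k ^ 4 * snc k c ^ 3 =
  snc k c * (2 * (k ^ 2 * k ^ 2 * snc k c ^ 2) - 2 * (2 - k ^ 2)) by ring.
rewrite Rabs_mult.
have h3 : 0 <= k ^ 2 * k ^ 2 * snc k c ^ 2 <= 1.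
  have := pow2_ge_0 (snc k c) => s0.
  have k4 : 0 < k ^ 2 * k ^ 2 < 1 by nra.
  by nra.
have h4 : Rabs (2 * (k ^ 2 * k ^ 2 * snc k c ^ 2) - 2 * (2 - k ^ 2)) <= 6.
  by apply: Rabs_le; lra.
have := Rabs_pos (snc k c); have := Rabs_pos (2 * (k ^ 2 * k ^ 2 * snc k c ^ 2) - 2 * (2 - k ^ 2)).
nra.
Qed.

Section Limit.
Context (v0 : R) (n : I -> R).

Definition balance (w : I -> R) (v : R) : R :=
  \big[Rplus/0]_i (w i * snc k ((v - b i) / 2)).
Definition stiffness (w : I -> R) (v : R) : R :=
  \big[Rplus/0]_i (w i * dsnc k ((v - b i) / 2)).

Lemma balance_derive w v : is_derive (balance w) v (stiffness w v / 2).
Proof.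
have -> : stiffness w v / 2 = \big[Rplus/0]_i (w i * (/ 2 * dsnc k ((v - b i) / 2))).
  by rewrite /stiffness {1}/Rdiv Rmult_comm -sumR_mull; apply: eq_bigr => i _; ring.
apply: (is_derive_sumR (f := fun i v => w i * snc k ((v - b i) / 2))) => i.
apply: is_derive_scal.
apply: (is_derive_comp (snc k) (fun v => (v - b i) / 2)); first exact: snc_derive.
by auto_derive => //; field.
Qed.

Lemma stiffness_near w v v' : (forall i, 0 <= w i) ->
  stiffness w v - 3 * Rabs (v' - v) * \big[Rplus/0]_i w i <= stiffness w v'.
Proof.
move=> w0; rewrite /stiffness.
have -> : forall a c, a - c = a + - c by move=> *; ring.
rewrite Ropp_mult_distr_l -sumR_lin; apply: sumR_le => i.
have h := dsnc_lipschitz ((v' - b i) / 2) ((v - b i) / 2).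
have e : Rabs ((v' - b i) / 2 - (v - b i) / 2) = Rabs (v' - v) / 2.
  have -> : (v' - b i) / 2 - (v - b i) / 2 = (v' - v) / 2 by field.
  by rewrite Rabs_div; [rewrite (Rabs_pos_eq 2) | ]; lra.
rewrite e in h.
have : dsnc k ((v - b i) / 2) - 3 * Rabs (v' - v) <= dsnc k ((v' - b i) / 2).
  by split_Rabs; lra.
have := w0 i; nra.
Qed.

Context (n0 : forall i, 0 <= n i) (n1 : \big[Rplus/0]_i n i = 1)
  (bal0 : balance n v0 = 0) (stiff0 : 0 < stiffness n v0).

(** Since [v0] is a nondegenerate zero of the limiting balance, the balances of
    nearby weights have zeros near [v0]. *)
Lemma saddle_location (w : nat -> I -> R) del : 0 < del ->
  (forall m i, 0 <= w m i) -> (forall i, is_lim_seq (fun m => w m i) (n i)) ->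
  eventually (fun m => exists v, [/\ Rabs (v - v0) <= del, balance (w m) v = 0 &
    stiffness n v0 / 2 * \big[Rplus/0]_i w m i <= stiffness (w m) v]).
Proof.
move=> del0 w0 hw; set D := stiffness n v0.
have D0 : 0 < D := stiff0.
pose d := Rmin del (D / 12).
have d0 : 0 < d by apply: Rmin_pos; lra.
have dd : d <= del by apply: Rmin_l.
have dD : d <= D / 12 by apply: Rmin_r.
have st v : Rabs (v - v0) <= d -> 0 < stiffness n v.
  move=> hv; have := stiffness_near v0 v n0; rewrite n1 -/D; lra.
have right0 : 0 < balance n (v0 + d).
  have [c [hc e]] := MVT_le (a := v0) (b := v0 + d) ltac:(lra) (fun x _ => balance_derive n x).
  have := st c ltac:(apply: Rabs_le; lra); rewrite bal0 in e; nra.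
have left0 : balance n (v0 - d) < 0.
  have [c [hc e]] := MVT_le (a := v0 - d) (b := v0) ltac:(lra) (fun x _ => balance_derive n x).
  have := st c ltac:(apply: Rabs_le; lra); rewrite bal0 in e; nra.
have lim_sum (c : I -> R) : is_lim_seq (fun m => \big[Rplus/0]_i (w m i * c i))
    (\big[Rplus/0]_i (n i * c i)).
  apply: (is_lim_seq_sumR (u := fun i m => w m i * c i)) => i.
  by apply: (is_lim_seq_scal_r _ (c i) (n i)).
have e1 := is_lim_seq_lt (lim_sum (fun i => snc k ((v0 + d - b i) / 2))) right0.
have e2 := is_lim_seq_gt (lim_sum (fun i => snc k ((v0 - d - b i) / 2))) left0.
have s3 : 0 < \big[Rplus/0]_i (n i * (dsnc k ((v0 - b i) / 2) - 3 * d - D / 2)).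
  have -> : \big[Rplus/0]_i (n i * (dsnc k ((v0 - b i) / 2) - 3 * d - D / 2)) =
    D + - (3 * d + D / 2) * \big[Rplus/0]_i n i.
    by rewrite /D /stiffness -sumR_lin; apply: eq_bigr => i _; ring.
  by rewrite n1; lra.
have e3 := is_lim_seq_lt (lim_sum _) s3.
apply: filter_imp (filter_and _ _ e1 (filter_and _ _ e2 e3)) => m [h1 [h2 h3]].
have cont : continuity (balance (w m)).
  by move=> x; apply: is_derive_continuity_pt (balance_derive (w m) x).
have [v [hv ev]] : {v | Rmin (v0 - d) (v0 + d) <= v <= Rmax (v0 - d) (v0 + d) /\ balance (w m) v = 0}.
  apply: IVT_gen => //; rewrite -/(balance (w m) (v0 + d)) in h1.
  rewrite -/(balance (w m) (v0 - d)) in h2.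
  by rewrite Rmin_left ?Rmax_right; lra.
rewrite Rmin_left ?Rmax_right in hv; try lra.
have av : Rabs (v - v0) <= d by apply: Rabs_le; lra.
exists v; split => //; first by lra.
have := stiffness_near v0 v (w0 m).
have e : \big[Rplus/0]_i (w m i * (dsnc k ((v0 - b i) / 2) - 3 * d - D / 2)) =
    stiffness (w m) v0 + - (3 * d + D / 2) * \big[Rplus/0]_i w m i.
  by rewrite /stiffness -sumR_lin; apply: eq_bigr => i _; ring.
have sw := sumR_ge0 (w0 m).
rewrite e in h3.
have : 3 * Rabs (v - v0) * \big[Rplus/0]_i w m i <= 3 * d * \big[Rplus/0]_i w m i.
  by apply: Rmult_le_compat_r; lra.
by lra.
Qed.

End Limit.
End Ratio.

Lemma ratio_close (J A0 A1 gam0 gam1 X : C) eps tol :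
  J <> RtoC 0 -> gam1 = Cmult X gam0 -> gam0 <> RtoC 0 ->
  Cmod (Cminus A0 (Cmult gam0 J)) <= eps * Cmod J ->
  Cmod (Cminus A1 (Cmult gam1 J)) <= eps * Cmod J ->
  2 * eps <= Cmod gam0 -> 2 * eps * (1 + Cmod X) < tol * Cmod gam0 ->
  Cmod (Cminus (Cdiv A1 A0) X) < tol.
Proof.
move=> J0 gX g0 h0 h1 e1 e2.
have j0 := proj1 (Cmod_gt_0 _) J0; have c0 := proj1 (Cmod_gt_0 _) g0.
have tri : Cmod gam0 * Cmod J <= Cmod A0 + Cmod (Cminus A0 (Cmult gam0 J)).
  rewrite -Cmod_mult -(Cmod_opp (Cminus _ _)).
  have {1}-> : Cmult gam0 J = Cplus A0 (Copp (Cminus A0 (Cmult gam0 J))) by ring.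
  exact: Cmod_triangle.
have lowA : Cmod gam0 * Cmod J / 2 <= Cmod A0 by nra.
have A0p : 0 < Cmod A0 by nra.
have A00 : A0 <> RtoC 0 by apply/Cmod_gt_0.
have -> : Cminus (Cdiv A1 A0) X =
  Cdiv (Cminus (Cminus A1 (Cmult gam1 J)) (Cmult X (Cminus A0 (Cmult gam0 J)))) A0.
  by rewrite gX; field.
rewrite Cmod_div //; apply: (Rmult_lt_reg_r (Cmod A0)) => //.
have -> : forall a, a / Cmod A0 * Cmod A0 = a by move=> a; field; lra.
apply: Rle_lt_trans (Cmod_triangle _ _) _; rewrite Cmod_opp Cmod_mult.
have h2 : Cmod X * Cmod (Cminus A0 (Cmult gam0 J)) <= Cmod X * (eps * Cmod J).
  by apply: Rmult_le_compat_l => //; apply: Cmod_ge_0.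
have h3 : 2 * eps * (1 + Cmod X) * Cmod J < tol * Cmod gam0 * Cmod J.
  exact: Rmult_lt_compat_r.
have tol0 : 0 < tol.
  have : 0 <= eps.
    have := Cmod_ge_0 (Cminus A0 (Cmult gam0 J)) => h.
    by apply: (Rmult_le_reg_r (Cmod J)) => //; lra.
  by have := Cmod_ge_0 X; nra.
have : tol * (Cmod gam0 * Cmod J / 2) <= tol * Cmod A0 by apply: Rmult_le_compat_l; lra.
lra.
Qed.

Section RatioLimit.
Context (k : R) (hk : 0 < k < 1) (I : finType) (b : I -> R).

Let K := ell_K k.
Let k' := compl_mod k.
Let hk' : 0 < k' < 1. Proof. exact: compl_mod_bounds. Qed.
Let K' := ell_K k'.

Definition pairwise_close (p : I -> nat) : Prop :=
  forall i j, (0 < p i)%N -> (0 < p j)%N -> b i - b j < 2 * K.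

Lemma arc_of_pairwise p v : pole_free k b p v -> pairwise_close p ->
  exists a, a < v < a + 2 * K /\ forall i, (0 < p i)%N -> a < b i < a + 2 * K.
Proof.
move=> pf pw; have K0 := ell_K_gt0 hk; rewrite -/K in K0.
pose x (o : option I) := if o is Some i then (if (0 < p i)%N then b i else v) else v.
have [a ha] : exists a, forall o, a < x o < a + 2 * K.
  apply: common_interval => [|[i|] [j|]] /=; try lra.
  - case: ifP => hi; case: ifP => hj; try lra; first exact: pw.
      by have := pf i hi; rewrite -/K; lra.
    by have := pf j hj; rewrite -/K; lra.
  - by case: ifP => hi; try lra; have := pf i hi; rewrite -/K; lra.
  - by case: ifP => hj; try lra; have := pf j hj; rewrite -/K; lra.
exists a; split; first exact: (ha None).
by move=> i hi; have := ha (Some i); rewrite /= hi.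
Qed.

Lemma stiffness_gt0 n v0 p : (forall i, 0 <= n i) -> (exists i, 0 < n i) ->
  balance k b n v0 = 0 -> (forall i, 0 < n i -> (0 < p i)%N) ->
  pole_free k b p v0 -> pairwise_close p -> 0 < stiffness k b n v0.
Proof.
move=> n0 nex bal np pf pw; have [a [hv ha]] := arc_of_pairwise pf pw.
have -> : stiffness k b n v0 = \big[Rplus/0]_i (n i * slope k 1 0 ((v0 - b i) / 2)).
  apply: eq_bigr => i _; congr (_ * _); rewrite /slope; field.
apply: (balanced_slope_gt0 hk (A := (v0 - a) / 2 - K)) => //; rewrite -/K; try lra.
by move=> i /np hi; have := ha i hi; lra.
Qed.

Context (v0 : R) (n : I -> R) (kap : nat) (p q : nat -> I -> nat) (X : C).

Let P m := \big[Rplus/0]_i INR (p m i).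

Definition compatible_exponents (m : nat) : Prop :=
  [/\ pole_free k b (p m) v0, pole_free k b (q m) v0, pairwise_close (p m),
      ~~ odd (\sum_i p m i)%N /\ ~~ odd (\sum_i q m i)%N
    & fac_prod k b (q m) v0 (2 * K') = Cmult X (fac_prod k b (p m) v0 (2 * K'))].

Context (n0 : forall i, 0 <= n i) (bal0 : balance k b n v0 = 0)
  (limP : is_lim_seq P p_infty)
  (limn : forall i, is_lim_seq (fun m => INR (p m i) / P m) (n i))
  (hpq : forall m i, (p m i <= q m i + kap)%N /\ (q m i <= p m i + kap)%N)
  (compat : eventually compatible_exponents).

Let P_ge0 m : 0 <= P m.
Proof. by apply: sumR_ge0 => i; apply: pos_INR. Qed.

Let P_large a : eventually (fun m => a < P m).
Proof. by move/is_lim_seq_spec: limP; apply. Qed.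

Let n1 : \big[Rplus/0]_i n i = 1.
Proof.
have h1 := is_lim_seq_sumR (u := fun i m => INR (p m i) / P m) limn.
have h2 : is_lim_seq (fun m => \big[Rplus/0]_i (INR (p m i) / P m)) 1.
  apply: (is_lim_seq_ext_loc (fun _ => 1)); last exact: is_lim_seq_const.
  apply: filter_imp (P_large 0) => m P0.
  have -> : \big[Rplus/0]_i (INR (p m i) / P m) =
      \big[Rplus/0]_i (/ P m * INR (p m i)).
    by apply: eq_bigr => i _; rewrite /Rdiv; ring.
  by rewrite sumR_mull -/(P m); field; lra.
have := is_lim_seq_unique _ _ h1; rewrite (is_lim_seq_unique _ _ h2).
by case.
Qed.

Let n_support : eventually (fun m => forall i, 0 < n i -> (0 < p m i)%N).
Proof.
apply: (eventually_forall (P := fun i m => 0 < n i -> (0 < p m i)%N)) => i.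
have [h|h] := Rle_or_lt (n i) 0; first by exists 0%N => m _; lra.
have := is_lim_seq_lt (@limn i) h; apply: filter_imp => m hm _.
rewrite lt0n; apply/eqP => z; move: hm; rewrite z /= /Rdiv Rmult_0_l; lra.
Qed.

Let stiff0 : 0 < stiffness k b n v0.
Proof.
have [m hm] := filter_and _ _ compat n_support.
have [[pf _ pw _ _] sup] := hm m (le_n m).
apply: (stiffness_gt0 n0 _ bal0 sup pf pw).
apply: Classical_Prop.NNPP => h; have := n1; rewrite big1; first by lra.
move=> i _; apply: Rle_antisym => //; apply: Rnot_lt_le => hi; apply: h; by exists i.
Qed.

(** The common part of the two exponents carries the asymptotics, while the
    excesses [p - r] and [q - r] take finitely many values. *)
Let r m i := minn (p m i) (q m i).

Let r_bounds m i : INR (p m i) - INR kap <= INR (r m i) <= INR (p m i).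
Proof.
have [h1 _] := hpq m i.
have h2 : (p m i <= r m i + kap)%N.
  by rewrite /r addn_minl leq_min leq_addr h1.
have h3 : (r m i <= p m i)%N by apply: geq_minl.
have a1 := le_INR _ _ (elimT leP h2); have a2 := le_INR _ _ (elimT leP h3).
by rewrite -plusE plus_INR in a1; lra.
Qed.

Let w m i := INR (r m i) / P m.

Let w_ge0 m i : 0 <= w m i.
Proof.
apply: Rmult_le_pos; first exact: pos_INR.
have [h|<-] := P_ge0 m; first by apply/Rlt_le/Rinv_0_lt_compat.
by rewrite Rinv_0; lra.
Qed.

Let w_lim i : is_lim_seq (fun m => w m i) (n i).
Proof.
apply: (is_lim_seq_le_le_loc (fun m => INR (p m i) / P m - INR kap * / P m) _
  (fun m => INR (p m i) / P m)) => //.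
  apply: filter_imp (P_large 0) => m P0.
  have := r_bounds m i; have := Rinv_0_lt_compat _ P0; rewrite /w /Rdiv => h1 h2.
  split; nra.
have e : Finite (n i) = Finite (n i - INR kap * 0) by congr Finite; ring.
rewrite e; apply: is_lim_seq_minus' => //.
apply: (is_lim_seq_scal_l _ (INR kap) 0).
exact: (is_lim_seq_inv _ _ limP).
Qed.

Let r_large a : eventually (fun m => a <= \big[Rplus/0]_i INR (r m i)).
Proof.
apply: filter_imp (P_large (a + \big[Rplus/0]_(i : I) INR kap)) => m h.
have : \big[Rplus/0]_i (INR (p m i) + (-1) * INR kap) <= \big[Rplus/0]_i INR (r m i).
  by apply: sumR_le => i; have := r_bounds m i; lra.
rewrite sumR_lin -/(P m); lra.
Qed.

Let patterns : Type := ({ffun I -> 'I_kap.+1} * {ffun I -> 'I_kap.+1})%type.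

Let excess m : patterns :=
  ([ffun i => inord (p m i - r m i)], [ffun i => inord (q m i - r m i)]).

Let excess1 m i : p m i = (r m i + (excess m).1 i)%N.
Proof.
have [h1 h2] := hpq m i; rewrite /= ffunE inordK /r; first by rewrite subnKC // geq_minl.
by rewrite ltnS leq_subLR addn_minl leq_min leq_addr h1.
Qed.

Let excess2 m i : q m i = (r m i + (excess m).2 i)%N.
Proof.
have [h1 h2] := hpq m i; rewrite /= ffunE inordK /r; first by rewrite subnKC // geq_minr.
by rewrite ltnS leq_subLR addn_minl leq_min leq_addr h2.
Qed.

Let margin : exists e, 0 < e /\ forall i, b i - 2 * K < v0 < b i + 2 * K ->
  b i - 2 * K + e < v0 < b i + 2 * K - e.
Proof.
apply: common_scale => [i e e' he h /h|i]; first by lra.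
pose m := Rmin (v0 - (b i - 2 * K)) (b i + 2 * K - v0).
have [h|h] := Rle_or_lt m 0.
  exists 1; split; first by lra.
  by move: h; rewrite /m /Rmin; case: Rle_dec => _; lra.
exists (m / 2); split; first by lra.
by move: h; rewrite /m /Rmin; case: Rle_dec => *; lra.
Qed.

(** For fixed excesses, [g0] and [g1] are fixed functions; they have no poles on
    the line because the excesses are part of exponents that occur. *)
Let pattern_limit tol (t : patterns) : 0 < tol ->
  eventually (fun m => excess m = t ->
    Cmod (Cminus (Cdiv (CInt (fac_prod k b (q m) v0) 0 (4 * K'))
                       (CInt (fac_prod k b (p m) v0) 0 (4 * K'))) X) < tol).
Proof.
move=> tol0.
have [M1 hM1] := compat.
have [[m1 [le1 e1]]|none] := Classical_Prop.classic
  (exists m, (M1 <= m)%coq_nat /\ excess m = t); last first.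
  by exists M1 => m lem em; exfalso; apply: none; exists m.
have [pf1 pf2 _ _ X1] := hM1 m1 le1.
pose c0 i : nat := t.1 i; pose c1 i : nat := t.2 i.
have pc0 : pole_free k b c0 v0.
  by move=> i hi; apply: pf1; rewrite excess1 e1 addn_gt0 hi orbT.
have pc1 : pole_free k b c1 v0.
  by move=> i hi; apply: pf2; rewrite excess2 e1 addn_gt0 hi orbT.
set gam0 := fac_prod k b c0 v0 (2 * K'); set gam1 := fac_prod k b c1 v0 (2 * K').
have split0 m v s : excess m = t ->
    fac_prod k b (p m) v s = Cmult (fac_prod k b c0 v s) (fac_prod k b (r m) v s).
  move=> em; rewrite Cmult_comm -fac_prod_add; apply: eq_bigr => i _.
  by rewrite excess1 em.
have split1 m v s : excess m = t ->
    fac_prod k b (q m) v s = Cmult (fac_prod k b c1 v s) (fac_prod k b (r m) v s).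
  move=> em; rewrite Cmult_comm -fac_prod_add; apply: eq_bigr => i _.
  by rewrite excess2 em.
have gX : gam1 = Cmult X gam0.
  have z := @fac_prod_peak_value_neq0 k hk I b (r m1) v0.
  move: X1; rewrite split0 // split1 // -/gam0 -/gam1 -/k' -/K' => h.
  have -> : gam1 = Cdiv (Cmult gam1 (fac_prod k b (r m1) v0 (2 * K')))
      (fac_prod k b (r m1) v0 (2 * K')) by field.
  by rewrite h; field.
have gam00 : gam0 <> RtoC 0 by apply: fac_prod_peak_value_neq0.
have g0 := proj1 (Cmod_gt_0 _) gam00.
have K1 : 1 < K' by apply: ell_K_gt1.
have T0 : 0 <= 4 * K' by lra.
have [B0 [B0p hB0]] := holomorphic_near_segment T0 (fac_prod_holomorphic hk b c0) pc0.
have [B1 [B1p hB1]] := holomorphic_near_segment T0 (fac_prod_holomorphic hk b c1) pc1.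
pose cX := 1 + Cmod X.
have cX0 : 1 <= cX by have := Cmod_ge_0 X; rewrite /cX; lra.
pose eps := Rmin 1 (Rmin (Cmod gam0 / 12) (tol * Cmod gam0 / (24 * cX))).
have tg : 0 < tol * Cmod gam0 by apply: Rmult_lt_0_compat.
have eps0 : 0 < eps.
  apply: Rmin_pos; first by lra.
  by apply: Rmin_pos; [lra | apply: Rdiv_lt_0_compat; lra].
have eps1 : eps <= 1 by apply: Rmin_l.
have eps2 : 12 * eps <= Cmod gam0.
  have := Rmin_r 1 (Rmin (Cmod gam0 / 12) (tol * Cmod gam0 / (24 * cX))).
  have := Rmin_l (Cmod gam0 / 12) (tol * Cmod gam0 / (24 * cX)); rewrite -/eps; lra.
have eps3 : 12 * eps * cX < tol * Cmod gam0.
  have : eps <= tol * Cmod gam0 / (24 * cX).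
    exact: Rle_trans (Rmin_r _ _) (Rmin_r _ _).
  move/(Rmult_le_compat_r (24 * cX) _ _ ltac:(lra)).
  have -> : tol * Cmod gam0 / (24 * cX) * (24 * cX) = tol * Cmod gam0 by field; lra.
  by lra.
have [d0 [d0p hd0]] := hB0 eps (conj eps0 eps1).
have [d1 [d1p hd1]] := hB1 eps (conj eps0 eps1).
have [e [ep he]] := margin.
pose del := Rmin (Rmin d0 d1) (Rmin (e / 2) 1).
have delp : 0 < del by do !apply: Rmin_pos; lra.
have dl1 : del <= d0 by apply: Rle_trans (Rmin_l _ _) (Rmin_l _ _).
have dl2 : del <= d1 by apply: Rle_trans (Rmin_l _ _) (Rmin_r _ _).
have dl3 : del <= e / 2 by apply: Rle_trans (Rmin_r _ _) (Rmin_l _ _).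
have dl4 : del <= 1 by apply: Rle_trans (Rmin_r _ _) (Rmin_r _ _).
pose D := Rmin (stiffness k b n v0 / 2) 2.
have D0 : 0 < D <= 2 by split; [apply: Rmin_pos; lra | apply: Rmin_r].
have Dst : D <= stiffness k b n v0 / 2 by apply: Rmin_l.
pose M := B0 + B1.
have [N0 conc] := saddle_concentration hk b D0 (M := M) ltac:(rewrite /M; lra)
  (conj eps0 eps1) delp.
have loc := saddle_location hk n0 n1 bal0 stiff0 delp w_ge0 w_lim.
apply: filter_imp (filter_and _ _ (filter_and _ _ compat (P_large 0))
  (filter_and _ _ loc (r_large N0))) => m [[[pfp pfq pw [evp evq] _] P0] [[v [hv bal st]] NN0]] em.
have widen s : pole_free k b s v0 -> pole_free k b s v.
  by move=> pf i /pf hi; have := he i hi; rewrite -/K; split_Rabs; lra.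
have pfp' := widen _ pfp; have pfq' := widen _ pfq.
have arc : common_arc k b (r m) v.
  have [a [ha hb]] := arc_of_pairwise pfp' pw.
  exists a; split => // i hi; apply: hb; apply: leq_trans hi _; exact: geq_minl.
have wr (f : I -> R) : \big[Rplus/0]_i (INR (r m i) * f i) =
    P m * \big[Rplus/0]_i (w m i * f i).
  by rewrite -sumR_mull; apply: eq_bigr => i _; rewrite /w; field; lra.
have crit : critical k b (r m) v.
  by rewrite /critical wr -/(balance k b (w m) v) bal Rmult_0_r.
have hD : \big[Rplus/0]_i INR (r m i) * D <=
    \big[Rplus/0]_i (INR (r m i) * dsnc k ((v - b i) / 2)).
  rewrite wr -/(stiffness k b (w m) v).
  have -> : \big[Rplus/0]_i INR (r m i) = P m * \big[Rplus/0]_i w m i.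
    by rewrite -sumR_mull; apply: eq_bigr => i _; rewrite /w; field; lra.
  rewrite Rmult_assoc; apply: Rmult_le_compat_l; first by lra.
  apply: Rle_trans st; rewrite Rmult_comm; apply: Rmult_le_compat_r => //.
  exact: sumR_ge0.
have near s : Rabs (s - 2 * K') <= del -> 0 <= s <= 4 * K' by split_Rabs; lra.
have mid : 0 <= 2 * K' <= 4 * K' by lra.
have bound0 : Cmod gam0 <= M.
  have [h _] := hd0 v0 ltac:(rewrite Rminus_diag Rabs_R0; lra).
  by have := h _ mid; rewrite /M /gam0; lra.
have bound1 : Cmod gam1 <= M.
  have [h _] := hd1 v0 ltac:(rewrite Rminus_diag Rabs_R0; lra).
  by have := h _ mid; rewrite /M /gam1; lra.
have [ub0 cl0] := hd0 v ltac:(lra); have [ub1 cl1] := hd1 v ltac:(lra).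
have pc0' := widen _ pc0; have pc1' := widen _ pc1.
have ubM0 s : 0 <= s <= 4 * K' -> Cmod (fac_prod k b c0 v s) <= M.
  by move/ub0; rewrite /M; lra.
have ubM1 s : 0 <= s <= 4 * K' -> Cmod (fac_prod k b c1 v s) <= M.
  by move/ub1; rewrite /M; lra.
have near0 s : Rabs (s - 2 * K') <= del -> Cmod (Cminus (fac_prod k b c0 v s) gam0) <= eps.
  by move=> hs; apply: cl0 => //; [apply: near | lra].
have near1 s : Rabs (s - 2 * K') <= del -> Cmod (Cminus (fac_prod k b c1 v s) gam1) <= eps.
  by move=> hs; apply: cl1 => //; [apply: near | lra].
have [J0 C0] := conc (r m) v crit arc NN0 hD (fac_prod k b c0 v) gam0
  (fac_prod_continuous hk pc0')
  ubM0 bound0 near0.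
have [_ C1] := conc (r m) v crit arc NN0 hD (fac_prod k b c1 v) gam1
  (fac_prod_continuous hk pc1')
  ubM1 bound1 near1.
rewrite -/k' -/K' in J0 C0 C1.
rewrite (fac_prod_shift hk evp pfp pfp') (fac_prod_shift hk evq pfq pfq') -/k' -/K'.
have -> : CInt (fac_prod k b (p m) v) 0 (4 * K') =
    CInt (fun s => Cmult (fac_prod k b c0 v s) (fac_prod k b (r m) v s)) 0 (4 * K').
  by apply: RInt_ext => s _; apply: split0.
have -> : CInt (fac_prod k b (q m) v) 0 (4 * K') =
    CInt (fun s => Cmult (fac_prod k b c1 v s) (fac_prod k b (r m) v s)) 0 (4 * K').
  by apply: RInt_ext => s _; apply: split1.
apply: (ratio_close J0 gX gam00 C0 C1); first by lra.
by rewrite -/cX; lra.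
Qed.

Lemma ratio_limit tol : 0 < tol ->
  eventually (fun m =>
    Cmod (Cminus (Cdiv (CInt (fac_prod k b (q m) v0) 0 (4 * K'))
                       (CInt (fac_prod k b (p m) v0) 0 (4 * K'))) X) < tol).
Proof.
move=> tol0.
have [M h] := eventually_forall (T := patterns) (fun t => pattern_limit t tol0).
by exists M => m hm; apply: (h m hm (excess m)).
Qed.

End RatioLimit.

(** * Signed directions *)

Lemma periodic_Z (T : Type) (f : R -> T) c : (forall x, f (x + c) = f x) ->
  forall x (m : Z), f (x + c * IZR m) = f x.
Proof.
move=> per.
have pos p x : f (x + c * IZR (Zpos p)) = f x.
  elim/Pos.peano_ind: p => [|p IH]; first by rewrite Rmult_1_r per.
  rewrite Pos2Z.inj_succ succ_IZR.
  have -> : x + c * (IZR (Zpos p) + 1) = x + c * IZR (Zpos p) + c by ring.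
  by rewrite per.
move=> x [|p|p]; [by rewrite Rmult_0_r Rplus_0_r | exact: pos |].
rewrite -(pos p (x + _)).
by congr f; rewrite -Pos2Z.opp_pos opp_IZR; ring.
Qed.

Lemma big_signed (T : Type) (idx : T) (op : Monoid.com_law idx) (J : finType)
    (F : J * bool -> T) :
  \big[op/idx]_i F i = \big[op/idx]_j op (F (j, true)) (F (j, false)).
Proof.
have := pair_bigA op (fun j c => F (j, c)).
rewrite (eq_bigr (fun j => op (F (j, true)) (F (j, false)))) => [|j _].
  by move=> ->; apply: eq_bigr => -[].
exact: big_bool.
Qed.

(** By the intermediate value theorem the weighted sum of the sines vanishes for
    some direction of the arc, and the sum of vectors is aligned with it; the
    cosines to the middle of the arc fix the orientation. *)
Lemma ray_in_arc (I : finType) (w th : I -> R) a L : 0 <= L < PI ->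
  (forall i, 0 <= w i) -> (forall i, 0 < w i -> a <= th i <= a + L) ->
  exists phi r, [/\ a <= phi <= a + L, 0 <= r &
    \big[Cplus/RtoC 0]_i Cmult (RtoC (w i)) (cis (th i)) = Cmult (RtoC r) (cis phi)].
Proof.
move=> hL w0 hth.
pose g phi := \big[Rplus/0]_i (w i * sin (th i - phi)).
have gd phi : is_derive g phi (\big[Rplus/0]_i (w i * - cos (th i - phi))).
  apply: (is_derive_sumR (f := fun i phi => w i * sin (th i - phi))) => i.
  by apply: is_derive_scal; auto_derive => //; rewrite /Rminus; ring.
have ga : 0 <= g a.
  apply: sumR_ge0 => i; have [h|<-] := w0 i; last by lra.
  by have := hth i h => hi; apply: Rmult_le_pos; [lra | apply: sin_ge_0; lra].
have gb : g (a + L) <= 0.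
  have : 0 <= \big[Rplus/0]_i (w i * sin (a + L - th i)).
    apply: sumR_ge0 => i; have [h|<-] := w0 i; last by lra.
    by have := hth i h => hi; apply: Rmult_le_pos; [lra | apply: sin_ge_0; lra].
  have -> : \big[Rplus/0]_i (w i * sin (a + L - th i)) = (-1) * g (a + L).
    rewrite -sumR_mull; apply: eq_bigr => i _.
    have -> : th i - (a + L) = - (a + L - th i) by ring.
    by rewrite sin_neg; ring.
  by lra.
have [phi [hphi g0]] : {x | Rmin (a + L) a <= x <= Rmax (a + L) a /\ g x = 0}.
  apply: IVT_gen; first by move=> x; apply: is_derive_continuity_pt (gd x).
  by rewrite /Rmin /Rmax; do !case: Rle_dec => ?; lra.
rewrite Rmin_right in hphi; last by lra.
rewrite Rmax_left in hphi; last by lra.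
pose r := \big[Rplus/0]_i (w i * cos (th i - phi)).
have turn psi : \big[Cplus/RtoC 0]_i Cmult (RtoC (w i)) (cis (th i + psi)) =
    Cmult (RtoC r) (cis (phi + psi)).
  have -> : Cmult (RtoC r) (cis (phi + psi)) = Cmult (r, g phi) (cis (phi + psi)).
    by rewrite g0.
  have -> : (r, g phi) = \big[Cplus/RtoC 0]_i Cmult (RtoC (w i)) (cis (th i - phi)).
    rewrite /r /g; elim: (index_enum I) => [|i s IH]; first by rewrite !big_nil.
    rewrite !big_cons -IH /Cplus /Cmult /cis /=; congr pair; ring.
  rewrite Cmult_comm (big_morph (Cmult (cis (phi + psi))) (Cmult_plus_distr_l _) (Cmult_0_r _)).
  apply: eq_bigr => i _.
  have -> : th i + psi = th i - phi + (phi + psi) by ring.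
  by rewrite cis_add; ring.
have r0 : 0 <= r.
  pose mid := a + L / 2.
  have e := congr1 fst (turn (- mid)).
  have e1 : fst (\big[Cplus/RtoC 0]_i Cmult (RtoC (w i)) (cis (th i + - mid))) =
    \big[Rplus/0]_i (w i * cos (th i + - mid)).
    elim: (index_enum I) => [|i s IH]; first by rewrite !big_nil.
    by rewrite !big_cons -IH /=; ring.
  rewrite e1 /cis /= in e.
  have p0 : 0 <= \big[Rplus/0]_i (w i * cos (th i + - mid)).
    apply: sumR_ge0 => i; have [h|<-] := w0 i; last by lra.
    have := hth i h => hi; apply: Rmult_le_pos; first by lra.
    by apply: cos_ge_0; rewrite /mid; lra.
  have c0 : 0 < cos (phi + - mid) by apply: cos_gt_0; rewrite /mid; lra.
  apply: (Rmult_le_reg_r (cos (phi + - mid))) => //; lra.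
exists phi, r; split => //.
have := turn 0; rewrite Rplus_0_r => <-.
by apply: eq_bigr => i _; rewrite Rplus_0_r.
Qed.

Section Directions.
Context (k : R) (hk : 0 < k < 1) (d : nat) (abar : 'I_d -> R).

Let K := ell_K k.
Let k' := compl_mod k.
Let hk' : 0 < k' < 1. Proof. exact: compl_mod_bounds. Qed.
Let K' := ell_K k'.
Let K0 : 0 < K. Proof. exact: ell_K_gt0. Qed.

Notation dir := ('I_d * bool)%type.
Implicit Types (J : dir) (x y : Zd d).

(** The second component of a signed direction is [true] when the direction is
    reversed. *)
Definition dir_angle J : R :=
  angle_scale k (abar J.1) + (if J.2 then 2 * K else 0).

(** The representative of [t] modulo [4 K] in the period centred at [v0]. *)
Definition rep (v0 t : R) : R := t + 4 * K * IZR (up ((v0 - 2 * K - t) / (4 * K))).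

Lemma rep_bounds v0 t : v0 - 2 * K < rep v0 t <= v0 + 2 * K.
Proof.
have [h1 h2] := archimed ((v0 - 2 * K - t) / (4 * K)).
have e : (v0 - 2 * K - t) / (4 * K) * (4 * K) = v0 - 2 * K - t by field; lra.
have h3 := Rmult_gt_compat_r (4 * K) _ _ ltac:(lra) h1.
have h4 := Rmult_le_compat_r (4 * K) _ _ ltac:(lra) h2.
rewrite /rep; lra.
Qed.

Lemma IZR_small (m : Z) : Rabs (4 * K * IZR m) < 4 * K -> m = 0%Z.
Proof.
move=> h.
have h1 : Rabs (IZR m) < 1.
  move: h; rewrite Rabs_mult (Rabs_pos_eq (4 * K)); last by lra.
  by move=> h; apply: (Rmult_lt_reg_l (4 * K)); lra.
have h2 : -1 < IZR m < 1 by split_Rabs; lra.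
have [a1 a2] : (-1 < m)%Z /\ (m < 1)%Z by split; apply: lt_IZR; lra.
lia.
Qed.

Lemma rep_unique v0 t (m : Z) : Rabs (v0 - (t + 4 * K * IZR m)) < 2 * K ->
  rep v0 t = t + 4 * K * IZR m.
Proof.
move=> h; have := rep_bounds v0 t; rewrite /rep; set z := up _ => hz.
have e : (z - m)%Z = 0%Z.
  by apply: IZR_small; rewrite minus_IZR; apply: Rabs_def1; split_Rabs; lra.
by have -> : z = m by lia.
Qed.

Lemma fac_rep v0 t v s : fac k ((v - rep v0 t) / 2) s = fac k ((v - t) / 2) s.
Proof.
rewrite -(periodic_Z (f := fun w => fac k w s) (c := 2 * K) _ ((v - t) / 2)
   (- up ((v0 - 2 * K - t) / (4 * K)))).
  by congr fac; rewrite /rep opp_IZR; field.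
by move=> w; apply: fac_period.
Qed.

Lemma snc_rep v0 t v : snc k ((v - rep v0 t) / 2) = snc k ((v - t) / 2).
Proof.
rewrite -(periodic_Z (f := snc k) (c := 2 * K) _ ((v - t) / 2)
   (- up ((v0 - 2 * K - t) / (4 * K)))).
  by congr snc; rewrite /rep opp_IZR; field.
move=> w; have -> : w + 2 * K = w + K + K by ring.
by rewrite !snc_add_K // Ropp_involutive.
Qed.

Definition zero_near (v0 : R) J : R := rep v0 (dir_angle J).

Definition exponent x y J : nat :=
  if J.2 then Z.to_nat (x J.1 - y J.1) else Z.to_nat (y J.1 - x J.1).

Lemma Rmax_opp a : Rmax (- a) 0 = Rmax a 0 - a.
Proof. by rewrite /Rmax; do !case: Rle_dec => ?; lra. Qed.

Definition signed_part (n : 'I_d -> R) J : R :=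
  if J.2 then Rmax (- n J.1) 0 else Rmax (n J.1) 0.

Lemma exp_fun_factor (v s t : R) :
  Cmult (Cmult Ci (RtoC (sqrt (compl_mod k))))
    (Csc k (Cdiv (Cminus (v, s) (RtoC t)) (RtoC 2))) = fac k ((v - t) / 2) (s / 2).
Proof.
rewrite /fac; congr Cmult; congr Csc.
by rewrite /Cdiv /Cminus /Cplus /Copp /Cmult /Cinv /RtoC /=; congr pair; field.
Qed.

Lemma Cpow_Z_split (A B : C) (N : Z) : Cmult A B = RtoC 1 ->
  Cpow_Z A N = Cmult (Cpow B (Z.to_nat (- N))) (Cpow A (Z.to_nat N)).
Proof.
move=> AB.
have A0 : A <> RtoC 0 by move=> z; move: AB; rewrite z Cmult_0_l => /RtoC_inj; lra.
case: N => [|p|p] /=; rewrite ?Cmult_1_l ?Cmult_1_r //.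
have pz := Cpow_nz A (Pos.to_nat p) A0.
have e : Cmult (Cpow A (Pos.to_nat p)) (Cpow B (Pos.to_nat p)) = RtoC 1.
  by rewrite -Cpow_mult_l AB Cpow_1_l.
have -> : Cpow B (Pos.to_nat p) = Cmult (Cinv (Cpow A (Pos.to_nat p)))
   (Cmult (Cpow A (Pos.to_nat p)) (Cpow B (Pos.to_nat p))) by field.
by rewrite e Cmult_1_r.
Qed.

Lemma exp_fun_fac_prod v0 x y v s : sn k' (s / 2) <> 0 ->
  exp_fun k abar x y (v, s) = fac_prod k (zero_near v0) (exponent x y) v s.
Proof.
move=> s0; rewrite /fac_prod big_signed; apply: eq_bigr => j _.
rewrite exp_fun_factor /zero_near !fac_rep /dir_angle /exponent /= Rplus_0_r.
set t := angle_scale k (abar j).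
have -> : (v - (t + 2 * K)) / 2 = (v - t) / 2 - K by field.
rewrite (@Cpow_Z_split _ (fac k ((v - t) / 2 - K) (s / 2))).
  by congr Cmult; congr Cpow; congr Z.to_nat; lia.
have := fac_shift_K hk ((v - t) / 2 - K) s0.
by have -> : (v - t) / 2 - K + ell_K k = (v - t) / 2 by rewrite /K; ring.
Qed.

Lemma exponent_odd x y : even_vertex x -> even_vertex y ->
  ~~ odd (\sum_J exponent x y J)%N.
Proof.
move=> [a ha] [c hc].
have e : Z.of_nat (\sum_J exponent x y J)%N =
   (\big[Z.add/0%Z]_j (y j - x j) + 2 * \big[Z.add/0%Z]_j Z.of_nat (exponent x y (j, true)))%Z.
  rewrite (big_morph Z.of_nat (id1 := 0%Z) (op1 := Z.add)) //; last first.
    by move=> m n; rewrite -plusE Nat2Z.inj_add.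
  rewrite big_signed.
  rewrite (big_morph (Z.mul 2) (Z.mul_add_distr_l 2) (Z.mul_0_r 2)) -big_split.
  apply: eq_bigr => j _.
  change (Z.of_nat (exponent x y (j, true)) + Z.of_nat (exponent x y (j, false)) =
    (y j - x j) + 2 * Z.of_nat (exponent x y (j, true)))%Z.
  by rewrite /exponent /fst /snd; lia.
have e2 : (\big[Z.add/0%Z]_j (y j - x j) = 2 * (c - a))%Z.
  have -> : (2 * (c - a) = 2 * c - 2 * a)%Z by lia.
  rewrite -ha -hc.
  rewrite -Z.add_opp_r (big_morph Z.opp Z.opp_add_distr (erefl 0%Z : Z.opp 0 = 0%Z)).
  by rewrite -big_split.
set m := (\sum_J exponent x y J)%N in e *; rewrite e2 in e.
set t := \big[Z.add/0%Z]_j _ in e.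
have -> : m = (Z.to_nat (c - a + t)).*2 by rewrite -mul2n -multE; lia.
by rewrite odd_double.
Qed.

Lemma INR_to_nat (z : Z) : INR (Z.to_nat z) = Rmax (IZR z) 0.
Proof.
rewrite INR_IZR_INZ; have [h|h] := Z.le_gt_cases 0 z.
  by rewrite Z2Nat.id // Rmax_left //; apply: IZR_le.
have -> : Z.of_nat (Z.to_nat z) = 0%Z by lia.
by rewrite Rmax_right //; apply/Rlt_le/IZR_lt.
Qed.

Lemma sum_exponent x y : \big[Rplus/0]_J INR (exponent x y J) = IZR (dist1 x y).
Proof.
rewrite big_signed /dist1 (big_morph IZR (id1 := 0) (op1 := Rplus)) //; last exact: plus_IZR.
apply: eq_bigr => j _ /=; rewrite /exponent /= !INR_to_nat !minus_IZR abs_IZR minus_IZR.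
by rewrite /Rmax; do !case: Rle_dec => ?; split_Rabs; lra.
Qed.

Lemma signed_part_reduced x y J : 0 < IZR (dist1 x y) ->
  INR (exponent x y J) / IZR (dist1 x y) = signed_part (reduced_coord x y) J.
Proof.
move=> h; rewrite /exponent /signed_part /reduced_coord; set D := IZR (dist1 x y) in h *.
have scale a : Rmax a 0 / D = Rmax (a / D) 0.
  have i0 := Rinv_0_lt_compat _ h.
  have e : a / D * D = a by field; lra.
  by rewrite /Rmax; do !case: Rle_dec => ?; rewrite /Rdiv ?Rmult_0_l //; nra.
case: J.2; rewrite INR_to_nat scale //.
by congr Rmax; rewrite !minus_IZR; field; lra.
Qed.

Lemma signed_part_lim (u : nat -> 'I_d -> R) (n : 'I_d -> R) J :
  (forall j, is_lim_seq (fun m => u m j) (n j)) ->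
  is_lim_seq (fun m => signed_part (u m) J) (signed_part n J).
Proof.
have maxE a : Rmax a 0 = / 2 * (a + Rabs a).
  by rewrite /Rmax; case: Rle_dec => ?; split_Rabs; lra.
have pos (a : nat -> R) (l : R) : is_lim_seq a l ->
    is_lim_seq (fun m => Rmax (a m) 0) (Rmax l 0).
  move=> h; apply: (is_lim_seq_ext (fun m => / 2 * (a m + Rabs (a m)))).
    by move=> m; rewrite maxE.
  rewrite maxE; apply: (is_lim_seq_scal_l _ (/ 2) (l + Rabs l)).
  apply: is_lim_seq_plus'; first exact: h.
  exact: (is_lim_seq_abs a l h).
move=> h; rewrite /signed_part; case: J.2; last exact: (pos _ _ (h J.1)).
exact: (pos _ _ (proj1 (is_lim_seq_opp _ (n J.1)) (h J.1))).
Qed.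

Lemma signed_part_ge0 n J : 0 <= signed_part n J.
Proof. by rewrite /signed_part; case: J.2; apply: Rmax_r. Qed.

Lemma balance_signed v0 n v : balance k (zero_near v0) (signed_part n) v =
  \big[Rplus/0]_j (n j * snc k ((v - angle_scale k (abar j)) / 2)).
Proof.
rewrite /balance big_signed; apply: eq_bigr => j _.
rewrite /zero_near !snc_rep /dir_angle /signed_part /= Rplus_0_r.
set t := angle_scale k (abar j).
have -> : snc k ((v - (t + 2 * K)) / 2) = - snc k ((v - t) / 2).
  have -> : (v - t) / 2 = (v - (t + 2 * K)) / 2 + K by field.
  by rewrite snc_add_K // Ropp_involutive.
by rewrite Rmax_opp; ring.
Qed.

Definition signed_support (n : 'I_d -> R) x y : Prop :=
  forall J, 0 < signed_part n J -> (0 < exponent x y J)%N.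

Lemma exponent_pos x y J : (0 < exponent x y J)%N ->
  if J.2 then (y J.1 - x J.1 < 0)%Z else (0 < y J.1 - x J.1)%Z.
Proof. by rewrite /exponent; case: J.2 => /ltP; lia. Qed.

Lemma admissible_arc x y : admissible abar x y ->
  exists A L, 0 <= L < 2 * K /\ forall J, (0 < exponent x y J)%N ->
    exists m : Z, A <= dir_angle J + 4 * K * IZR m <= A + L.
Proof.
move=> [a [L [L0 LP h]]]; have P0 := PI_RGT_0.
pose c := 2 * K / PI.
have c0 : 0 < c by apply: Rdiv_lt_0_compat; lra.
have cP : c * PI = 2 * K by rewrite /c; field; lra.
exists (c * a), (c * L); split; first by split; nra.
move=> [j sg] /exponent_pos /=; have [h1 h2] := h j; case: sg => hJ.
  have [m hm] := h2 hJ; exists m; rewrite /dir_angle /angle_scale -/K -/c /=.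
  have -> : c * abar j + 2 * K + 4 * K * IZR m = c * (abar j + PI + 2 * PI * IZR m).
    by rewrite !Rmult_plus_distr_l cP; have -> : c * (2 * PI * IZR m) = 2 * (c * PI) * IZR m; [ring | rewrite cP; ring].
  by split; nra.
have [m hm] := h1 hJ; exists m; rewrite /dir_angle /angle_scale -/K -/c /=.
have -> : c * abar j + 0 + 4 * K * IZR m = c * (abar j + 2 * PI * IZR m).
  by rewrite !Rmult_plus_distr_l; have -> : c * (2 * PI * IZR m) = 2 * (c * PI) * IZR m; [ring | rewrite cP; ring].
by split; nra.
Qed.

(** At the two ends of the arc containing the zeros, the sums of [snc] have
    opposite signs. *)
Lemma critical_point_exists n x y : admissible abar x y -> signed_support n x y ->
  exists v, is_critical_point k abar n v.
Proof.
move=> adm sup; have [A [L [hL hA]]] := admissible_arc adm.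
pose f v := \big[Rplus/0]_j (n j * snc k ((v - angle_scale k (abar j)) / 2)).
have fE v : f v = balance k (zero_near 0) (signed_part n) v by rewrite balance_signed.
have cont : continuity (balance k (zero_near 0) (signed_part n)).
  by move=> v; apply: is_derive_continuity_pt (balance_derive hk _ _ v).
have snc_sg w : (0 <= w < K -> 0 <= snc k w) /\ (- K < w <= 0 -> snc k w <= 0).
  split=> hw; have [->|n0] := Req_dec w 0; rewrite ?snc_0 //; try lra.
    by apply/Rlt_le/snc_gt0 => //; rewrite -/K; lra.
  by apply/Rlt_le/snc_lt0 => //; rewrite -/K; lra.
have term v J : 0 < signed_part n J -> exists z : R,
    snc k ((v - zero_near 0 J) / 2) = snc k ((v - z) / 2) /\ A <= z <= A + L.
  move=> /sup /hA [m hm]; exists (dir_angle J + 4 * K * IZR m); split => //.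
  rewrite /zero_near snc_rep.
  rewrite -(periodic_Z (f := snc k) (c := 2 * K) _ ((v - (dir_angle J + _)) / 2) m).
    by congr snc; field.
  move=> w; have -> : w + 2 * K = w + K + K by ring.
  by rewrite !snc_add_K // Ropp_involutive.
have fA : balance k (zero_near 0) (signed_part n) A <= 0.
  rewrite /balance -[X in _ <= X](Rmult_0_r (-1)); apply: Rle_trans (_ : _ <= \big[Rplus/0]_(J : dir) 0) _.
    apply: sumR_le => J; have [h|<-] := signed_part_ge0 n J; last by lra.
    have [z [-> hz]] := term A J h.
    have [_ h2] := snc_sg ((A - z) / 2); have := h2 ltac:(lra); nra.
  by rewrite big1 //; lra.
have fB : 0 <= balance k (zero_near 0) (signed_part n) (A + L).
  apply: sumR_ge0 => J; have [h|<-] := signed_part_ge0 n J; last by lra.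
  have [z [-> hz]] := term (A + L) J h.
  have [h2 _] := snc_sg ((A + L - z) / 2); have := h2 ltac:(lra); nra.
have [v [hv ev]] : {v | Rmin A (A + L) <= v <= Rmax A (A + L) /\
    balance k (zero_near 0) (signed_part n) v = 0}.
  apply: IVT_gen => //; rewrite /Rmin /Rmax; do !case: Rle_dec => ?; lra.
rewrite Rmin_left in hv; last by lra.
rewrite Rmax_right in hv; last by lra.
exists v; split; last by rewrite -[RHS]ev balance_signed.
exists ((K - L / 2) / 2), (A + L / 2); split; first by lra.
- move=> j; split=> hj.
    have [m hm] := hA (j, false) (sup (j, false) ltac:(rewrite /signed_part /= Rmax_left; lra)).
    by exists m; move: hm; rewrite /dir_angle /= -/K; lra.
  have [m hm] := hA (j, true) (sup (j, true) ltac:(rewrite /signed_part /= Rmax_left; lra)).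
  by exists m; move: hm; rewrite /dir_angle /= -/K; lra.
- by exists 0%Z; rewrite Rmult_0_r -/K; lra.
Qed.

(** A multiple of the period brings the arc that defines the critical point into
    the window where the zeros are represented. *)
Lemma critical_point_arc n v : is_critical_point k abar n v ->
  [/\ (forall J, 0 < signed_part n J -> Rabs (v - zero_near v J) < 2 * K),
      (forall J J', 0 < signed_part n J -> 0 < signed_part n J' ->
         zero_near v J - zero_near v J' < 2 * K)
    & balance k (zero_near v) (signed_part n) v = 0].
Proof.
move=> [[eps [a [e0 hn [mv hv]]]] bal].
have key J : 0 < signed_part n J ->
    a - K + eps < zero_near v J + 4 * K * IZR mv < a + K - eps.
  move=> hJ.
  have [m hm] : in_arc k a eps (dir_angle J).
    have [h1 h2] := hn J.1; move: hJ; rewrite /signed_part /dir_angle; case: J.2 => hJ.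
      by apply: h2; move: hJ; rewrite /Rmax; case: Rle_dec; lra.
    by rewrite Rplus_0_r; apply: h1; move: hJ; rewrite /Rmax; case: Rle_dec; lra.
  rewrite -/K in hv hm.
  have e : zero_near v J = dir_angle J + 4 * K * IZR (m - mv).
    by apply: rep_unique; rewrite minus_IZR; apply: Rabs_def1; lra.
  by rewrite e minus_IZR; lra.
rewrite -/K in hv; split.
- by move=> J /key hJ; apply: Rabs_def1; lra.
- by move=> J J' /key hJ /key hJ'; lra.
- by rewrite balance_signed.
Qed.

(** [snc] has the sign of its argument, so a balanced family has points on both
    sides. *)
Lemma hull_of_balance (I : finType) (b : I -> R) w v : (forall i, 0 <= w i) ->
  (exists i, 0 < w i) -> (forall i, 0 < w i -> Rabs (v - b i) < 2 * K) ->
  balance k b w v = 0 ->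
  (exists i, 0 < w i /\ b i <= v) /\ (exists i, 0 < w i /\ v <= b i).
Proof.
move=> w0 [i0 hi0] near bal.
split; apply: Classical_Prop.NNPP => none.
  have neg i : 0 < w i -> snc k ((v - b i) / 2) < 0.
    move=> hi; have h := near i hi; apply: snc_lt0 => //; rewrite -/K.
    have : v < b i by apply: Rnot_le_lt => hb; apply: none; exists i.
    by split_Rabs; lra.
  have : 0 < \big[Rplus/0]_i (w i * - snc k ((v - b i) / 2)).
    apply: (sumR_gt0 (i := i0)) => [i|]; last by have := neg i0 hi0; nra.
    by have [h|<-] := w0 i; [have := neg i h; nra | lra].
  have -> : \big[Rplus/0]_i (w i * - snc k ((v - b i) / 2)) = (-1) * balance k b w v.
    by rewrite /balance -sumR_mull; apply: eq_bigr => i _; ring.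
  by rewrite bal; lra.
have pos i : 0 < w i -> 0 < snc k ((v - b i) / 2).
  move=> hi; have h := near i hi; apply: snc_gt0 => //; rewrite -/K.
  have : b i < v by apply: Rnot_le_lt => hb; apply: none; exists i.
  by split_Rabs; lra.
have : 0 < balance k b w v.
  apply: (sumR_gt0 (i := i0)) => [i|]; last by have := pos i0 hi0; nra.
  by have [h|<-] := w0 i; [have := pos i h; nra | lra].
by rewrite bal; lra.
Qed.

(** The critical point lies between two zeros of the limiting direction, hence
    in the arc of every admissible vector whose signs extend those of this
    direction. *)
Lemma admissible_arc_near n v x y : is_critical_point k abar n v ->
  (exists J, 0 < signed_part n J) -> admissible abar x y -> signed_support n x y ->
  exists A L, [/\ 0 <= L < 2 * K, A <= v <= A + L &
    forall J, (0 < exponent x y J)%N -> A <= zero_near v J <= A + L].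
Proof.
move=> crit nex adm sup; have [near close bal] := critical_point_arc crit.
have [[J1 [n1 h1]] [J2 [n2 h2]]] :=
  hull_of_balance (signed_part_ge0 n) nex near bal.
have [A [L [hL hA]]] := admissible_arc adm.
have [m1 hm1] := hA J1 (sup J1 n1); have [m2 hm2] := hA J2 (sup J2 n2).
have c12 := close J2 J1 n2 n1.
have [z1 e1] : exists z, zero_near v J1 = dir_angle J1 + 4 * K * IZR z by eexists.
have [z2 e2] : exists z, zero_near v J2 = dir_angle J2 + 4 * K * IZR z by eexists.
have e : (m2 - z2 - (m1 - z1))%Z = 0%Z.
  apply: IZR_small; rewrite !minus_IZR; apply: Rabs_def1; lra.
have eR : IZR m2 - IZR z2 = IZR m1 - IZR z1.
  by rewrite -!minus_IZR; congr IZR; lia.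
have eK : 4 * K * (IZR m2 - IZR z2) = 4 * K * (IZR m1 - IZR z1) by rewrite eR.
exists (A - 4 * K * (IZR m1 - IZR z1)), L.
have inside : A - 4 * K * (IZR m1 - IZR z1) <= v <= A - 4 * K * (IZR m1 - IZR z1) + L.
  by lra.
split => // J hJ; have [m hm] := hA J hJ.
have -> : zero_near v J = dir_angle J + 4 * K * IZR (m - (m1 - z1)).
  by apply: rep_unique; rewrite !minus_IZR; apply: Rabs_def1; lra.
by rewrite !minus_IZR; lra.
Qed.

Lemma ray_abscissa_in_arc v x y A L : 0 <= L < 2 * K ->
  (forall J, (0 < exponent x y J)%N -> A <= zero_near v J <= A + L) ->
  exists phi, A <= phi <= A + L /\ ray_abscissa k abar x y phi.
Proof.
move=> hL hA; have P0 := PI_RGT_0.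
pose c := PI / (2 * K).
have c0 : 0 < c by apply: Rdiv_lt_0_compat; lra.
have cK : c * (2 * K) = PI by rewrite /c; field; lra.
have hcL : 0 <= c * L < PI by split; nra.
have hth J : 0 < INR (exponent x y J) -> c * A <= c * zero_near v J <= c * A + c * L.
  move=> hJ; have {}hJ : (0 < exponent x y J)%N.
    by rewrite lt0n; apply/eqP => z; move: hJ; rewrite z /=; lra.
  by have := hA J hJ; split; nra.
have [phi [r [hphi r0 e]]] := ray_in_arc hcL (fun J => pos_INR (exponent x y J)) hth.
exists (phi / c); split.
  split; apply: (Rmult_le_reg_r c) => //; have -> : phi / c * c = phi by field; lra.
    by lra.
  by lra.
exists r; split => //; rewrite -/K -/c.
have -> : phi / c * c = phi by field; lra.
rewrite -e big_signed; apply: eq_bigr => j _.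
have cisZ t (m : Z) : cis (t + 2 * PI * IZR m) = cis t.
  apply: (periodic_Z (f := cis)) => u.
  by rewrite /cis cos_plus sin_plus cos_2PI sin_2PI; congr pair; ring.
have cisP t : cis (t + PI) = Copp (cis t) by rewrite /cis neg_cos neg_sin.
have ang J : cis (c * zero_near v J) = cis (c * dir_angle J).
  rewrite /zero_near /rep Rmult_plus_distr_l.
  have -> : c * (4 * K * IZR (up ((v - 2 * K - dir_angle J) / (4 * K)))) =
    2 * (c * (2 * K)) * IZR (up ((v - 2 * K - dir_angle J) / (4 * K))) by ring.
  by rewrite cK cisZ.
rewrite !ang /dir_angle /angle_scale -/K /exponent /= Rplus_0_r.
have -> : c * (2 * K / PI * abar j) = abar j by rewrite /c; field; lra.
rewrite Rmult_plus_distr_l cK.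
have -> : c * (2 * K / PI * abar j) = abar j by rewrite /c; field; lra.
rewrite cisP !INR_to_nat !minus_IZR.
have -> : IZR (x j) - IZR (y j) = - (IZR (y j) - IZR (x j)) by ring.
rewrite Rmax_opp; move: (IZR (y j) - IZR (x j)) => z.
by rewrite /Cmult /Cplus /RtoC /cis /=; congr pair; ring.
Qed.

End Directions.

(** * The limit of the quotient of Green functions *)

Lemma Cpow_Z_succ A m : A <> RtoC 0 -> Cpow_Z A (Z.succ m) = Cmult (Cpow_Z A m) A.
Proof.
move=> A0; have AB : Cmult A (Cinv A) = RtoC 1 by apply: Cinv_r.
rewrite !(Cpow_Z_split _ AB); have [h|h] := Z.le_gt_cases 0 m.
  have -> : Z.to_nat (- Z.succ m) = 0%N by lia.
  have -> : Z.to_nat (- m) = 0%N by lia.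
  have -> : Z.to_nat (Z.succ m) = S (Z.to_nat m) by lia.
  by rewrite /=; ring.
have -> : Z.to_nat (- m) = S (Z.to_nat (- Z.succ m)) by lia.
have -> : Z.to_nat (Z.succ m) = 0%N by lia.
have -> : Z.to_nat m = 0%N by lia.
by rewrite /=; field.
Qed.

Lemma Cpow_Z_add A m n : A <> RtoC 0 ->
  Cpow_Z A (m + n) = Cmult (Cpow_Z A m) (Cpow_Z A n).
Proof.
move=> A0; elim/Z.peano_ind: n => [|n IH|n IH].
- by rewrite Z.add_0_r /= Cmult_1_r.
- by rewrite Z.add_succ_r !Cpow_Z_succ // IH; ring.
- have e1 : Cpow_Z A (m + n) = Cmult (Cpow_Z A (m + Z.pred n)) A.
    by rewrite -Cpow_Z_succ //; congr Cpow_Z; lia.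
  have e2 : Cpow_Z A n = Cmult (Cpow_Z A (Z.pred n)) A.
    by rewrite -Cpow_Z_succ //; congr Cpow_Z; lia.
  rewrite e1 e2 in IH.
  have -> : Cpow_Z A (m + Z.pred n) = Cdiv (Cmult (Cpow_Z A (m + Z.pred n)) A) A by field.
  by rewrite IH; field.
Qed.

Lemma exp_fun_chasles k d (abar : 'I_d -> R) x y z v : 0 < k < 1 ->
  exp_fun k abar x z (v, 2 * ell_K' k) =
  Cmult (exp_fun k abar x y (v, 2 * ell_K' k)) (exp_fun k abar y z (v, 2 * ell_K' k)).
Proof.
move=> hk; rewrite /exp_fun -big_split; apply: eq_bigr => j _.
rewrite !exp_fun_factor.
set A := fac _ _ _; rewrite -[RHS]/(Cmult (Cpow_Z A (y j - x j)) (Cpow_Z A (z j - y j))).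
have A0 : A <> RtoC 0.
  have s0 : sn (compl_mod k) (2 * ell_K' k / 2) <> 0.
    have -> : 2 * ell_K' k / 2 = ell_K (compl_mod k) by rewrite /ell_K'; field.
    by rewrite sn_K; [lra | apply: compl_mod_bounds].
  have := fac_shift_K hk ((v - angle_scale k (abar j)) / 2) s0; rewrite -/A => h e.
  by move: h; rewrite e Cmult_0_r => /RtoC_inj; lra.
by rewrite -Cpow_Z_add //; congr Cpow_Z; lia.
Qed.

(** The integral formula, with the contour moved to the abscissa of the
    critical point. *)
Lemma green_at_critical k d (abar : 'I_d -> R) (n : 'I_d -> R) v
    (x y : Zd d) (Gxy : C) : 0 < k < 1 ->
  even_vertex x -> even_vertex y -> admissible abar x y ->
  (forall phi, ray_abscissa k abar x y phi ->
     Gxy = Cmult (Cdiv (RtoC (compl_mod k)) (Cmult (RtoC (4 * PI)) Ci))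
               (vertical_int (exp_fun k abar x y) phi (4 * ell_K' k))) ->
  is_critical_point k abar n v -> (exists J, 0 < signed_part n J) ->
  signed_support n x y ->
  let b := zero_near k abar v in
  [/\ pole_free k b (exponent x y) v, pairwise_close k b (exponent x y)
    & Gxy = Cmult (Cmult (Cdiv (RtoC (compl_mod k)) (Cmult (RtoC (4 * PI)) Ci)) Ci)
             (CInt (fac_prod k b (exponent x y) v) 0 (4 * ell_K' k))].
Proof.
move=> hk ex ey adm hG crit nex sup b.
have [A [L [hL hv hA]]] := admissible_arc_near hk crit nex adm sup.
have [phi [hphi ray]] := ray_abscissa_in_arc hk hL hA.
have pf t : A <= t <= A + L -> pole_free k b (exponent x y) t.
  by move=> ht J hJ; have := hA J hJ; rewrite -/b; lra.
split; first exact: pf.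
  by move=> J J' hJ hJ'; have := hA J hJ; have := hA J' hJ'; rewrite -/b; lra.
rewrite (hG phi ray) -Cmult_assoc; congr Cmult; rewrite /vertical_int; congr Cmult.
rewrite -(fac_prod_shift hk (exponent_odd ex ey) (pf phi hphi) (pf v hv)).
rewrite -/(ell_K' k); apply: (RInt_ext (V := C_R_CompleteNormedModule)) => s; have K1 := ell_K_gt1 (compl_mod_bounds hk).
rewrite -/(ell_K' k) in K1.
rewrite Rmin_left; last by lra.
rewrite Rmax_right; last by lra.
move=> hs.
have s0 : sn (compl_mod k) (s / 2) <> 0.
  apply: Rgt_not_eq; apply: sn_gt0; first exact: compl_mod_bounds.
  by rewrite -/(ell_K' k); lra.
exact: (exp_fun_fac_prod hk abar v x y phi s0).
Qed.

Theorem theorem1 (g : geom_graph) (d : nat) (abar : 'I_d -> R)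
    (lift : C -> Zd d) (k : R) (G : Zd d -> Zd d -> C)
    (x0 x1 : Zd d) (y : nat -> Zd d) (n : 'I_d -> R) :
  isoradial g -> bounded_angles g -> quasicrystalline g abar ->
  is_lift g abar lift -> liftable g lift ->
  0 < k < 1 ->
  extended_green g abar lift k G ->
  even_vertex x0 -> even_vertex x1 ->
  (forall m : nat, even_vertex (y m)) ->
  (forall m : nat, admissible abar x0 (y m)) ->
  (forall m : nat, admissible abar x1 (y m)) ->
  is_lim_seq (fun m => IZR (dist1 x0 (y m))) p_infty ->
  (forall j : 'I_d,
     is_lim_seq (fun m => reduced_coord x0 (y m) j) (Finite (n j))) ->
  filterlim (fun m => Cdiv (G x1 (y m)) (G x0 (y m))) eventually
    (locally (exp_fun k abar x1 x0
                (Cplus (Cmult (RtoC 2) (Cmult Ci (RtoC (ell_K' k))))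
                       (RtoC (critical_point k abar n))))).
Proof.
move=> _ _ _ _ _ hk [_ hG] e0 e1 ey adm0 adm1 dist lim.
have hk' := compl_mod_bounds hk.
have large a : eventually (fun m => a < IZR (dist1 x0 (y m))).
  by move/is_lim_seq_spec: dist; apply.
have limP (J : 'I_d * bool) : is_lim_seq
    (fun m => INR (exponent x0 (y m) J) / IZR (dist1 x0 (y m))) (signed_part n J).
  apply: (is_lim_seq_ext_loc (fun m => signed_part (reduced_coord x0 (y m)) J)).
    by apply: filter_imp (large 0) => m hm; rewrite signed_part_reduced.
  exact: signed_part_lim.
pose kap := (\sum_(j < d) Z.abs_nat (x1 j - x0 j))%N.
have close m (J : 'I_d * bool) :
    (exponent x0 (y m) J <= exponent x1 (y m) J + kap)%N /\
    (exponent x1 (y m) J <= exponent x0 (y m) J + kap)%N.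
  have hkap : (Z.abs_nat (x1 J.1 - x0 J.1) <= kap)%N.
    by rewrite /kap (bigD1 J.1) //= leq_addr.
  move/leP: hkap => hkap.
  by split; apply/leP; rewrite -plusE /exponent; case: J.2; lia.
have sup0 : eventually (fun m => signed_support n x0 (y m) /\ signed_support n x1 (y m)).
  have : eventually (fun m => forall J : 'I_d * bool, 0 < signed_part n J ->
      (kap < exponent x0 (y m) J)%N).
    apply: (eventually_forall (P := fun (J : 'I_d * bool) m => 0 < signed_part n J ->
      (kap < exponent x0 (y m) J)%N)) => J.
    have [h|h] := Rle_or_lt (signed_part n J) 0; first by exists 0%N => m _; lra.
    have half : signed_part n J / 2 < signed_part n J by lra.
    have ev1 := is_lim_seq_lt (limP J) half.
    have ev2 := large (2 * INR kap / signed_part n J).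
    apply: filter_imp (filter_and _ _ ev1 ev2) => m [h1 h2] _; apply/ltP/INR_lt.
    have D0 : 0 < IZR (dist1 x0 (y m)).
      apply: Rle_lt_trans h2; apply: Rdiv_le_0_compat => //.
      by have := pos_INR kap; lra.
    have := Rmult_lt_compat_r _ _ _ D0 h1; have := Rmult_lt_compat_r _ _ _ h h2.
    have -> : 2 * INR kap / signed_part n J * signed_part n J = 2 * INR kap by field; lra.
    have -> : INR (exponent x0 (y m) J) / IZR (dist1 x0 (y m)) * IZR (dist1 x0 (y m)) =
      INR (exponent x0 (y m) J) by field; lra.
    lra.
  apply: filter_imp => m hm; split => J /hm hJ; first by apply: leq_ltn_trans hJ.
  have [h1 _] := close m J.
  by have := leq_trans hJ h1; rewrite -[X in (X < _)%N]add0n ltn_add2r.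
have nex : exists J : 'I_d * bool, 0 < signed_part n J.
  apply: Classical_Prop.NNPP => none.
  have h1 := is_lim_seq_sumR (u := fun J m => INR (exponent x0 (y m) J) / IZR (dist1 x0 (y m)))
    (l := signed_part n) limP.
  rewrite big1 in h1; last first.
    move=> J _; apply: Rle_antisym; last exact: signed_part_ge0.
    by apply: Rnot_lt_le => h; apply: none; exists J.
  have ev1 := is_lim_seq_gt h1 Rlt_0_1; have ev2 := large 0.
  have [M2 hM2] := filter_and _ _ ev1 ev2; have [lt1 D0] := hM2 M2 (le_n _).
  move: lt1; have -> : \big[Rplus/0]_J (INR (exponent x0 (y M2) J) / IZR (dist1 x0 (y M2))) = 1; last by lra.
  rewrite (eq_bigr (fun J => / IZR (dist1 x0 (y M2)) * INR (exponent x0 (y M2) J))).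
    by rewrite sumR_mull sum_exponent; field; lra.
  by move=> J _; rewrite /Rdiv Rmult_comm.
have crit : is_critical_point k abar n (critical_point k abar n).
  apply: (epsilon_spec (inhabits 0) (is_critical_point k abar n)); have [M hM] := sup0; have [s0 _] := hM M (le_n _).
  exact: (critical_point_exists hk (adm0 M) s0).
set v := critical_point k abar n in crit *.
have -> : Cplus (Cmult (RtoC 2) (Cmult Ci (RtoC (ell_K' k)))) (RtoC v) = (v, 2 * ell_K' k).
  by rewrite /Cplus /Cmult /Ci /RtoC /=; congr pair; ring.
set X := exp_fun k abar x1 x0 (v, 2 * ell_K' k).
pose b := zero_near k abar v.
have [_ _ bal] := critical_point_arc hk crit.
have green m : signed_support n x0 (y m) -> signed_support n x1 (y m) ->
  [/\ compatible_exponents k b v (fun m => exponent x0 (y m)) (fun m => exponent x1 (y m)) X m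
    & Cdiv (G x1 (y m)) (G x0 (y m)) =
      Cdiv (CInt (fac_prod k b (exponent x1 (y m)) v) 0 (4 * ell_K' k))
           (CInt (fac_prod k b (exponent x0 (y m)) v) 0 (4 * ell_K' k))].
  move=> s0 s1.
  have [pf0 pw0 G0] := green_at_critical hk e0 (ey m) (adm0 m)
    (fun phi => hG _ _ phi e0 (ey m) (adm0 m)) crit nex s0.
  have [pf1 pw1 G1] := green_at_critical hk e1 (ey m) (adm1 m)
    (fun phi => hG _ _ phi e1 (ey m) (adm1 m)) crit nex s1.
  split.
    have sK : sn (compl_mod k) (2 * ell_K' k / 2) <> 0.
      have -> : 2 * ell_K' k / 2 = ell_K (compl_mod k) by rewrite /ell_K'; field.
      by rewrite sn_K //; lra.
    split => //; first by split; apply: exponent_odd.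
    by rewrite -!exp_fun_fac_prod // /X -/(ell_K' k) -exp_fun_chasles.
  rewrite G0 G1; set c := Cmult _ Ci.
  have c0 : c <> RtoC 0.
    apply: Cmult_neq_0; last by move=> /(congr1 snd) /=; lra.
    apply: Cmult_neq_0; first by move=> /RtoC_inj; lra.
    have p0 : Cmult (RtoC (4 * PI)) Ci <> RtoC 0.
      apply: Cmult_neq_0; last by move=> /(congr1 snd) /=; lra.
      by move=> /RtoC_inj; have := PI_RGT_0; lra.
    by move=> e; have := Cinv_r _ p0; rewrite e Cmult_0_r => /RtoC_inj; lra.
  move: (CInt _ _ _) (CInt _ _ _) => B0 B1.
  (* For a vanishing denominator both quotients are 0, as the inverse of 0 is 0. *)
  have [->|B00] := Classical_Prop.classic (B0 = RtoC 0); last by field.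
  have z : Cinv (RtoC 0) = RtoC 0.
    by rewrite /Cinv /RtoC /=; congr pair; rewrite /Rdiv; ring.
  by rewrite /Cdiv Cmult_0_r z !Cmult_0_r.
have compat : eventually (compatible_exponents k b v (fun m => exponent x0 (y m))
    (fun m => exponent x1 (y m)) X).
  by apply: filter_imp sup0 => m [s0 s1]; have [] := green m s0 s1.
have main := @ratio_limit k hk ('I_d * bool)%type b v (signed_part n) kap
  (fun m => exponent x0 (y m)) (fun m => exponent x1 (y m)) X
  (signed_part_ge0 n) bal.
apply/filterlim_locally => eps.
have lim1 : is_lim_seq (fun m => \big[Rplus/0]_J INR (exponent x0 (y m) J)) p_infty.
  by apply: is_lim_seq_ext dist => m; rewrite sum_exponent.
have lim2 J : is_lim_seq (fun m => INR (exponent x0 (y m) J) /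
    \big[Rplus/0]_J INR (exponent x0 (y m) J)) (signed_part n J).
  by apply: is_lim_seq_ext (limP J) => m; rewrite sum_exponent.
have := main lim1 lim2 close compat eps (cond_pos eps) => ev.
apply: filter_imp (filter_and _ _ ev sup0) => m [h [s0 s1]].
have [_ ->] := green m s0 s1.
exact: C_NormedModule_mixin_compat1.
Qed.
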